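(* Suppose the model assumptions (i)–(vi) of the context hold along with the sequence of local alternative restrictions $R_1BR_2=\theta+\theta_0/\sqrt n$, $n=1,2,\dots$, where $\theta_0$ is a fixed $r_1\times r_2$ matrix with $\|\theta_0\|<\infty$. Then, as $n\to\infty$, $$\begin{pmatrix} n^{1/2}(\hat B_1-B)\\ n^{1/2}(\hat B_2-B)\\ n^{1/2}(\hat B_3-B)\\ n^{1/2}(\hat B_4-B)\end{pmatrix}\xrightarrow{d}\begin{pmatrix}\eta_1\\ \eta_2\\ \eta_3\\ \eta_4\end{pmatrix}\sim\mathcal N_{4p\times q}\left(\begin{pmatrix}0\\ \mu_2\\ \mu_3\\ \mu_4\end{pmatrix},\begin{pmatrix}\Sigma_{11}&\Sigma_{12}&\Sigma_{13}&\Sigma_{14}\\ \Sigma_{21}&\Sigma_{22}&\Sigma_{23}&\Sigma_{24}\\ \Sigma_{31}&\Sigma_{32}&\Sigma_{33}&\Sigma_{34}\\ \Sigma_{41}&\Sigma_{42}&\Sigma_{43}&\Sigma_{44}\end{pmatrix}\right),$$ where $\Sigma_{ij}=A_i\Lambda A_j'$ for $i,j=1,2,3,4$, with $P_2=R_2(R_2'R_2)^{-1}R_2'$ and $$A_1=(\Sigma K)^{-1}\otimes I_q,$$ $$A_2=A_1-\Big((\Sigma K)^{-1}R_1'(R_1(\Sigma K)^{-1}R_1')^{-1}R_1(\Sigma K)^{-1}\Big)\otimes P_2,$$ $$A_3=A_1-\Big(\Sigma^{-1}R_1'(R_1\Sigma^{-1}R_1')^{-1}R_1(\Sigma K)^{-1}\Big)\otimes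 P_2,$$ $$A_4=A_1-\Big(R_1'(R_1R_1')^{-1}R_1(\Sigma K)^{-1}\Big)\otimes P_2,$$ and $$\mu_2=-(\Sigma K)^{-1}R_1'(R_1(\Sigma K)^{-1}R_1')^{-1}\theta_0(R_2'R_2)^{-1}R_2',$$ $$\mu_3=-\Sigma^{-1}R_1'(R_1\Sigma^{-1}R_1')^{-1}\theta_0(R_2'R_2)^{-1}R_2',\qquad \mu_4=-R_1'(R_1R_1')^{-1}\theta_0(R_2'R_2)^{-1}R_2'.$$
   Context: Conventions: $'$ is transpose, $\otimes$ the Kronecker product, $I_m$ the identity matrix. For a matrix $A$, $\operatorname{vec}(A)$ denotes the column vector obtained by stacking the rows of $A$ (so $\operatorname{vec}(AYC)=(A\otimes C')\operatorname{vec}(Y)$). A random $a\times b$ matrix $Y$ is $\mathcal N_{a\times b}(\mu,\Omega)$ if $\operatorname{vec}(Y)$ is (possibly degenerate) $ab$-variate normal with mean $\operatorname{vec}(\mu)$ and covariance matrix $\Omega$. Model: for each sample size $n$, $Z=DB+E$, $X=D+\Delta$, $D=M+\Psi$, where $Z,E$ are $n\times q$, $D,X,\Delta,M,\Psi$ are $n\times p$, $B$ is the $p\times q$ matrix of regression coefficients, $M$ is nonrandom, and $E=(\epsilon_{ij})$, $\Delta=(\delta_{ij})$, $\Psi=(\psi_{ij})$ are random; $Z,X$ are observed. As $n$ grows, rows are appended to $M,E,\Delta,\Psi$. $R_1$ ($r_1\times p$), $R_2$ ($q\times r_2$), $\theta$ ($r_1\times r_2$) are known fixed matrices. Under the local alternatives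 the coefficient matrix $B=B^{(n)}$ is nonrandom and depends on $n$ (so that $R_1B^{(n)}R_2=\theta+\theta_0/\sqrt n$), and $B^{(n)}$ converges to a finite limit as $n\to\infty$; in the formulas below $B$ means $B^{(n)}$. Assumptions: (i) the $\epsilon_{ij}$ are independent with mean $0$, variance $\sigma_\epsilon^2$, third moment $\gamma_{1\epsilon}\sigma_\epsilon^3$, fourth moment $(\gamma_{2\epsilon}+3)\sigma_\epsilon^4$; (ii) the $\delta_{ij}$ are i.i.d. with mean $0$, variance $\sigma_\delta^2$, third moment $\gamma_{1\delta}\sigma_\delta^3$, fourth moment $(\gamma_{2\delta}+3)\sigma_\delta^4$; (iii) the $\psi_{ij}$ are i.i.d. with mean $0$, variance $\sigma_\psi^2$, third moment $\gamma_{1\psi}\sigma_\psi^3$, fourth moment $(\gamma_{2\psi}+3)\sigma_\psi^4$; (iv) $\Delta,\Psi,E$ are mutually independent; (v) the $n$-th row of $M$, written as a column vector $M_{(n)}\in\mathbb R^p$, converges to a finite vector $\sigma_M\in\mathbb R^p$ as $n\to\infty$; (vi) $\operatorname{rank}X=p$, $\operatorname{rank}R_1=r_1$, $\operatorname{rank}R_2=r_2$. All inverses written are assumed to exist. Notation: $\Sigma_X=n^{-1}M'M+\sigma_\psi^2I_p+\sigma_\delta^2I_p$, $\Sigma_D=n^{-1}M'M+\sigma_\psi^2I_p$, $K_X=\Sigma_X^{-1}\Sigma_D$, $\Sigma=\sigma_M\sigma_M'+\sigma_\psi^2I_p+\sigma_\delta^2I_p$, $K=\Sigma^{-1}(\Sigma-\sigma_\delta^2I_p)$.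 Further $\bar K_X=(\Sigma_X-\Sigma_D)\Sigma_X^{-1}$, $H=n^{-1/2}X'X-n^{1/2}\Sigma_X$, $h=n^{-1/2}X'(E-\Delta B)+n^{1/2}\sigma_\delta^2B$, and $\Lambda=\lim_{n\to\infty}\mathrm E[u_nu_n']$ (a $pq\times pq$ matrix; the limit exists), where $u_n\in\mathbb R^{pq}$ is obtained by stacking the columns of the $q\times p$ matrix $h'+B'\bar K_XH$. Estimators: $\hat B_1=K_X^{-1}(X'X)^{-1}X'Z$ (unrestricted), and the restricted estimators $$\hat B_2=\hat B_1-(X'XK_X)^{-1}R_1'[R_1(X'XK_X)^{-1}R_1']^{-1}(R_1\hat B_1R_2-\theta)(R_2'R_2)^{-1}R_2',$$ $$\hat B_3=\hat B_1-(X'X)^{-1}R_1'[R_1(X'X)^{-1}R_1']^{-1}(R_1\hat B_1R_2-\theta)(R_2'R_2)^{-1}R_2',$$ $$\hat B_4=\hat B_1-R_1'(R_1R_1')^{-1}(R_1\hat B_1R_2-\theta)(R_2'R_2)^{-1}R_2'.$$ *)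

(* Defs.v *)
From HB Require Import structures.
From mathcomp Require Import all_boot all_order all_algebra.
From mathcomp Require Import mxtens.
From mathcomp Require Import all_classical all_reals all_analysis.

Set Implicit Arguments.
Unset Strict Implicit.
Unset Printing Implicit Defensive.

Import Order.TTheory GRing.Theory Num.Theory.
Import numFieldNormedType.Exports.

Local Open Scope classical_set_scope.
Local Open Scope ring_scope.

Section Vectorization.
Context {R : realType}.

(* mxtens_unindex k = (k %/ b, k %% b): the ROWS of A are stacked.  The
   Kronecker product [tensmx], written [*t], uses the same indexing. *)
Definition vec {a b} (A : 'M[R]_(a, b)) : 'cV[R]_(a * b) :=
  \col_k A (mxtens_unindex k).1 (mxtens_unindex k).2.

Lemma vec_mulmx a b c e (A : 'M[R]_(a, b)) (Y : 'M[R]_(b, c))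
    (C : 'M[R]_(c, e)) :
  vec (A *m Y *m C) = (A *t C^T) *m vec Y.
Proof.
apply/colP => k; rewrite !mxE.
rewrite (reindex (@mxtens_index b c)) /=; last first.
  by exists (@mxtens_unindex b c) => i _;
    rewrite ?mxtens_indexK ?mxtens_unindexK.
under [RHS]eq_bigr => ij _ do rewrite !mxE !mxtens_indexK.
rewrite -(pair_bigA _ (fun i j => A (mxtens_unindex k).1 i *
  C j (mxtens_unindex k).2 * Y i j)) /= exchange_big /=.
apply: eq_bigr => j _; rewrite !mxE mulr_suml; apply: eq_bigr => i _.
by rewrite mulrAC.
Qed.

Definition col4 {a b} (A1 A2 A3 A4 : 'M[R]_(a, b)) :
    'M[R]_(a + (a + (a + a)), b) :=
  col_mx A1 (col_mx A2 (col_mx A3 A4)).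

Definition row4 {a b} (A1 A2 A3 A4 : 'M[R]_(a, b)) :
    'M[R]_(a, b + (b + (b + b))) :=
  row_mx A1 (row_mx A2 (row_mx A3 A4)).

Definition block4 {a b} (S : 'I_4 -> 'I_4 -> 'M[R]_(a, b)) :
    'M[R]_(a + (a + (a + a)), b + (b + (b + b))) :=
  let r i := row4 (S i 0) (S i 1) (S i 2%:R) (S i 3%:R) in
  col4 (r 0) (r 1) (r 2%:R) (r 3%:R).

Lemma mul4nDl a b :
  (a * b + (a * b + (a * b + a * b)) = (a + (a + (a + a))) * b)%N.
Proof. by rewrite !mulnDl. Qed.

(* Only the dimension is cast: vec (col4 Y1 Y2 Y3 Y4) lists the entries of
   vec Y1, vec Y2, vec Y3, vec Y4 in this order (vec_col4 below). *)
Definition block4_vec {a b} (S : 'I_4 -> 'I_4 -> 'M[R]_(a * b)) :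
    'M[R]_((a + (a + (a + a))) * b) :=
  castmx (mul4nDl a b, mul4nDl a b) (block4 S).

Lemma vec_col_mx a1 a2 b (Y1 : 'M[R]_(a1, b)) (Y2 : 'M[R]_(a2, b)) :
  vec (col_mx Y1 Y2) =
  castmx (esym (mulnDl a1 a2 b), erefl 1%N) (col_mx (vec Y1) (vec Y2)).
Proof.
apply/colP => k; case: (mxtens_indexP k) => i j.
rewrite castmxE [LHS]mxE mxtens_indexK /= cast_ord_id.
case: (split_ordP i) => i' ->.
  rewrite col_mxEu (_ : cast_ord _ _ = lshift _ (mxtens_index (i', j)));
    last exact/val_inj.
  by rewrite col_mxEu mxE mxtens_indexK.
rewrite col_mxEd (_ : cast_ord _ _ = rshift _ (mxtens_index (i', j))).
  by rewrite col_mxEd mxE mxtens_indexK.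
by apply/val_inj => /=; rewrite mulnDl addnA.
Qed.

Lemma vec_col4 a b (Y1 Y2 Y3 Y4 : 'M[R]_(a, b)) :
  vec (col4 Y1 Y2 Y3 Y4) =
  castmx (mul4nDl a b, erefl 1%N) (col4 (vec Y1) (vec Y2) (vec Y3) (vec Y4)).
Proof.
have castcol m1 m2 m2' (e : m2 = m2') (U : 'cV[R]_m1) (V : 'cV[R]_m2) :
    col_mx U (castmx (e, erefl 1%N) V) =
    castmx (congr1 (addn m1) e, erefl 1%N) (col_mx U V).
  by case: m2' / e; rewrite !castmx_id.
rewrite /col4 !vec_col_mx !(castcol, castmx_comp) /=.
by congr (castmx (_, _) _); exact: eq_irrelevance.
Qed.

End Vectorization.

Section Probability.
Context {R : realType}.

Definition random_mx d (T : measurableType d) a b (Y : T -> 'M[R]_(a, b)) :=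
  forall i j, measurable_fun setT (fun w => Y w i j).

Definition cvg_in_dist d (T : measurableType d) (P : probability T R)
    d' (T' : measurableType d') (P' : probability T' R) a b
    (Y : nat -> T -> 'M[R]_(a, b)) (eta : T' -> 'M[R]_(a, b)) :=
  [/\ forall n, random_mx (Y n),
      random_mx eta &
      forall f : 'M[R]_(a, b) -> R, continuous f ->
        (exists C : R, forall x, `|f x| <= C) ->
        'E_P[f \o Y n]%E @[n --> \oo] --> 'E_P'[f \o eta]%E].

(* Univariate normal law with mean m and variance v >= 0; normal_prob takes
   the standard deviation and is not the Dirac mass when it is 0. *)
Definition normal_law (m v : R) (A : set R) : \bar R :=
  if v == 0 then \d_m A else normal_prob m (Num.sqrt v) A.

(* Y ~ N_{a x b}(mu, Omega), possibly degenerate: every linear combination of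
   the entries of vec Y is univariate normal with the matching mean and
   variance. *)
Definition normal_mx d (T : measurableType d) (P : probability T R) a b
    (Y : T -> 'M[R]_(a, b)) (mu : 'M[R]_(a, b)) (Omega : 'M[R]_(a * b)) :=
  [/\ random_mx Y,
      Omega^T = Omega &
      forall c : 'cV[R]_(a * b),
        let v := (c^T *m Omega *m c) 0 0 in
        0 <= v /\
        forall A : set R, measurable A ->
          P ((fun w => (c^T *m vec (Y w)) 0 0) @^-1` A) =
          normal_law ((c^T *m vec mu) 0 0) v A].

Definition mutually_independent d (T : measurableType d) (P : probability T R)
    (I : eqType) (F : I -> set (set T)) :=
  forall (J : seq I) (A : I -> set T), uniq J ->
    (forall i, i \in J -> F i (A i)) ->
    P (\big[setI/setT]_(i <- J) A i) = (\prod_(i <- J) P (A i))%E.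

Definition sigma_RV d (T : measurableType d) (P : probability T R)
    (X : {RV P >-> R}) : set (set T) :=
  preimage_set_system setT X measurable.

Definition sigma_array d (T : measurableType d) (P : probability T R) k
    (X : nat -> 'I_k -> {RV P >-> R}) : set (set T) :=
  <<s \bigcup_i \bigcup_j sigma_RV (X i j) >>.

Definition independent_array d (T : measurableType d) (P : probability T R) k
    (X : nat -> 'I_k -> {RV P >-> R}) :=
  mutually_independent P (fun ij : nat * 'I_k => sigma_RV (X ij.1 ij.2)).

Definition iid_array d (T : measurableType d) (P : probability T R) k
    (X : nat -> 'I_k -> {RV P >-> R}) :=
  independent_array X /\
  forall i j i' j' (A : set R), measurable A ->
    distribution P (X i j) A = distribution P (X i' j') A.

(* The fourth moment is finite, so X has integrable powers up to 4. *)
Definition has_moments d (T : measurableType d) (P : probability T R)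
    (X : T -> R) (s g1 g2 : R) :=
  [/\ 'E_P[X]%E = 0%:E,
      'V_P[X]%E = (s ^+ 2)%:E,
      'E_P[(fun w => X w ^+ 3)%R]%E = (g1 * s ^+ 3)%:E &
      'E_P[(fun w => X w ^+ 4)%R]%E = ((g2 + 3) * s ^+ 4)%:E].

Definition array_mx k (X : nat -> 'I_k -> R) n : 'M[R]_(n, k) :=
  \matrix_(i < n, j < k) X i j.

Definition random_array_mx d (T : measurableType d) (P : probability T R) k
    (X : nat -> 'I_k -> {RV P >-> R}) n (w : T) : 'M[R]_(n, k) :=
  array_mx (fun i j => X i j w) n.

End Probability.

Section Model.
Context {R : realType}.

Definition SigmaD n p (M : 'M[R]_(n, p)) (spsi : R) : 'M[R]_p :=
  n%:R^-1 *: (M^T *m M) + (spsi ^+ 2)%:M.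

Definition SigmaX n p (M : 'M[R]_(n, p)) (spsi sdelta : R) : 'M[R]_p :=
  n%:R^-1 *: (M^T *m M) + (spsi ^+ 2)%:M + (sdelta ^+ 2)%:M.

Definition KX n p (M : 'M[R]_(n, p)) (spsi sdelta : R) : 'M[R]_p :=
  invmx (SigmaX M spsi sdelta) *m SigmaD M spsi.

Definition KbarX n p (M : 'M[R]_(n, p)) (spsi sdelta : R) : 'M[R]_p :=
  (SigmaX M spsi sdelta - SigmaD M spsi) *m invmx (SigmaX M spsi sdelta).

Definition Sigma p (sigmaM : 'cV[R]_p) (spsi sdelta : R) : 'M[R]_p :=
  sigmaM *m sigmaM^T + (spsi ^+ 2)%:M + (sdelta ^+ 2)%:M.

Definition Kmx p (sigmaM : 'cV[R]_p) (spsi sdelta : R) : 'M[R]_p :=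
  invmx (Sigma sigmaM spsi sdelta) *m
  (Sigma sigmaM spsi sdelta - (sdelta ^+ 2)%:M).

Definition Hmx n p (M X : 'M[R]_(n, p)) (spsi sdelta : R) : 'M[R]_p :=
  (Num.sqrt n%:R)^-1 *: (X^T *m X) -
  Num.sqrt n%:R *: SigmaX M spsi sdelta.

Definition hmx n p q (X Delta : 'M[R]_(n, p)) (E : 'M[R]_(n, q))
    (B : 'M[R]_(p, q)) (sdelta : R) : 'M[R]_(p, q) :=
  (Num.sqrt n%:R)^-1 *: (X^T *m (E - Delta *m B)) +
  (Num.sqrt n%:R * sdelta ^+ 2) *: B.

(* The transpose turns the row-stacking [vec] into the stacking of the columns
   of the q x p matrix h' + B' KbarX H. *)
Definition uvec n p q (M X Delta : 'M[R]_(n, p)) (E : 'M[R]_(n, q))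
    (B : 'M[R]_(p, q)) (spsi sdelta : R) : 'cV[R]_(p * q) :=
  vec ((hmx X Delta E B sdelta)^T +
       B^T *m KbarX M spsi sdelta *m Hmx M X spsi sdelta)^T.

Definition second_moment_mx d (T : measurableType d) (P : probability T R) k
    (u : T -> 'cV[R]_k) : 'M[R]_k :=
  \matrix_(i, j) fine 'E_P[(fun w => (u w *m (u w)^T) i j)%R]%E.

Definition lim_mx a b (S : nat -> 'M[R]_(a, b)) : 'M[R]_(a, b) :=
  \matrix_(i, j) limn (fun n => S n i j).

Definition gain p r1 (G : 'M[R]_p) (R1 : 'M[R]_(r1, p)) : 'M[R]_(p, r1) :=
  G *m R1^T *m invmx (R1 *m G *m R1^T).

Definition gain_id p r1 (R1 : 'M[R]_(r1, p)) : 'M[R]_(p, r1) :=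
  R1^T *m invmx (R1 *m R1^T).

Definition Bhat1 n p q (K : 'M[R]_p) (X : 'M[R]_(n, p)) (Z : 'M[R]_(n, q)) :
    'M[R]_(p, q) :=
  invmx K *m invmx (X^T *m X) *m X^T *m Z.

Definition restricted p q r1 r2 (W : 'M[R]_(p, r1)) (R1 : 'M[R]_(r1, p))
    (R2 : 'M[R]_(q, r2)) (theta : 'M[R]_(r1, r2)) (B1 : 'M[R]_(p, q)) :
    'M[R]_(p, q) :=
  B1 - W *m (R1 *m B1 *m R2 - theta) *m invmx (R2^T *m R2) *m R2^T.

End Model.

(* Main.v *)
(* With W = X'X / n, the estimation error is exactly
   sqrt n (B1 - B) = K_X^-1 W^-1 U with vec U = u_n, and the restricted
   estimators are affine functions of it whose coefficients (the gains are
   invariant under scaling of W) converge in probability.  The entries of U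
   are, up to an L^2-negligible error and with convergent weights, normalized
   sums over the independent rows of the variables psi, delta, eps and of their
   centered products.  A Lindeberg argument gives the limit of
   E[cos (a + t . u_n)] as that of the Gaussian vector with covariance Lambda;
   Slutsky's lemma transfers it to the four estimators.  Tightness and these
   limits imply weak convergence, since on a box every continuous function is
   uniformly approximated by finite sums of functions cos (a + t . x), obtained
   from Bernstein polynomials in the variables sin (lam x_i). *)
Require Import Defs.
From HB Require Import structures.
From mathcomp Require Import all_boot all_order all_algebra.
From mathcomp Require Import mxtens.
From mathcomp Require Import all_classical all_reals all_analysis.
From mathcomp Require Import measurable_realfun.
From mathcomp Require Import ring lra.

Set Implicit Arguments.
Unset Strict Implicit.
Unset Printing Implicit Defensive.

Import Order.TTheory GRing.Theory Num.Theory.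
Import numFieldNormedType.Exports.

Local Open Scope classical_set_scope.
Local Open Scope ring_scope.

(** * Expectations of real random variables *)

Section Expectation.
Context {d} {T : measurableType d} {R : realType} (P : probability T R).
Implicit Types X Y : T -> R.

(** The error variables enter [u_n] through products, and four moments of the factors give only
    second moments of a square. For a product of two different variables independence still yields a
    fourth moment, hence Lindeberg's condition uniformly over the rows; for a square it does not,
    and a common law of the rows is used instead. [psi] and [delta] have one. The rows of [eps]
    share only moments, but no square of an [eps] occurs in [u_n]. Transforms are kept real: the
    functions cos (a + t . x), with a free phase a, carry both parts of the characteristic function,
    and their linear combinations are closed under products. The limit is asserted to be the law of
    some [eta], so a Gaussian matrix with a possibly singular covariance must be built: its
    quadratic form is written as a sum of squares, with one standard normal per square. [Lambda] is
    by definition a limit of second moments; approximation in L^2, rather than in probability only,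
    is what makes these moments converge to the covariance of the limit law. *)

Definition integ X := P.-integrable [set: T] (EFin \o X).
(** [Rintegral] sends an infinite integral to 0, so the linearity rules below carry [integ]. *)
Definition Ex X : R := Rintegral P [set: T] X.

Lemma integ_measurable X : integ X -> measurable_fun setT X.
Proof. by move=> /measurable_int/measurable_EFinP. Qed.

Lemma expectationE X : integ X -> 'E_P[X]%E = (Ex X)%:E.
Proof.
move=> iX; rewrite unlock /Ex /Rintegral fineK//.
exact: (integrable_fin_num measurableT iX).
Qed.

Lemma Ex_expectation X : Ex X = fine 'E_P[X]%E.
Proof. by rewrite unlock. Qed.

Lemma integ_le X Y : measurable_fun setT X -> integ Y ->
  (forall w, `|X w| <= Y w) -> integ X.
Proof.
move=> mX iY XY; apply: (le_integrable measurableT _ _ iY).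
  exact/measurable_EFinP.
by move=> w _ /=; rewrite lee_fin (le_trans (XY w))// ler_norm.
Qed.

Lemma integ_cst c : integ (cst c).
Proof. exact: finite_measure_integrable_cst. Qed.

Lemma integ_bounded X C : measurable_fun setT X -> (forall w, `|X w| <= C) ->
  integ X.
Proof. by move=> mX XC; apply: (integ_le (Y := cst C)) => //; exact: integ_cst. Qed.

Lemma integD X Y : integ X -> integ Y -> integ (fun w => X w + Y w).
Proof. by move=> iX iY; have := integrableD measurableT iX iY. Qed.

Lemma integZ c X : integ X -> integ (fun w => c * X w).
Proof. by move=> iX; have := integrableZl measurableT c iX. Qed.

Lemma integB X Y : integ X -> integ Y -> integ (fun w => X w - Y w).
Proof. by move=> iX iY; have := integrableB measurableT iX iY. Qed.

Lemma integ_norm X : integ X -> integ (fun w => `|X w|).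
Proof. by move=> iX; exact: (integrable_norm iX). Qed.

Lemma integ_sum I (s : seq I) (Q : pred I) (X : I -> T -> R) :
  (forall i, Q i -> integ (X i)) -> integ (fun w => \sum_(i <- s | Q i) X i w).
Proof.
move=> iX; elim: s => [|i s IH].
  by under eq_fun do rewrite big_nil; exact: integ_cst.
under eq_fun do rewrite big_cons.
by case: (boolP (Q i)) => // Qi; apply: integD => //; exact: iX.
Qed.

Lemma ExD X Y : integ X -> integ Y -> Ex (fun w => X w + Y w) = Ex X + Ex Y.
Proof. by move=> iX iY; exact: RintegralD. Qed.

Lemma ExB X Y : integ X -> integ Y -> Ex (fun w => X w - Y w) = Ex X - Ex Y.
Proof. by move=> iX iY; exact: RintegralB. Qed.

Lemma ExZ c X : integ X -> Ex (fun w => c * X w) = c * Ex X.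
Proof. by move=> iX; exact: RintegralZl. Qed.

Lemma Ex_cst c : Ex (fun=> c) = c.
Proof.
by rewrite /Ex Rintegral_cst//= probability_setT mulr1.
Qed.

Lemma Ex_sum I (s : seq I) (Q : pred I) (X : I -> T -> R) :
  (forall i, Q i -> integ (X i)) ->
  Ex (fun w => \sum_(i <- s | Q i) X i w) = \sum_(i <- s | Q i) Ex (X i).
Proof.
move=> iX; elim: s => [|i s IH].
  by under eq_fun do rewrite big_nil; rewrite big_nil Ex_cst.
under eq_fun do rewrite big_cons; rewrite big_cons.
case: ifP => // Qi; rewrite -IH ExD//; first exact: iX.
exact: integ_sum.
Qed.

Lemma Ex_le X Y : integ X -> integ Y -> (forall w, X w <= Y w) -> Ex X <= Ex Y.
Proof. by move=> iX iY XY; apply: le_Rintegral. Qed.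

Lemma Ex_ge0 X : (forall w, 0 <= X w) -> 0 <= Ex X.
Proof. by move=> X0; apply: Rintegral_ge0. Qed.

Lemma Ex_norm X : integ X -> `|Ex X| <= Ex (fun w => `|X w|).
Proof. by move=> iX; exact: le_normr_Rintegral. Qed.

Lemma Ex_norm_le X Y : integ X -> integ Y -> (forall w, `|X w| <= Y w) ->
  `|Ex X| <= Ex Y.
Proof.
move=> iX iY XY; apply: le_trans (Ex_norm iX) _; apply: Ex_le => //.
exact: integ_norm.
Qed.

Lemma Ex_norm_bounded X C : integ X -> (forall w, `|X w| <= C) -> `|Ex X| <= C.
Proof.
by move=> iX XC; rewrite -[C]Ex_cst; apply: Ex_norm_le => //; exact: integ_cst.
Qed.

Lemma integ_indic (A : set T) : measurable A -> integ (\1_A).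
Proof.
move=> mA; apply: (integ_bounded (C := 1)); first exact: measurable_indic.
by move=> w; rewrite indicE; case: (_ \in _); rewrite ?normr0 ?normr1 ?ler01.
Qed.

Lemma Ex_indic (A : set T) : measurable A -> Ex (\1_A) = fine (P A).
Proof. by move=> mA; rewrite Ex_expectation expectation_indic. Qed.

Lemma integ_sqr_mul X Y : measurable_fun setT X -> measurable_fun setT Y ->
  integ (fun w => X w ^+ 2) -> integ (fun w => Y w ^+ 2) ->
  integ (fun w => X w * Y w).
Proof.
move=> mX mY iX iY; apply: (integ_le _ (integD iX iY)).
  exact: measurable_funM.
move=> w; rewrite normrM -(real_normK (num_real (X w))) -(real_normK (num_real (Y w))).
by have := sqr_ge0 (`|X w| - `|Y w|); have := normr_ge0 (X w);
  have := normr_ge0 (Y w); nra.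
Qed.

Lemma integ_sqr X : measurable_fun setT X -> integ (fun w => X w ^+ 2) -> integ X.
Proof.
move=> mX iX; apply: (integ_le mX (integD iX (integ_cst 1))) => w /=.
by rewrite -(real_normK (num_real (X w))); have := sqr_ge0 (`|X w| - 1); have := normr_ge0 (X w); nra.
Qed.

(** The variance of [|X|] about its mean is nonnegative. *)
Lemma Ex_sqr_ge X : measurable_fun setT X -> integ (fun w => X w ^+ 2) ->
  Ex (fun w => `|X w|) ^+ 2 <= Ex (fun w => X w ^+ 2).
Proof.
move=> mX iX; have iX1 := integ_norm (integ_sqr mX iX).
set m := Ex (fun w => `|X w|).
have : 0 <= Ex (fun w => (`|X w| - m) ^+ 2) by apply: Ex_ge0 => w; exact: sqr_ge0.
have -> : (fun w => (`|X w| - m) ^+ 2) =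
    (fun w => (X w ^+ 2 - (2 * m) * `|X w|) + cst (m ^+ 2) w).
  by apply/funext => w /=; rewrite -(real_normK (num_real (X w))); ring.
have i1 := integZ (2 * m) iX1.
by rewrite (ExD (integB iX i1) (integ_cst _)) ExB// ExZ// Ex_cst -/m; lra.
Qed.

Lemma chebyshev_Ex X (e : R) : measurable_fun setT X ->
  integ (fun w => X w ^+ 2) -> 0 < e ->
  fine (P [set w | e <= `|X w|]) <= Ex (fun w => X w ^+ 2) / e ^+ 2.
Proof.
move=> mX iX e0.
have mA : measurable [set w | e <= `|X w|].
  have mf : measurable_fun setT (fun w => `|X w|) by exact: measurableT_comp.
  have := mf measurableT `[e, +oo[%classic (measurable_itv _).
  rewrite setTI; congr (measurable _).
  by apply/seteqP; split => w /=; rewrite in_itv/= andbT.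
rewrite -Ex_indic// ler_pdivlMr ?exprn_gt0// mulrC -ExZ; last exact: integ_indic.
apply: Ex_le => //; first by apply/integZ/integ_indic.
move=> w; rewrite indicE; case: (boolP (w \in _)) => [|_]; last first.
  by rewrite mulr0 sqr_ge0.
by rewrite inE /= mulr1 -(real_normK (num_real (X w))) => h; rewrite ler_pXn2r ?nnegrE ?(ltW e0).
Qed.

Lemma cvg_EFin' (u : nat -> R) l : u n @[n --> \oo] --> l ->
  (u n)%:E @[n --> \oo] --> l%:E.
Proof. by move=> ul; apply/cvg_EFin => //; near=> n. Unshelve. all: by end_near. Qed.

Lemma dominated_Ex (X : nat -> T -> R) X0 Y :
  (forall n, measurable_fun setT (X n)) -> measurable_fun setT X0 ->
  (forall w, X n w @[n --> \oo] --> X0 w) -> integ Y ->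
  (forall n w, `|X n w| <= Y w) -> Ex (X n) @[n --> \oo] --> Ex X0.
Proof.
move=> mX mX0 XX0 iY XY.
have h1 n : measurable_fun setT (EFin \o X n) by exact/measurable_EFinP.
have h2 : measurable_fun setT (EFin \o X0) by exact/measurable_EFinP.
have h3 : {ae P, forall w, [set: T] w ->
    (EFin \o X n) w @[n --> \oo] --> (EFin \o X0) w}.
  by apply: aeW => w _; exact: cvg_EFin'.
have h4 : {ae P, forall w n, [set: T] w -> (`|(EFin \o X n) w| <= (EFin \o Y) w)%E}.
  by apply: aeW => w n _; rewrite /= lee_fin.
have [iX0 _ cX] := dominated_convergence measurableT h1 h2 h3 iY h4.
have h : (Ex (X n))%:E @[n --> \oo] --> (Ex X0)%:E.
  rewrite -[X in _ --> X]/(fine _)%:E fineK; last exact: (integrable_fin_num measurableT iX0).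
  under eq_fun do (rewrite /Ex /Rintegral fineK; last
    exact: (integrable_fin_num measurableT (integ_le (mX _) iY (XY _)))).
  exact: cX.
by have /fine_cvgP[] := h.
Qed.

End Expectation.

(** * Weak convergence from cosine transforms *)

Section StepOperator.
Context {R : realType} {I : eqType}.
Implicit Types (x : I -> R) (G H : (I -> nat) -> R) (l : seq I) (s : I -> nat).

Definition bump_at i s : I -> nat := fun j => (s j + (i == j))%N.

(* The expectation of [G] at the counts obtained from [s] by tossing, for each
   entry [i] of [l], an independent coin of bias [x i] that increments [s i]:
   a coordinate-free form of the tensor Bernstein operator. *)
Fixpoint coin x l G s : R :=
  if l is i :: l' then x i * coin x l' G (bump_at i s) + (1 - x i) * coin x l' G s
  else G s.

Lemma coin_le x l G H : (forall i, 0 <= x i <= 1) -> (forall s, G s <= H s) ->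
  forall s, coin x l G s <= coin x l H s.
Proof.
move=> x01 GH; elim: l => [//|i l IH] s /=.
have /andP[x0 x1] := x01 i.
by apply: lerD; apply: ler_wpM2l => //; rewrite ?subr_ge0.
Qed.

Lemma coin_cst x l c s : coin x l (fun=> c) s = c.
Proof. by elim: l s => [//|i l IH] s /=; rewrite !IH; ring. Qed.

Lemma coinD x l G H s :
  coin x l (fun s => G s + H s) s = coin x l G s + coin x l H s.
Proof. by elim: l s => [//|i l IH] s /=; rewrite !IH; ring. Qed.

Lemma coinZ x l c G s : coin x l (fun s => c * G s) s = c * coin x l G s.
Proof. by elim: l s => [//|i l IH] s /=; rewrite !IH; ring. Qed.

Lemma coin_sum x l J (r : seq J) (G : J -> (I -> nat) -> R) s :
  coin x l (fun s => \sum_(j <- r) G j s) s = \sum_(j <- r) coin x l (G j) s.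
Proof.
elim: r => [|j r IH].
  rewrite big_nil -[RHS](coin_cst x l 0 s); congr (coin _ _ _ _).
  by apply/funext => t; rewrite big_nil.
rewrite big_cons -IH -coinD; congr (coin _ _ _ _).
by apply/funext => t; rewrite big_cons.
Qed.

(** Mean and variance of a count: each of the [count_mem j l] independent tosses adds [x j] to the
    mean and [x j * (1 - x j)] to the variance. *)
Lemma coin_sqr x l j c s : coin x l (fun s => ((s j)%:R - c) ^+ 2) s =
  ((s j)%:R + (count_mem j l)%:R * x j - c) ^+ 2 +
  (count_mem j l)%:R * (x j * (1 - x j)).
Proof.
elim: l s => [|i l IH] s /=; first by rewrite !mul0r !addr0.
rewrite !IH /bump_at; have [<-|ij] := eqVneq i j; last by rewrite !addn0 !add0n; ring.
by rewrite (_ : nat_of_bool true = 1%N)// !natrD; ring.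
Qed.

(** The operator is positive and fixes constants, so a pointwise error bound passes through it. *)
Lemma coin_norm x l G c K s : (forall i, 0 <= x i <= 1) ->
  (forall s, `|G s - c| <= K s) -> `|coin x l G s - c| <= coin x l K s.
Proof.
move=> x01 GK; rewrite ler_norml; apply/andP; split.
  rewrite lerBrDr -[in leLHS](coin_cst x l c s) -mulN1r -coinZ -coinD.
  by apply: coin_le => // t; have := GK t; rewrite ler_norml => /andP[h _]; lra.
rewrite lerBlDr -[in leRHS](coin_cst x l c s) -coinD.
by apply: coin_le => // t; have := GK t; rewrite ler_norml => /andP[_ h]; lra.
Qed.

Lemma coin_bounded x l G C s : (forall i, 0 <= x i <= 1) ->
  (forall s, `|G s| <= C) -> `|coin x l G s| <= C.
Proof.
move=> x01 GC; rewrite -(coin_cst x l C s) -[X in `|X|]subr0.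
by apply: coin_norm => // t; rewrite subr0.
Qed.

End StepOperator.

Lemma cvg_mx {R : realType} {T : Type} {F : set_system T} {FF : Filter F} a b
    (f : T -> 'M[R]_(a, b)) (l : 'M[R]_(a, b)) :
  (forall i j, f x i j @[x --> F] --> l i j) -> f x @[x --> F] --> l.
Proof.
move=> h A /= [Q hQ QA].
have : \forall x \near F, forall i j, Q i j (f x i j).
  apply: filter_forall => i; apply: filter_forall => j.
  exact: h (hQ i j).
by apply: filterS => x hx; exact: QA.
Qed.

Lemma cvg_mx_coord {R : realType} {T : Type} {F : set_system T} {FF : Filter F} a b
    (f : T -> 'M[R]_(a, b)) (l : 'M[R]_(a, b)) i j :
  f x @[x --> F] --> l -> f x i j @[x --> F] --> l i j.
Proof.
by move=> h; apply: (@cvg_comp _ _ _ f (fun M : 'M[R]_(a, b) => M i j) _ _ _ h);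
  exact: coord_continuous.
Qed.

(** * Uniform continuity on the unit cube *)

Section HeineCantor.
Context {R : realType} {m : nat}.
Implicit Types (F : 'rV[R]_m -> R).

(** Compactness enters as the near-covering property, which turns a locally valid [del] into one for
    the whole cube. Only [x] is confined to the cube; [z] may be any nearby point. *)
Lemma heine_rV F (e : R) : continuous F -> 0 < e ->
  exists2 del : R, 0 < del & forall x z : 'rV[R]_m,
    (forall i, 0 <= x 0 i <= 1) -> (forall i, `|x 0 i - z 0 i| < del) ->
    `|F x - F z| < e.
Proof.
move=> cF e0.
pose K := [set x : 'rV[R]_m | forall i, `[0, 1]%classic (x ord0 i)].
have cK : compact K.
  exact: (@rV_compact _ m (fun=> `[0%R:R, 1]%classic) (fun i => @segment_compact R 0 1)).
have ncK : near_covering K by apply/compact_near_coveringP.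
pose Q (del : R) (x : 'rV[R]_m) := forall z : 'rV[R]_m,
  (forall i, `|x 0 i - z 0 i| < del) -> `|F x - F z| < e.
have /(ncK R (0 : R)^'+ Q) : forall x, K x ->
    \forall x' \near x & del \near (0 : R)^'+, Q del x'.
  move=> x Kx.
  have := cF x; move/cvgrPdist_lt => /(_ (e / 2)).
  rewrite divr_gt0// => /(_ isT) /nbhs_ballP [r /= r0 hr].
  (* The radius is halved so that both [y] and any [z] within [del] of [y] stay in the ball of
     radius [r] about [x]. *)
  exists ([set y | ball x (r / 2) y], [set del | 0 < del < r / 2]); first split => /=.
  - by apply: nbhsx_ballx; rewrite divr_gt0.
  - by near=> del; apply/andP; split; near: del;
      [exact: nbhs_right_gt|apply: nbhs_right_lt; rewrite divr_gt0].
  move=> [y del]/= [xy /andP[d0 d1]] z yz.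
  have h1 : `|F x - F y| < e / 2.
    by apply: hr; apply: le_ball xy; lra.
  have h2 : `|F x - F z| < e / 2.
    apply: hr; rewrite [r](_ : _ = r / 2 + r / 2); last lra.
    apply: (ball_triangle xy); split; first by rewrite divr_gt0.
    by move=> i j; rewrite (ord1 i); exact: lt_trans (yz j) d1.
  rewrite -(subrKA (F x)) (le_lt_trans (ler_normD _ _))//.
  by rewrite distrC in h1; lra.
move=> [del /= del0 hdel].
have d2 : 0 < del / 2 by rewrite divr_gt0.
exists (del / 2) => // x z x01 xz.
apply: (hdel (del / 2)) => //=.
  by rewrite sub0r normrN gtr0_norm//; lra.
Unshelve. all: by end_near. Qed.

(** If some coordinate of [z] is at least [del] away from [x], the trivial bound 2C is at most 2C /
    del^2 times the squared distance. A quadratic error is what [coin_sqr] averages exactly. *)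
Lemma heine_rV_sqr F (C e : R) : continuous F -> (forall x, `|F x| <= C) -> 0 < e ->
  exists2 D : R, 0 <= D & forall x z : 'rV[R]_m, (forall i, 0 <= x 0 i <= 1) ->
    `|F z - F x| <= e + D * \sum_i (z 0 i - x 0 i) ^+ 2.
Proof.
move=> cF FC e0; have [del d0 hdel] := heine_rV cF e0.
have C0 : 0 <= C by apply: le_trans (FC 0).
have D0 : 0 <= 2 * C / del ^+ 2 by rewrite divr_ge0 ?mulr_ge0 ?exprn_ge0 ?(ltW d0).
exists (2 * C / del ^+ 2) => // x z x01.
have S0 : 0 <= \sum_i (z 0 i - x 0 i) ^+ 2 by apply: sumr_ge0 => i _; exact: sqr_ge0.
have [h|] := pselect (forall i, `|x 0 i - z 0 i| < del).
  rewrite distrC (le_trans (ltW (hdel _ _ x01 h)))// lerDl; exact: mulr_ge0.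
move=> /existsNP[i /negP]; rewrite -leNgt => hi.
have h1 : `|F z - F x| <= 2 * C.
  by rewrite (le_trans (ler_normB _ _))//; have := FC z; have := FC x; lra.
have h2 : del ^+ 2 <= \sum_i (z 0 i - x 0 i) ^+ 2.
  rewrite (bigD1 i)//= -[leLHS]addr0 lerD//; last first.
    by apply: sumr_ge0 => j _; exact: sqr_ge0.
  rewrite (_ : (z 0 i - x 0 i) ^+ 2 = (x 0 i - z 0 i) ^+ 2); last ring.
  by rewrite -[leRHS]real_normK ?num_real// ler_pXn2r ?nnegrE ?(ltW d0).
have h3 : 2 * C / del ^+ 2 * del ^+ 2 = 2 * C by field; rewrite gt_eqF.
by have := ler_wpM2l D0 h2; lra.
Qed.

End HeineCantor.

(** * Trigonometric sums and approximation on a box *)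

Section Trigonometric.
Context {R : realType} {m : nat}.
Implicit Types (g h : 'rV[R]_m -> R) (t x : 'rV[R]_m).

Definition dotv t x : R := \sum_i t 0 i * x 0 i.

Lemma dotvDl t u x : dotv (t + u) x = dotv t x + dotv u x.
Proof. by rewrite /dotv -big_split/=; apply: eq_bigr => i _; rewrite !mxE mulrDl. Qed.

Lemma dotvNl t x : dotv (- t) x = - dotv t x.
Proof. by rewrite /dotv -sumrN; apply: eq_bigr => i _; rewrite !mxE mulNr. Qed.

(** A triple [(c, a, t)] encodes c cos (a + t . x); the phase [a] makes constants and sines
    available in the same form. *)
Definition trig_sum (s : seq (R * R * 'rV[R]_m)) x : R :=
  \sum_(u <- s) u.1.1 * cos (u.1.2 + dotv u.2 x).

Definition is_trig g := exists s, g = trig_sum s.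

Lemma is_trig_cos a t : is_trig (fun x => cos (a + dotv t x)).
Proof. by exists [:: (1, a, t)]; apply/funext => x; rewrite /trig_sum big_seq1 mul1r. Qed.

Lemma is_trig_cst c : is_trig (fun=> c).
Proof.
exists [:: (c, 0, 0)]; apply/funext => x; rewrite /trig_sum big_seq1/= add0r.
by rewrite /dotv big1 ?cos0 ?mulr1// => i _; rewrite mxE mul0r.
Qed.

Lemma is_trigD g h : is_trig g -> is_trig h -> is_trig (fun x => g x + h x).
Proof.
by move=> [s ->] [r ->]; exists (s ++ r); apply/funext => x; rewrite /trig_sum big_cat.
Qed.

(** Product-to-sum formula: every pair of terms gives its sum and its difference frequency, each
    with half the coefficient. *)
Lemma is_trigM g h : is_trig g -> is_trig h -> is_trig (fun x => g x * h x).
Proof.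
move=> [s ->] [r ->].
exists ([seq (u.1.1 * v.1.1 / 2, u.1.2 + v.1.2, u.2 + v.2) | u <- s, v <- r] ++
        [seq (u.1.1 * v.1.1 / 2, u.1.2 - v.1.2, u.2 - v.2) | u <- s, v <- r]).
apply/funext => x; rewrite /trig_sum big_cat !big_allpairs_dep/= -big_split/= mulr_suml.
apply: eq_bigr => u _; rewrite mulr_sumr -big_split/=; apply: eq_bigr => v _.
have prod a b : cos a * cos b = (cos (a + b) + cos (a - b)) / 2 :> R.
  by rewrite cosD cosB; field.
rewrite mulrACA prod !dotvDl dotvNl (_ : u.1.2 + v.1.2 + _ =
  (u.1.2 + dotv u.2 x) + (v.1.2 + dotv v.2 x)); last ring.
rewrite (_ : u.1.2 - v.1.2 + _ = (u.1.2 + dotv u.2 x) - (v.1.2 + dotv v.2 x)); last ring.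
by field.
Qed.

(** For fixed [l], [G] and [s], [coin] is a polynomial in the biases. *)
Lemma is_trig_coin (X : 'rV[R]_m -> 'I_m -> R) l G s :
  (forall i, is_trig (fun x => X x i)) -> is_trig (fun x => coin (X x) l G s).
Proof.
move=> tX; elim: l s => [|i l IH] s /=; first exact: is_trig_cst.
apply: is_trigD; first exact: is_trigM.
apply: is_trigM => //.
under eq_fun => x do rewrite -mulN1r.
apply: is_trigD; first exact: is_trig_cst.
by apply: is_trigM => //; exact: is_trig_cst.
Qed.

(** The value lies in [[0, 1]] everywhere, not only on the box, so it is a legitimate coin bias at
    every point; this keeps the approximant globally bounded. *)
Definition sine_coord (lam : R) x (i : 'I_m) : R := (1 + sin (lam * x 0 i)) / 2.

Lemma is_trig_sine_coord lam i : is_trig (fun x => sine_coord lam x i).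
Proof.
rewrite /sine_coord.
under eq_fun => x do rewrite mulrC.
apply: is_trigM; first exact: is_trig_cst.
apply: is_trigD; first exact: is_trig_cst.
rewrite (_ : (fun x => _) = (fun x => cos (- (pi / 2) + dotv (lam *: delta_mx 0 i) x))).
  exact: is_trig_cos.
apply/funext => x; rewrite addrC cosBpihalf /dotv (bigD1 i)//= big1 ?addr0.
  by rewrite !mxE !eqxx mulr1.
by move=> j ji; rewrite !mxE (negbTE ji) andbF mulr0 mul0r.
Qed.

Lemma sine_coord01 lam x i : 0 <= sine_coord lam x i <= 1.
Proof.
by rewrite /sine_coord; have := sin_geN1 (lam * x 0 i); have := sin_le1 (lam * x 0 i); lra.
Qed.

(** Clamping to [- sin 1, sin 1] keeps the argument in the open interval where [asin] is continuous.
    Since 1 <= pi / 2, it leaves sin y unchanged for |y| <= 1. *)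
Definition asin_clamp (y : R) : R := asin (Num.max (- sin 1) (Num.min (sin 1) y)).

Let sin1_lt1 : 0 < sin (1 : R) < 1.
Proof.
apply/andP; split; first by apply: sin2_gt0; lra.
rewrite lt_neqAle sin_le1 andbT; apply/eqP => h.
have := cos2Dsin2 (1 : R); have := cos1_gt0 R; rewrite h; nra.
Qed.

Lemma continuous_asin_clamp : continuous asin_clamp.
Proof.
move=> y; apply: (@continuous_comp _ _ _
    (fun y => Num.max (- sin 1) (Num.min (sin 1) y)) (@asin R)).
  apply: (@continuous_max _ _ (fun=> - sin 1) (fun y => Num.min (sin 1) y)).
    exact: cst_continuous.
  apply: (@continuous_min _ _ (fun=> sin 1) id); first exact: cst_continuous.
  exact: cvg_id.
apply: continuous_asin.
have /andP[s0 s1] := sin1_lt1.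
rewrite lt_max gt_max; apply/andP; split; first by apply/orP; left; lra.
by apply/andP; split; [lra|rewrite gt_min s1].
Qed.

(* A continuous left inverse of [sine_coord lam] on the cube of side [2 / lam]. *)
Definition unsine (lam : R) (z : 'rV[R]_m) : 'rV[R]_m :=
  \row_i (asin_clamp (2 * z 0 i - 1) / lam).

Lemma continuous_unsine lam : continuous (unsine lam).
Proof.
move=> z; apply: (@cvg_mx R _ (nbhs z) _ _ _ (unsine lam)) => i j; rewrite (ord1 i) mxE.
under eq_fun => x do rewrite mxE.
apply: cvgM; last exact: cvg_cst.
apply: (@cvg_comp _ _ _ (fun x : 'rV[R]_m => 2 * x 0 j - 1) asin_clamp);
  last exact: continuous_asin_clamp.
apply: cvgB; last exact: cvg_cst.
apply: cvgM; first exact: cvg_cst.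
exact: coord_continuous.
Qed.

Lemma unsineK (lam : R) x : 0 < lam -> (forall i, `|x 0 i| <= lam^-1) ->
  unsine lam (\row_i sine_coord lam x i) = x.
Proof.
move=> l0 hx; apply/rowP => i; rewrite !mxE /sine_coord /asin_clamp.
have /andP[s0 s1] := sin1_lt1.
have pi1 : 1 <= pi / 2 :> R := pihalf_ge1 R.
have y1 : -1 <= lam * x 0 i <= 1.
  have := hx i; rewrite ler_norml => /andP[h1 h2].
  have := ler_wpM2l (ltW l0) h1; have := ler_wpM2l (ltW l0) h2.
  by rewrite mulrN divff ?gt_eqF// => ? ?; apply/andP.
set y := lam * x 0 i in y1 *.
have -> : 2 * ((1 + sin y) / 2) - 1 = sin y by field.
have in1 (z : R) : -1 <= z <= 1 -> z \in `[(- (pi / 2)), pi / 2].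
  by move=> /andP[z1 z2]; rewrite in_itv/=; apply/andP; split; lra.
have mono (a b : R) : -1 <= a <= 1 -> -1 <= b <= 1 -> a <= b -> sin a <= sin b.
  by move=> ha hb; rewrite le_eqVlt => /orP[/eqP->//|ab]; rewrite ltW// ltr_sin ?in1.
have s1' : sin y <= sin 1 by apply: mono; lra.
have s2' : - sin 1 <= sin y by rewrite -sinN; apply: mono; lra.
rewrite (min_idPr s1') (max_idPr s2') sinK; last exact: in1.
by rewrite /y mulrC mulKf ?gt_eqF.
Qed.

(** In the coordinates [sine_coord], [f] becomes the continuous function [F] on a cube, and its
    Bernstein polynomial is a trigonometric sum of [x]. The bound by [C] on the whole space is
    needed later to control expectations outside the box. *)
Lemma trig_approx (f : 'rV[R]_m -> R) (C L e : R) : continuous f ->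
  (forall x, `|f x| <= C) -> 0 < L -> 0 < e ->
  exists g, [/\ is_trig g, forall x, `|g x| <= C &
    forall x : 'rV[R]_m, (forall i, `|x 0 i| <= L) -> `|g x - f x| <= e].
Proof.
move=> cf fC L0 e0.
pose F z := f (unsine L^-1 z).
have cF : continuous F.
  by move=> z; apply: continuous_comp; [exact: continuous_unsine|exact: cf].
have e2 : 0 < e / 2 by rewrite divr_gt0.
have [D D0 hD] := heine_rV_sqr cF (fun x => fC _) e2.
(* Each of the [m] coordinates contributes a variance of at most 1 / N, so this [N] makes D m / N
   smaller than e / 2. *)
pose N := (Num.truncn (D * m%:R / (e / 2))).+1.
have N0 : 0 < N%:R :> R by rewrite ltr0n.
pose G (s : 'I_m -> nat) := F (\row_i ((s i)%:R / N%:R)).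
(* Each index occurs [N] times: [N] tosses per coordinate, the tensor Bernstein operator of degree
   [N]. *)
pose l := flatten [seq nseq N i | i <- enum 'I_m].
have cl j : count_mem j l = N.
  rewrite count_flatten -map_comp (eq_map (g := fun i => ((i == j) : bool) * N)%N); last first.
    by move=> i /=; rewrite count_nseq /=; case: (i == j).
  rewrite sumnE big_map big_enum/= (bigD1 j)//= eqxx mul1n big1 ?addn0// => i /negbTE->.
  by rewrite mul0n.
pose g x := coin (sine_coord L^-1 x) l G (fun=> 0%N).
exists g; split.
- by apply: is_trig_coin => i; exact: is_trig_sine_coord.
- by move=> x; apply: coin_bounded => [i|s]; [exact: sine_coord01|exact: fC].
move=> x xL.
have fx : f x = F (\row_i sine_coord L^-1 x i).
  by rewrite /F unsineK ?invr_gt0 ?invrK.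
pose K (s : 'I_m -> nat) := e / 2 + D * \sum_i (N%:R ^- 2 * ((s i)%:R - N%:R * sine_coord L^-1 x i) ^+ 2).
apply: (@le_trans _ _ (coin (sine_coord L^-1 x) l K (fun=> 0%N))).
  apply: coin_norm => [i|s]; first exact: sine_coord01.
  rewrite fx /G /K; apply: le_trans (hD _ _ _) _.
    by move=> i; rewrite mxE; exact: sine_coord01.
  rewrite lerD2l ler_wpM2l// ler_sum// => i _; rewrite !mxE -exprVn -exprMn.
  by rewrite mulrBr mulrA mulVf ?gt_eqF// mul1r [_^-1 * _]mulrC.
rewrite /K coinD coin_cst coinZ coin_sum.
(* Started from 0, the count has mean [N] times its bias, so the centred square vanishes and only
   the variance is left. *)
under eq_bigr => i _ do rewrite coinZ coin_sqr cl add0r subrr expr0n/= add0r.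
rewrite [leRHS](_ : e = e / 2 + e / 2); last lra.
rewrite lerD2l.
have h : \sum_(i < m) N%:R ^- 2 * (N%:R * (sine_coord L^-1 x i * (1 - sine_coord L^-1 x i)))
    <= \sum_(i < m) (N%:R^-1 : R).
  apply: ler_sum => i _.
  rewrite (_ : N%:R ^- 2 * _ = N%:R^-1 * (sine_coord L^-1 x i * (1 - sine_coord L^-1 x i))); last first.
    by field; rewrite gt_eqF.
  rewrite ler_piMr ?invr_ge0 ?ler0n//.
  by have := sine_coord01 L^-1 x i; nra.
apply: (le_trans (ler_wpM2l D0 h)).
rewrite sumr_const card_ord -[_ *+ m]mulr_natr (_ : D * (N%:R^-1 * m%:R) = N%:R^-1 * (D * m%:R)); last ring.
rewrite ler_pdivrMl//.
have : D * m%:R / (e / 2) < N%:R by exact: truncnS_gt.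
rewrite ltr_pdivrMr ?divr_gt0//; lra.
Qed.

End Trigonometric.

(** * Tightness and comparison of expectations *)

Section WeakConvergence.
Context {d} {T : measurableType d} {R : realType} (P : probability T R).

Lemma measurable_dotv m (t : 'rV[R]_m) (Y : T -> 'rV[R]_m) : random_mx Y ->
  measurable_fun setT (fun w => dotv t (Y w)).
Proof.
move=> mY; apply: measurable_sum => i.
by apply: measurable_funM; [exact: measurable_cst|exact: mY].
Qed.

Lemma measurable_cosD (a : R) (X : T -> R) : measurable_fun setT X ->
  measurable_fun setT (fun w => cos (a + X w)).
Proof.
move=> mX; apply: (measurableT_comp (f := @cos R)).
  by apply: continuous_measurable_fun => x; exact: continuous_cos.
by apply: measurable_funD => //; exact: measurable_cst.
Qed.

Lemma measurable_trig m (g : 'rV[R]_m -> R) (Y : T -> 'rV[R]_m) : random_mx Y ->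
  is_trig g -> measurable_fun setT (g \o Y).
Proof.
move=> mY [s ->]; apply: measurable_sum => u.
apply: measurable_funM; first exact: measurable_cst.
by apply: measurable_cosD; exact: measurable_dotv.
Qed.

(** [f] is the pointwise limit of trigonometric sums approximating it on growing boxes, and those
    are measurable because the entries of [Y] are. *)
Lemma measurable_bounded_continuous m (f : 'rV[R]_m -> R) (C : R) (Y : T -> 'rV[R]_m) :
  random_mx Y -> continuous f -> (forall x, `|f x| <= C) ->
  measurable_fun setT (f \o Y).
Proof.
move=> mY cf fC.
have h (n : nat) : exists g, [/\ is_trig g, forall x, `|g x| <= C &
    forall x : 'rV[R]_m, (forall i, `|x 0 i| <= n.+1%:R) -> `|g x - f x| <= n.+1%:R^-1].
  by apply: trig_approx; rewrite ?invr_gt0.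
have [g hg] := choice h.
apply: (measurable_fun_cvg (h := fun n => g n \o Y)).
  by move=> n; apply: measurable_trig => //; have [] := hg n.
move=> w _ /=; apply/cvgrPdist_le => e e0.
have [L hL] : exists L : nat, forall i, `|Y w 0 i| <= L%:R.
  exists (\max_i (Num.truncn `|Y w 0%R i|).+1)%N => i.
  apply: (@le_trans _ _ (Num.truncn `|Y w 0 i|).+1%:R); first exact/ltW/truncnS_gt.
  by rewrite ler_nat (leq_bigmax (F := fun i => (Num.truncn `|Y w 0%R i|).+1)).
near=> n; rewrite distrC.
have [_ _ hn] := hg n; apply: (le_trans (hn _ _)) => [i|].
  apply: (le_trans (hL i)); rewrite ler_nat; near: n; exists L => // k /=; exact: leqW.
near: n; have := @near_infty_natSinv_lt R (PosNum e0).
by apply: filterS => k /ltW.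
Unshelve. all: by end_near. Qed.

Lemma measurable_norm_ge (X : T -> R) (L : R) : measurable_fun setT X ->
  measurable [set w | L <= `|X w|].
Proof.
move=> mX; have mf : measurable_fun setT (fun w => `|X w|) by exact: measurableT_comp.
have := mf measurableT `[L, +oo[%classic (measurable_itv _).
rewrite setTI; congr (measurable _).
by apply/seteqP; split => w /=; rewrite in_itv/= andbT.
Qed.

Lemma tight_rv (X : T -> R) (e : R) : measurable_fun setT X -> 0 < e ->
  exists2 L : R, 0 < L & (P [set w | (L <= `|X w|)%R] <= e%:E)%E.
Proof.
move=> mX e0.
have mA n : measurable [set w | n.+1%:R <= `|X w|] by exact: measurable_norm_ge.
have : Ex P (\1_[set w | n.+1%:R <= `|X w|]) @[n --> \oo] --> Ex P (fun=> 0).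
  apply: (dominated_Ex (Y := cst 1)).
  - by move=> n; exact: measurable_indic.
  - exact: measurable_cst.
  - move=> w; apply: cvg_near_cst; near=> n.
    rewrite indicE; case: (boolP (w \in _)) => //; rewrite inE /= => h.
    have : `|X w| < n.+1%:R.
      apply: (lt_le_trans (truncnS_gt _)); rewrite ler_nat ltnS; near: n.
      exact: nbhs_infty_ge.
    by rewrite ltNge h.
  - exact: integ_cst.
  - by move=> n w; rewrite indicE /=; case: (_ \in _); rewrite ?normr0 ?normr1 ?ler01.
rewrite Ex_cst => /cvgrPdist_le /(_ e e0) [N _ /(_ N (leqnn N))] /=.
rewrite sub0r normrN Ex_indic// ger0_norm ?fine_ge0// => h.
exists N.+1%:R => //; rewrite -(@fineK _ (P _)) ?lee_fin//; exact: fin_num_measure.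
Unshelve. all: by end_near. Qed.

Definition tight m (Y : nat -> T -> 'rV[R]_m) := forall e : R, 0 < e ->
  exists2 L : R, 0 < L & \forall n \near \oo, exists N : set T,
    [/\ measurable N, (P N <= e%:E)%E &
        forall w, ~ N w -> forall i, `|Y n w 0 i| <= L].

Lemma tight_cst m (Y : T -> 'rV[R]_m) : random_mx Y -> tight (fun=> Y).
Proof.
move=> mY e e0.
(* The divisor is [m.+1] so that the empty vector is covered as well. *)
have e' : 0 < e / m.+1%:R by rewrite divr_gt0.
have h i : exists2 L : R, 0 < L & (P [set w | (L <= `|Y w 0 i|)%R] <= (e / m.+1%:R)%:E)%E.
  by apply: tight_rv.
have /choice[L hL] : forall i : 'I_m, exists L : R, 0 < L /\
    (P [set w | (L <= `|Y w 0 i|)%R] <= (e / m.+1%:R)%:E)%E.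
  by move=> i; have [l l0 hl] := h i; exists l.
exists (1 + \sum_i L i).
  by rewrite ltr_pwDl// sumr_ge0// => i _; have [/ltW] := hL i.
near=> n; exists (\big[setU/set0]_i [set w | L i <= `|Y w 0 i|]).
have mA i : measurable [set w | L i <= `|Y w 0 i|] by exact: measurable_norm_ge.
split.
- by apply: bigsetU_measurable => i _.
- have PU (s : seq 'I_m) :
      (P (\big[setU/set0]_(i <- s) [set w | (L i <= `|Y w 0%R i|)%R]) <=
       ((size s)%:R * (e / m.+1%:R))%:E)%E.
    elim: s => [|i s IH]; first by rewrite big_nil measure0 mul0r.
    rewrite big_cons; apply: (le_trans (measureU2 _ (mA i) _)).
      by apply: bigsetU_measurable => j _.
    rewrite (_ : (size (i :: s))%:R = 1 + (size s)%:R :> R); last by rewrite nat1r.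
    rewrite mulrDl mul1r EFinD; apply: leeD => //.
    by have [] := hL i.
  rewrite -(big_enum) /=; apply: (le_trans (PU _)); rewrite lee_fin size_enum_ord.
  rewrite mulrA ler_pdivrMr// mulrC ler_wpM2l ?ltW//  ltr_nat//.
move=> w Nw i; rewrite leNgt; apply/negP => hi; apply: Nw.
rewrite (bigD1 i)//=; left => /=; apply/ltW/(le_lt_trans _ hi).
rewrite (bigD1 i)//= addrCA lerDl addr_ge0// sumr_ge0// => j _.
by have [/ltW] := hL j.
Unshelve. all: by end_near. Qed.

(** The two functions differ by at most [e] outside [N] and by at most [2 * C] on [N]. *)
Lemma Ex_approx m (f g : 'rV[R]_m -> R) (C L e e' : R) (Y : T -> 'rV[R]_m) (N : set T) :
  random_mx Y -> continuous f -> is_trig g ->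
  (forall x, `|f x| <= C) -> (forall x, `|g x| <= C) ->
  (forall x : 'rV[R]_m, (forall i, `|x 0 i| <= L) -> `|g x - f x| <= e) -> 0 <= e ->
  measurable N -> (P N <= e'%:E)%E ->
  (forall w, ~ N w -> forall i, `|Y w 0 i| <= L) ->
  `|Ex P (g \o Y) - Ex P (f \o Y)| <= e + 2 * C * e'.
Proof.
move=> mY cf tg fC gC gf e0 mN PN hN.
have C0 : 0 <= C by apply: le_trans (fC 0).
have mg := measurable_trig mY tg.
have mf := measurable_bounded_continuous mY cf fC.
have ig : integ P (g \o Y) by apply: (integ_bounded P (C := C)) => // w; exact: gC.
have if_ : integ P (f \o Y) by apply: (integ_bounded P (C := C)) => // w; exact: fC.
have iN := integ_indic P mN.
have iK : integ P (fun w => e + 2 * C * \1_N w).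
  by apply: integD; [exact: integ_cst|exact: integZ].
rewrite -ExB//; apply: (@le_trans _ _ (Ex P (fun w => e + 2 * C * \1_N w))).
  apply: Ex_norm_le => //; first exact: integB.
  move=> w; rewrite indicE /=; case: (boolP (w \in N)) => [_|/negP wN].
    rewrite mulr1 (le_trans (ler_normB _ _))//.
    by have := fC (Y w); have := gC (Y w); lra.
  rewrite mulr0 addr0; apply: gf; apply: hN.
  by move=> Nw; apply: wN; rewrite inE.
rewrite ExD ?ExZ ?Ex_indic ?Ex_cst//; last 2 first.
- exact: integ_cst.
- exact: integZ.
rewrite lerD2l ler_wpM2l ?mulr_ge0//.
by rewrite -lee_fin fineK// fin_num_measure.
Qed.

End WeakConvergence.

(** A real form of Lévy's continuity theorem. On a box carrying most of both laws, [f] is replaced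
    by one trigonometric sum [g]; the expectations of [g] converge by linearity from the cosine
    hypothesis. *)
Lemma cvg_in_law_cos {R : realType} d (T : measurableType d) (P : probability T R)
    d' (T' : measurableType d') (P' : probability T' R) m
    (Y : nat -> T -> 'rV[R]_m) (eta : T' -> 'rV[R]_m) :
  (forall n, random_mx (Y n)) -> random_mx eta -> tight P Y ->
  (forall (a : R) (t : 'rV[R]_m), Ex P (fun w => cos (a + dotv t (Y n w)))
    @[n --> \oo] --> Ex P' (fun w => cos (a + dotv t (eta w)))) ->
  forall (f : 'rV[R]_m -> R) (C : R), continuous f -> (forall x, `|f x| <= C) ->
    Ex P (f \o Y n) @[n --> \oo] --> Ex P' (f \o eta).
Proof.
move=> mY meta tY hcos f C cf fC.
have C0 : 0 <= C by apply: le_trans (fC 0).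
have trigE d0 (T0 : measurableType d0) (P0 : probability T0 R) (Y0 : T0 -> 'rV[R]_m) s :
    random_mx Y0 -> Ex P0 (trig_sum s \o Y0) =
    \sum_(u <- s) u.1.1 * Ex P0 (fun w => cos (u.1.2 + dotv u.2 (Y0 w))).
  move=> m0.
  have i0 u : integ P0 (fun w => cos (u.1.2 + dotv u.2 (Y0 w))).
    apply: (integ_bounded P0 (C := 1)); last by move=> w; exact: cos_max.
    by apply: measurable_cosD; exact: measurable_dotv.
  rewrite /trig_sum /comp Ex_sum; last by move=> u _; exact: integZ.
  by apply: eq_bigr => u _; rewrite ExZ.
have htrig g : is_trig g -> Ex P (g \o Y n) @[n --> \oo] --> Ex P' (g \o eta).
  move=> [s ->]; rewrite trigE//; under eq_fun do rewrite trigE//.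
  apply: (@cvg_big _ _ +%R) => //; first exact: add_continuous.
  move=> u _; apply: cvgM; [exact: cvg_cst|exact: hcos].
apply/cvgrPdist_le => e e0.
(* With this [b], [2 * C * b] is at most e / 4, and [C + 1] avoids dividing by zero. The three
   errors then add up to at most 3e/8 + 3e/8 + e/8. *)
pose b := e / (8 * (C + 1)).
have b0 : 0 < b by rewrite divr_gt0// mulr_gt0//; lra.
have Cb : 2 * C * b <= e / 4.
  by rewrite /b mulrA ler_pdivrMr; [nra|rewrite mulr_gt0//; lra].
have [L1 L10 hL1] := tY b b0.
have [L2 L20 hL2] := tight_cst P' meta b0.
pose L := L1 + L2.
have [||g [tg gC hg]] := @trig_approx _ _ f C L (e / 8) cf fC.
- by rewrite addr_gt0.
- by rewrite divr_gt0.
have {}hL2 : exists N : set T', [/\ measurable N, (P' N <= b%:E)%E &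
    forall w, ~ N w -> forall i, `|eta w 0 i| <= L2].
  by have [n _ /(_ n (leqnn n))] := hL2.
have [N2 [mN2 PN2 hN2]] := hL2.
have A2 : `|Ex P' (g \o eta) - Ex P' (f \o eta)| <= e / 8 + 2 * C * b.
  apply: (Ex_approx (L := L)) PN2 _ => //; first by rewrite divr_ge0// ltW.
  by move=> w Nw i; apply: (le_trans (hN2 _ Nw i)); rewrite lerDr ltW.
have e8 : 0 < e / 8 by rewrite divr_gt0.
have /cvgrPdist_le/(_ _ e8) hgn := htrig _ tg.
near=> n.
have A1 : `|Ex P (g \o Y n) - Ex P (f \o Y n)| <= e / 8 + 2 * C * b.
  have [N [mN PN hN]] : exists N : set T, [/\ measurable N, (P N <= b%:E)%E &
      forall w, ~ N w -> forall i, `|Y n w 0 i| <= L1] by near: n.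
  apply: (Ex_approx (L := L)) PN _ => //; first by rewrite divr_ge0// ltW.
  by move=> w Nw i; apply: (le_trans (hN _ Nw i)); rewrite lerDl ltW.
have A3 : `|Ex P' (g \o eta) - Ex P (g \o Y n)| <= e / 8 by near: n.
move: A1 A2 A3; rewrite !ler_norml => /andP[? ?] /andP[? ?] /andP[? ?].
by apply/andP; split; lra.
Unshelve. all: by end_near. Qed.

(** * Independence *)

Section Independence.
Context {d} {T : measurableType d} {R : realType} (P : probability T R).

Definition indep2 (X Y : T -> R) :=
  forall A B : set R, measurable A -> measurable B ->
    P (X @^-1` A `&` Y @^-1` B) = (P (X @^-1` A) * P (Y @^-1` B))%E.

(** Independence identifies the joint law with the product of the marginals, by uniqueness of the
    product measure on rectangles; Fubini then factors the integral of the product of the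
    coordinates. *)
Lemma indep2_Ex (X Y : T -> R) : integ P X -> integ P Y -> indep2 X Y ->
  integ P (fun w => X w * Y w) /\ Ex P (fun w => X w * Y w) = Ex P X * Ex P Y.
Proof.
move=> iX iY XY.
have mX := integ_measurable iX; have mY := integ_measurable iY.
pose Xm : {mfun T >-> R} := mfun_Sub (mem_set mX).
pose Ym : {mfun T >-> R} := mfun_Sub (mem_set mY).
have mXY : measurable_fun setT (fun w => (X w, Y w)) by exact: measurable_fun_pair.
pose XYm : {mfun T >-> (R * R)%type} := mfun_Sub (mem_set mXY).
pose m1 := distribution P Xm; pose m2 := distribution P Ym.
pose m := distribution P XYm.
have mE A : measurable A -> (m1 \x m2)%E A = m A.
  by apply: product_measure_unique => {}A B mA mB; exact: XY.
pose f (z : R * R) : \bar R := (z.1 * z.2)%:E.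
have mf : measurable_fun setT f.
  apply/measurable_EFinP; apply: measurable_funM.
    exact: measurable_fst.
  exact: measurable_snd.
have eX (g : R -> R) : measurable_fun setT g -> integ P (g \o X) ->
    m1.-integrable setT (EFin \o g) /\ (\int[m1]_x (g x)%:E)%E = (Ex P (g \o X))%:E.
  move=> mg ig; split.
    by apply: integrable_pushforward => //; exact/measurable_EFinP.
  rewrite integral_distribution//; last exact/measurable_EFinP.
  by rewrite /Ex /Rintegral fineK//; exact: (integrable_fin_num measurableT ig).
have eY (g : R -> R) : measurable_fun setT g -> integ P (g \o Y) ->
    m2.-integrable setT (EFin \o g) /\ (\int[m2]_x (g x)%:E)%E = (Ex P (g \o Y))%:E.
  move=> mg ig; split.
    by apply: integrable_pushforward => //; exact/measurable_EFinP.
  rewrite integral_distribution//; last exact/measurable_EFinP.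
  by rewrite /Ex /Rintegral fineK//; exact: (integrable_fin_num measurableT ig).
have [i1 e1] := eX id (@measurable_id _ _ _) iX.
have [i2 e2] := eY id (@measurable_id _ _ _) iY.
have [j1 f1] := eX (fun x => `|x|) (@normr_measurable _ _) (integ_norm iX).
have [j2 f2] := eY (fun x => `|x|) (@normr_measurable _ _) (integ_norm iY).
(* Tonelli: the iterated integral of the absolute value is the product of two finite first absolute
   moments. *)
have imf : (m1 \x m2)%E.-integrable setT f.
  apply/integrable12ltyP => //.
  under eq_integral => x _.
    under eq_integral => y _ do rewrite /f /= normrM EFinM.
    rewrite integralZl// f2; over.
  rewrite integralZr// f1; exact: ltry.
have F := integral12_prod_meas1 imf.
have mm g : (\int[m1 \x m2]_z g z = \int[m]_z g z)%E.
  by apply: eq_measure_integral => A mA _; exact: mE.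
have ifXY : P.-integrable setT (f \o XYm).
  apply/integrableP; split; first exact: measurableT_comp.
  have -> : (\int[P]_x `|(f \o XYm) x| = \int[m]_x `|f x|)%E.
    by rewrite ge0_integral_distribution//; exact: measurableT_comp.
  rewrite -mm.
  by have /integrableP[] := imf.
split; first exact: ifXY.
apply: EFin_inj; rewrite -expectationE; last exact: ifXY.
rewrite unlock.
transitivity (\int[m]_z f z)%E; first by rewrite integral_distribution.
rewrite -mm -F /fubini_F.
under eq_integral => x _.
  under eq_integral => y _ do rewrite /f /= EFinM.
  rewrite integralZl// e2; over.
by rewrite integralZr// e1.
Qed.

(** * Independence of functions of disjoint blocks of variables *)

Section Subfamilies.
Context {I : choiceType} (y : I -> {RV P >-> R}).
Hypothesis indy : mutually_independent P (fun i => sigma_RV (y i)).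

(** A pi-system generating the sigma-algebra of the variables with index in [K]. The indices of a
    cylinder are kept distinct, so that mutual independence applies to it directly. *)
Definition cylinders (K : pred I) : set (set T) :=
  [set A | exists s : seq I, exists B : I -> set T,
    [/\ uniq s, all K s, (forall i, i \in s -> sigma_RV (y i) (B i)) &
        A = \big[setI/setT]_(i <- s) B i]].

Lemma sigma_RV_measurable i A : sigma_RV (y i) A -> measurable A.
Proof.
move=> [B mB <-]; have := @measurable_funPT _ _ _ _ (y i).
by move=> /(_ measurableT B mB).
Qed.

Lemma sigma_RVT i : sigma_RV (y i) setT.
Proof. by exists setT => //; rewrite preimage_setT setIT. Qed.

Lemma sigma_RVI i A B : sigma_RV (y i) A -> sigma_RV (y i) B ->
  sigma_RV (y i) (A `&` B).
Proof.
move=> [A' mA' <-] [B' mB' <-]; exists (A' `&` B'); first exact: measurableI.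
by rewrite !setTI preimage_setI.
Qed.

Lemma cylinders_measurable K : cylinders K `<=` measurable.
Proof.
move=> _ [s [B [us Ks sB ->]]]; elim: s us Ks sB => [|i s IH] us Ks sB.
  by rewrite big_nil; exact: measurableT.
rewrite big_cons; apply: measurableI.
  by apply: sigma_RV_measurable (sB i _); rewrite mem_head.
apply: IH; first by case/andP: us.
- by case/andP: Ks.
- by move=> j js; apply: sB; rewrite inE js orbT.
Qed.

Lemma cylindersT K : cylinders K setT.
Proof. by exists [::], (fun=> setT); split; rewrite ?big_nil. Qed.

Lemma cylindersI K : setI_closed (cylinders K).
Proof.
move=> _ _ [s [B [us Ks sB ->]]] [s' [B' [us' Ks' sB' ->]]].
(* The two cylinders are intersected index by index, with [setT] where an index is missing. *)
exists (undup (s ++ s')), (fun i => (if i \in s then B i else setT) `&`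
  (if i \in s' then B' i else setT)); split.
- exact: undup_uniq.
- by apply/allP => i; rewrite mem_undup mem_cat => /orP[|]; apply/allP.
- move=> i _; apply: sigma_RVI; case: ifP => h; [exact: sB|exact: sigma_RVT|exact: sB'|exact: sigma_RVT].
- rewrite -!bigcap_seq; apply/seteqP; split => w /=.
    move=> [h1 h2] i _; split; case: ifP => // h; [exact: h1|exact: h2].
  move=> h; split=> i /= hi.
    have := h i; rewrite /= mem_undup mem_cat hi => /(_ isT)[]; done.
  have := h i; rewrite /= mem_undup mem_cat hi orbT => /(_ isT)[]; done.
Qed.

Lemma cylinders_sigma_measurable K A : <<s cylinders K >> A -> measurable A.
Proof.
apply: smallest_sub; first exact: sigma_algebra_measurable.
exact: cylinders_measurable.
Qed.

Lemma cylinders_indep (K1 K2 : pred I) A B : (forall i, K1 i -> K2 i -> False) ->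
  cylinders K1 A -> cylinders K2 B -> P (A `&` B) = (P A * P B)%E.
Proof.
move=> K12 [s [F [us Ks sF ->]]] [s' [F' [us' Ks' sF' ->]]].
have ns i : i \in s -> i \in s' = false.
  move=> h; apply/negbTE/negP => h'.
  exact: (K12 i (allP Ks _ h) (allP Ks' _ h')).
pose H i := if i \in s then F i else F' i.
have E1 : \big[setI/setT]_(i <- s) F i = \big[setI/setT]_(i <- s) H i.
  by apply: eq_big_seq => i h; rewrite /H h.
have E2 : \big[setI/setT]_(i <- s') F' i = \big[setI/setT]_(i <- s') H i.
  apply: eq_big_seq => i h; rewrite /H; case: ifP => // h'.
  by rewrite (ns _ h') in h.
have sH1 i : i \in s -> sigma_RV (y i) (H i) by move=> h; rewrite /H h; exact: sF.
have sH2 i : i \in s' -> sigma_RV (y i) (H i).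
  by move=> h; rewrite /H; case: ifP => h'; [rewrite (ns _ h') in h|exact: sF'].
rewrite E1 E2 -big_cat /=.
rewrite indy//=; last 2 first.
- rewrite cat_uniq us us' andbT/=; apply/hasPn => i h; apply/negP => h'.
  by rewrite (ns _ h') in h.
- by move=> i; rewrite mem_cat => /orP[]; [exact: sH1|exact: sH2].
by rewrite big_cat/= !indy.
Qed.

(** The pi-lambda argument, used twice. With [C] fixed, P (D [&] C) and P C * P D are finite
    measures in D that agree on a pi-system; [ext] extends the equality on one side, and it is
    applied to each side in turn. *)
Lemma sigma_cylinders_indep (K1 K2 : pred I) A B : (forall i, K1 i -> K2 i -> False) ->
  <<s cylinders K1 >> A -> <<s cylinders K2 >> B -> P (A `&` B) = (P A * P B)%E.
Proof.
move=> K12.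
have ext K (C : set T) (mC : measurable C) :
    (forall D, cylinders K D -> P (D `&` C) = (P C * P D)%E) ->
    forall D, <<s cylinders K >> D -> P (D `&` C) = (P C * P D)%E.
  move=> h D sD.
  have c0 : 0 <= fine (P C) by exact: fine_ge0.
  have PC : P C = (fine (P C))%:E by rewrite fineK// fin_num_measure.
  transitivity (mrestr P mC D) => //.
  transitivity (mscale (NngNum c0) P D); last by rewrite /mscale/= -PC.
  apply: (g_sigma_algebra_measure_unique (cylinders K) _ (fun=> setT)) => //.
  - exact: cylinders_measurable.
  - by move=> _; exact: cylindersT.
  - by rewrite bigcup_const.
  - exact: cylindersI.
  - by move=> E cE; transitivity (P C * P E)%E; [exact: h|rewrite [in LHS]PC].
  - by move=> _; apply: le_lt_trans (probability_le1 P (measurableI _ _ measurableT mC)) (ltry _).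
move=> sA sB; have mB := cylinders_sigma_measurable sB.
rewrite [RHS]muleC; apply: (ext K1) sA => // D cD.
rewrite setIC [RHS]muleC; apply: (ext K2) sB; first exact: cylinders_measurable cD.
by move=> E cE; rewrite setIC; exact: (cylinders_indep K12).
Qed.

(** Measurability for the sigma-algebra generated by the variables with index in [K], which is what
    lets independence pass to arbitrary measurable functions of a block. *)
Definition fun_of (K : pred I) (X : T -> R) :=
  @measurable_fun _ _ (g_sigma_algebraType (cylinders K)) R setT X.

Lemma fun_of_measurable K X : fun_of K X -> measurable_fun setT X.
Proof.
by move=> mX _ A mA; apply: (@cylinders_sigma_measurable K); exact: mX.
Qed.

Lemma fun_of_var (K : pred I) i : K i -> fun_of K (y i).
Proof.
move=> Ki _ A mA; apply: sub_sigma_algebra; exists [:: i], (fun=> y i @^-1` A).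
split => //=; rewrite ?Ki//; last by rewrite big_seq1 setTI.
by move=> j; rewrite inE => /eqP->; exists A => //; rewrite setTI.
Qed.

Lemma fun_of_Ex (K1 K2 : pred I) X Y : (forall i, K1 i -> K2 i -> False) ->
  fun_of K1 X -> fun_of K2 Y -> integ P X -> integ P Y ->
  integ P (fun w => X w * Y w) /\ Ex P (fun w => X w * Y w) = Ex P X * Ex P Y.
Proof.
move=> K12 mX mY iX iY; apply: indep2_Ex => // A B mA mB.
apply: (sigma_cylinders_indep K12).
  by have := mX measurableT A mA; rewrite setTI.
by have := mY measurableT B mB; rewrite setTI.
Qed.

Lemma fun_of_sub (K1 K2 : pred I) X : (forall i, K1 i -> K2 i) ->
  fun_of K1 X -> fun_of K2 X.
Proof.
move=> K12 mX _ A mA; have := mX measurableT A mA.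
apply: sub_smallest2r; first exact: smallest_sigma_algebra.
move=> _ [s [B [us Ks sB ->]]].
by exists s, B; split => //; exact: sub_all Ks.
Qed.

End Subfamilies.
End Independence.

(** * Gaussian vectors *)

Section LawUniqueness.
Context {R : realType} d (T : measurableType d) (P : probability T R)
  d' (T' : measurableType d') (P' : probability T' R).

(** The constant sequence [Y] converges in law to [Y'] by [cvg_in_law_cos], so expectations of
    bounded continuous functions agree. Ramps carry this over to closed half-lines, a pi-system
    generating the Borel sets. *)
Lemma law_cos_unique (X : T -> R) (X' : T' -> R) :
  measurable_fun setT X -> measurable_fun setT X' ->
  (forall a t : R, Ex P (fun w => cos (a + t * X w)) = Ex P' (fun w => cos (a + t * X' w))) ->
  forall A, measurable A -> P (X @^-1` A) = P' (X' @^-1` A).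
Proof.
move=> mX mX' hcos.
pose Y w : 'rV[R]_1 := \row__ X w; pose Y' w : 'rV[R]_1 := \row__ X' w.
have mY : random_mx Y by move=> i j; under eq_fun do rewrite mxE.
have mY' : random_mx Y' by move=> i j; under eq_fun do rewrite mxE.
have hf (f : R -> R) (C : R) : continuous f -> (forall x, `|f x| <= C) ->
    Ex P (f \o X) = Ex P' (f \o X').
  move=> cf fC.
  pose F (x : 'rV[R]_1) := f (x 0 0).
  have cF : continuous F.
    by move=> x; apply: continuous_comp; [exact: coord_continuous|exact: cf].
  have := cvg_in_law_cos (fun=> mY) mY' (tight_cst P mY) _ cF (fun x => fC _).
  have -> : F \o Y = f \o X by apply/funext => w; rewrite /F /= mxE.
  have -> : F \o Y' = f \o X' by apply/funext => w; rewrite /F /= mxE.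
  move=> /(_ P') h; have := cvg_unique _ (cvg_cst (Ex P (f \o X))) (h _); apply => //.
  move=> a t.
  have -> : (fun w => cos (a + dotv t (Y w))) = fun w => cos (a + t 0 0 * X w).
    by apply/funext => w; rewrite /dotv big_ord1 mxE.
  have -> : (fun w => cos (a + dotv t (Y' w))) = fun w => cos (a + t 0 0 * X' w).
    by apply/funext => w; rewrite /dotv big_ord1 mxE.
  by rewrite hcos; exact: cvg_cst.
(* For positive [n] it is 0 up to b - 1/n and 1 from b on, and tends pointwise to the indicator of
   [b, +oo[. *)
pose ramp (b : R) (n : nat) (x : R) : R := Num.max 0 (Num.min 1 (1 + n%:R * (x - b))).
have cramp b n : continuous (ramp b n).
  move=> x; apply: (@continuous_max _ _ (fun=> 0) (fun x => Num.min 1 (1 + n%:R * (x - b)))).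
    exact: cst_continuous.
  apply: (@continuous_min _ _ (fun=> 1) (fun x => 1 + n%:R * (x - b))).
    exact: cst_continuous.
  apply: cvgD; first exact: cvg_cst.
  apply: cvgM; first exact: cvg_cst.
  by apply: cvgB; [exact: cvg_id|exact: cvg_cst].
have bramp b n x : `|ramp b n x| <= 1.
  rewrite /ramp ger0_norm ?le_max ?lexx//.
  by rewrite ge_max ler01 ge_min lexx.
have cvramp b x : ramp b n x @[n --> \oo] --> (\1_(`[b, +oo[%classic) x : R).
  rewrite indicE; case: (boolP (x \in _)) => [|/negP]; rewrite inE/= in_itv/= andbT.
    move=> bx; apply: cvg_near_cst; near=> n.
    rewrite /ramp; have h : 0 <= n%:R * (x - b) by rewrite mulr_ge0// subr_ge0.
    by rewrite min_l ?max_r//; lra.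
  move=> /negP; rewrite -ltNge => xb; apply: cvg_near_cst; near=> n.
  rewrite /ramp max_l// ge_min; apply/orP; right.
  have : (b - x)^-1 <= n%:R by near: n; exact: nbhs_infty_ger.
  have bx : 0 < b - x by rewrite subr_gt0.
  by rewrite -(ler_pM2r bx) mulVf ?gt_eqF//; lra.
have indE d0 (T0 : measurableType d0) (P0 : probability T0 R) (Z : T0 -> R) b :
    measurable_fun setT Z ->
    Ex P0 (ramp b n \o Z) @[n --> \oo] --> fine (P0 (Z @^-1` `[b, +oo[%classic)).
  move=> mZ; have mA : measurable (Z @^-1` `[b, +oo[%classic).
    by rewrite -[X in measurable X]setTI; exact: mZ.
  rewrite -Ex_indic//; apply: (dominated_Ex (Y := cst 1)).
  - by move=> n; apply: measurableT_comp => //; exact: continuous_measurable_fun.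
  - exact: measurable_indic.
  - by move=> w; have := cvramp b (Z w); rewrite !indicE.
  - exact: integ_cst.
  - by move=> n w; exact: bramp.
have rayE b : P (X @^-1` `[b, +oo[%classic) = P' (X' @^-1` `[b, +oo[%classic).
  have e1 := indE _ _ P X b mX; have e2 := indE _ _ P' X' b mX'.
  have e : fine (P (X @^-1` `[b, +oo[%classic)) = fine (P' (X' @^-1` `[b, +oo[%classic)).
    have E : (fun n => Ex P (ramp b n \o X)) = fun n => Ex P' (ramp b n \o X').
      by apply/funext => n; exact: (hf _ 1).
    by rewrite E in e1; have := cvg_unique _ e1 e2; apply.
  rewrite -[LHS]fineK -1?[RHS]fineK ?e// fin_num_measure// -[X in measurable X]setTI.
    exact: mX'.
  exact: mX.
move=> A mA.
pose Xm : {mfun T >-> R} := mfun_Sub (mem_set mX).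
pose Xm' : {mfun T' >-> R} := mfun_Sub (mem_set mX').
have := @measure_unique _ R R [set B | exists x, B = `[x, +oo[%classic] (fun n => `[- n%:R, +oo[%classic)
  (@RGenCInfty.measurableE R) _ _ _ (distribution P Xm) (distribution P' Xm').
apply => //.
- move=> _ _ [x ->] [y ->]; exists (Num.max x y).
  by apply/seteqP; split => z /=; rewrite !in_itv/= !andbT ge_max => /andP.
- by move=> n; exists (- n%:R).
- apply/seteqP; split => // x _; exists (Num.truncn `|x|).+1 => //=.
  by rewrite in_itv/= andbT lerNl ltW// (le_lt_trans _ (truncnS_gt _))// -normrN ler_norm.
- by move=> _ [x ->]; exact: rayE.
- by move=> k; rewrite (le_lt_trans (probability_le1 _ _)) ?ltry.
Unshelve. all: by end_near. Qed.

End LawUniqueness.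

(** * The cosine transform of the normal law *)

Section NormalDensity.
Context {R : realType} (m s : R).
Hypothesis s0 : s != 0.
Local Notation mu := (@lebesgue_measure R).
Local Notation g := (normal_pdf m s).

(** The Radon-Nikodym derivative and [normal_pdf] have the same integral over every measurable set,
    so they agree almost everywhere. *)
Lemma Ex_normal_prob (f : R -> R) : measurable_fun setT f ->
  (normal_prob m s).-integrable setT (EFin \o f) ->
  Ex (normal_prob m s) f = \int[mu]_x (f x * g x).
Proof.
move=> mf iF; rewrite /Ex /Rintegral; congr fine.
rewrite -(Radon_Nikodym_change_of_variables (normal_prob_dominates m s))//.
apply: ae_eq_integral => //.
- apply: emeasurable_funM; first exact/measurable_EFinP.
  apply: (measurable_int mu); apply: Radon_Nikodym_integrable.
  exact: normal_prob_dominates.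
- by apply/measurable_EFinP; apply: measurable_funM => //; exact: measurable_normal_pdf.
under [in X in ae_eq _ _ _ X]eq_fun do rewrite EFinM.
apply: ae_eqe_mul2l => /=.
rewrite Radon_NikodymE//=; first exact: normal_prob_dominates.
move=> nm; case: cid => /= h [h1 h2 h3].
apply: integral_ae_eq => //=.
- by apply/measurable_EFinP; exact: measurable_normal_pdf.
- by move=> E _ mE; rewrite -h3.
Qed.

Lemma normal_pdf_expR x : g x = normal_peak s * expR (- (x - m) ^+ 2 / (s ^+ 2 *+ 2)).
Proof. by rewrite normal_pdfE. Qed.

Let s2 : 0 < s ^+ 2. Proof. by rewrite exprn_even_gt0. Qed.

(** Half of the Gaussian exponent absorbs the linear factor; the other half is the exponent for
    deviation sqrt 2 * s. With z = (x - m)^2 / (4 s^2) this rests on 4z <= (1 + z)^2 and 1 + z <=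
    exp z. The bound serves for domination under the integral and for decay at infinity. *)
Lemma norm_mul_normal_pdf_le x :
  `|x - m| * g x <= 2 * `|s| * normal_pdf m (Num.sqrt 2 * s) x.
Proof.
have q0 : Num.sqrt 2 * s != 0 :> R by rewrite mulf_neq0// gt_eqF// sqrtr_gt0.
rewrite !normal_pdfE// /normal_peak.
have -> : (Num.sqrt 2 * s) ^+ 2 = 2 * s ^+ 2 by rewrite exprMn sqr_sqrtr.
have -> : Num.sqrt (2 * s ^+ 2 * pi *+ 2) = Num.sqrt 2 * Num.sqrt (s ^+ 2 * pi *+ 2) :> R.
  by rewrite -sqrtrM//; congr (Num.sqrt _); ring.
have p0 : 0 < Num.sqrt (s ^+ 2 * pi *+ 2) :> R.
  by rewrite sqrtr_gt0 mulrn_wgt0// mulr_gt0 ?pi_gt0.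
have r0 : 0 < Num.sqrt 2 :> R by rewrite sqrtr_gt0.
have r2 : Num.sqrt 2 <= 2 :> R.
  by have := sqr_sqrtr (ler0n R 2); nra.
set p := Num.sqrt (s ^+ 2 * pi *+ 2) in p0 *.
rewrite /normal_fun invfM.
have -> : (Num.sqrt 2 * s) ^+ 2 = 2 * s ^+ 2 by rewrite exprMn sqr_sqrtr.
set z := (x - m) ^+ 2 / (s ^+ 2 *+ 4).
have z0 : 0 <= z by rewrite divr_ge0 ?sqr_ge0// mulrn_wge0// ltW.
have -> : - (x - m) ^+ 2 / (s ^+ 2 *+ 2) = (- z) + (- z).
  by rewrite /z -[s ^+ 2 *+ 2]mulr_natr -[s ^+ 2 *+ 4]mulr_natr; field.
have -> : - (x - m) ^+ 2 / ((2 * s ^+ 2) *+ 2) = - z.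
  by rewrite /z -[_ *+ 2]mulr_natr -[s ^+ 2 *+ 4]mulr_natr; field.
rewrite expRD.
have ez := expR_ge1Dx z.
have eN : expR (- z) * expR z = 1 by rewrite -expRD addNr expR0.
have eP := expR_gt0 (- z).
have xz : `|x - m| <= `|s| * expR z.
  have s1 : 0 < `|s| by rewrite normr_gt0.
  have e1 : (x - m) ^+ 2 = 4 * `|s| ^+ 2 * z.
    by rewrite /z real_normK ?num_real// -[_ *+ 4]mulr_natr; field.
  have e2 : `|x - m| ^+ 2 = 4 * `|s| ^+ 2 * z by rewrite real_normK ?num_real.
  have h : `|x - m| <= `|s| * (1 + z).
    rewrite -ler_sqr ?nnegrE ?mulr_ge0// ?addr_ge0// e2 exprMn.
    by have := sqr_ge0 (1 - z); have := sqr_ge0 `|s|; nra.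
  by apply: (le_trans h); rewrite ler_pM2l.
have : `|x - m| * expR (- z) <= `|s|.
  apply: (le_trans (ler_wpM2r (ltW eP) xz)).
  by rewrite -mulrA [expR z * _]mulrC eN mulr1.
move=> h.
have ip : 0 < p^-1 by rewrite invr_gt0.
have ir : 1 <= 2 * (Num.sqrt 2)^-1 :> R by rewrite ler_pdivlMr// mul1r.
have s1 := normr_ge0 s.
have h1 : `|x - m| * (p^-1 * (expR (- z) * expR (- z))) =
    (`|x - m| * expR (- z)) * (p^-1 * expR (- z)) by ring.
have h2 : 2 * `|s| * ((Num.sqrt 2)^-1 * p^-1 * expR (- z)) =
   (2 * (Num.sqrt 2)^-1) * `|s| * (p^-1 * expR (- z)) by ring.
rewrite h1 h2; apply: ler_wpM2r; first by rewrite mulr_ge0// ltW.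
by apply: (le_trans h); rewrite ler_peMl.
Qed.

Lemma integrable_norm_mul_normal_pdf :
  mu.-integrable setT (EFin \o (fun x => `|x - m| * g x)).
Proof.
have i := integrableZl measurableT (2 * `|s|) (integrable_normal_pdf m (Num.sqrt 2 * s)).
apply: (le_integrable measurableT _ _ i).
  apply/measurable_EFinP; apply: measurable_funM; last exact: measurable_normal_pdf.
  by apply: measurableT_comp => //; exact: measurable_funB.
move=> x _ /=; rewrite lee_fin ger0_norm; last first.
  by rewrite mulr_ge0// normal_pdf_ge0.
by apply: (le_trans (norm_mul_normal_pdf_le x)); exact: ler_norm.
Qed.

Let mcos a t : measurable_fun setT (fun x : R => cos (a + t * (x - m))).
Proof.
apply: measurable_cosD; apply: measurable_funM => //.
exact: measurable_funB.
Qed.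

Let msin a t : measurable_fun setT (fun x : R => sin (a + t * (x - m))).
Proof.
apply: (measurableT_comp (f := @sin R)).
  by apply: continuous_measurable_fun => x; exact: continuous_sin.
apply: measurable_funD => //; apply: measurable_funM => //.
exact: measurable_funB.
Qed.

Let icos (a t : R) : mu.-integrable setT (EFin \o (fun x => cos (a + t * (x - m)) * g x)).
Proof.
apply: (le_integrable measurableT _ _ (integrable_normal_pdf m s)).
  have mf : measurable_fun setT (fun x : R => cos (a + t * (x - m)) * g x).
    by apply: measurable_funM => //; exact: measurable_normal_pdf.
  exact/measurable_EFinP.
by move=> x _ /=; rewrite lee_fin normrM ler_piMl// cos_max.
Qed.

Let isin (a t : R) : mu.-integrable setT (EFin \o (fun x => (x - m) * sin (a + t * (x - m)) * g x)).
Proof.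
apply: (le_integrable measurableT _ _ integrable_norm_mul_normal_pdf).
  have mf : measurable_fun setT (fun x : R => (x - m) * sin (a + t * (x - m)) * g x).
    apply: measurable_funM; last exact: measurable_normal_pdf.
    by apply: measurable_funM => //; exact: measurable_funB.
  exact/measurable_EFinP.
by move=> x _ /=; rewrite lee_fin !normrM normr_id ler_wpM2r// ler_piMr// sin_max.
Qed.

Let psi a t := \int[mu]_x (cos (a + t * (x - m)) * g x).

Let is_derive_normal_pdf (x : R) : is_derive x (1 : R) g (- ((x - m) / s ^+ 2) * g x).
Proof.
rewrite (_ : g = fun x => normal_peak s * expR (- (s ^+ 2 *+ 2)^-1 * (x - m) ^+ 2)); last first.
  by apply/funext => y; rewrite normal_pdf_expR; congr (_ * expR _); ring.
apply: is_derive_eq; rewrite /GRing.scale/= -[_ *+ 2]mulr_natr.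
by field.
Qed.

Let is_derive_sin_pdf (a t x : R) : is_derive x (1 : R) (fun x => sin (a + t * (x - m)) * g x)
  (t * (cos (a + t * (x - m)) * g x) - (s ^+ 2)^-1 * ((x - m) * sin (a + t * (x - m)) * g x)).
Proof.
have := is_derive_normal_pdf x => dg.
by apply: is_derive_eq; rewrite /GRing.scale/=; field.
Qed.

Let sin_pdf_cont (a t : R) : continuous (fun x : R => sin (a + t * (x - m)) * g x).
Proof.
by move=> x; apply/differentiable_continuous/derivable1_diffP;
  have [] := is_derive_sin_pdf a t x.
Qed.

(** Stein's identity. [f] is the derivative of [F]; its integrals over growing intervals about [m]
    are increments of [F], which vanish in the limit because [F] decays at infinity. *)
Lemma normal_by_parts (a t : R) :
  \int[mu]_x ((x - m) * sin (a + t * (x - m)) * g x) = s ^+ 2 * t * psi a t.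
Proof.
pose F (x : R) := sin (a + t * (x - m)) * g x.
pose f (x : R) := t * (cos (a + t * (x - m)) * g x) -
  (s ^+ 2)^-1 * ((x - m) * sin (a + t * (x - m)) * g x).
have gc : continuous g by exact: continuous_normal_pdf.
have lc : continuous (fun x : R => a + t * (x - m)).
  move=> x; apply: cvgD; first exact: cvg_cst.
  by apply: cvgM; [exact: cvg_cst|apply: cvgB; [exact: cvg_id|exact: cvg_cst]].
have fc : continuous f.
  move=> x; apply: cvgB; apply: cvgM; try exact: cvg_cst.
    apply: cvgM; last exact: gc.
    by apply: continuous_comp; [exact: lc|exact: continuous_cos].
  apply: cvgM; last exact: gc.
  apply: cvgM; first by apply: cvgB; [exact: cvg_id|exact: cvg_cst].
  by apply: continuous_comp; [exact: lc|exact: continuous_sin].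
have i1 : mu.-integrable setT (EFin \o (fun x => t * (cos (a + t * (x - m)) * g x))).
  by have := integrableZl measurableT t (icos a t).
have i2 : mu.-integrable setT
    (EFin \o (fun x => (s ^+ 2)^-1 * ((x - m) * sin (a + t * (x - m)) * g x))).
  by have := integrableZl measurableT (s ^+ 2)^-1 (isin a t).
have if_ : mu.-integrable setT (EFin \o f).
  by have := integrableB measurableT i1 i2.
suff f0 : \int[mu]_x f x = 0.
  move: f0; rewrite RintegralB//.
  rewrite !RintegralZl// -/(psi a t) => h.
  rewrite -mulrA -[t * _](subrK ((s ^+ 2)^-1 * \int[mu]_x ((x - m) * sin (a + t * (x - m)) * g x))) h add0r mulrA divff ?mul1r//.
  by rewrite gt_eqF.
pose I (n : nat) := `[m - n.+1%:R, m + n.+1%:R]%classic : set R.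
have FTC n : (\int[mu]_x ((EFin \o f) \_ (I n)) x = (F (m + n.+1%:R) - F (m - n.+1%:R))%:E)%E.
  have ab : m - n.+1%:R < m + n.+1%:R by have : 0 < n.+1%:R :> R by []; lra.
  rewrite -integral_mkcond /I (@continuous_FTC2 R f F _ _ ab)//.
  - exact: continuous_subspaceT.
  - split.
    + by move=> x _; have [] := is_derive_sin_pdf a t x.
    + by apply: cvg_at_right_filter; exact: sin_pdf_cont.
    + by apply: cvg_at_left_filter; exact: sin_pdf_cont.
  - by move=> x _; rewrite derive1E; have [_ ->] := is_derive_sin_pdf a t x.
have mf : measurable_fun setT (EFin \o f) by exact: measurable_int if_.
have cI : (\int[mu]_x ((EFin \o f) \_ (I n)) x)%E @[n --> \oo] --> (\int[mu]_x (EFin \o f) x)%E.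
  have h1 n : measurable_fun setT ((EFin \o f) \_ (I n)).
    apply/(measurable_restrictT _ (measurable_itv _)).
    exact: measurable_funTS.
  have h3 : {ae mu, forall x, setT x ->
      ((EFin \o f) \_ (I n)) x @[n --> \oo] --> (EFin \o f) x}.
    apply: aeW => x _; apply: cvg_near_cst; near=> n.
    rewrite patchE mem_set//= /I /= in_itv/= -ler_distlC.
    apply: (le_trans (ltW (truncnS_gt _))); rewrite ler_nat ltnS; near: n.
    exact: nbhs_infty_ge.
  have h5 : {ae mu, forall x n, setT x ->
      (`|((EFin \o f) \_ (I n)) x| <= (abse \o (EFin \o f)) x)%E}.
    apply: aeW => x n _; rewrite patchE; case: ifP => _ //=.
    by rewrite normr0 lee_fin.
  by have [_ _] := @dominated_convergence _ (measurableTypeR R) R mu setT measurableT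
    (fun n => (EFin \o f) \_ (I n)) (EFin \o f) (abse \o (EFin \o f))
    h1 mf h3 (integrable_abse if_) h5.
have cF : F (m + n.+1%:R) - F (m - n.+1%:R) @[n --> \oo] --> (0 : R).
  pose C := 2 * `|s| * normal_peak (Num.sqrt 2 * s).
  have q0 : Num.sqrt 2 * s != 0 :> R by rewrite mulf_neq0// gt_eqF// sqrtr_gt0.
  have C0 : 0 <= C by rewrite !mulr_ge0// normal_peak_ge0.
  have gC (x : R) : 0 < `|x - m| -> `|F x| <= C / `|x - m|.
    move=> x0; rewrite ler_pdivlMr// /F normrM [X in _ * X * _]ger0_norm ?normal_pdf_ge0//.
    have h1 := norm_mul_normal_pdf_le x.
    have h2 : 2 * `|s| * normal_pdf m (Num.sqrt 2 * s) x <= C.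
      by rewrite ler_wpM2l ?mulr_ge0// normal_pdf_ub.
    have h3 := sin_max (a + t * (x - m)); have h4 := normal_pdf_ge0 m s x.
    rewrite -mulrA [g x * _]mulrC (le_trans _ (le_trans h1 h2))// ler_piMl// mulr_ge0//.
  have cC : C / n.+1%:R @[n --> \oo] --> (0 : R).
    by rewrite -[X in _ --> X](mulr0 C); apply: cvgM; [exact: cvg_cst|exact: cvg_harmonic].
  have c1 : F (m + n.+1%:R) @[n --> \oo] --> (0 : R).
    apply: norm_cvg0; apply: (squeeze_cvgr _ (cvg_cst 0) cC); apply: nearW => n.
    rewrite normr_ge0/=; have := gC (m + n.+1%:R).
    by rewrite addrAC subrr add0r ger0_norm//; apply.
  have c2 : F (m - n.+1%:R) @[n --> \oo] --> (0 : R).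
    apply: norm_cvg0; apply: (squeeze_cvgr _ (cvg_cst 0) cC); apply: nearW => n.
    rewrite normr_ge0/=; have := gC (m - n.+1%:R).
    by rewrite addrAC subrr add0r normrN ger0_norm//; apply.
  by rewrite -[X in _ --> X](subrr 0); exact: cvgB.
have FTC' : (fun n => (\int[mu]_x ((EFin \o f) \_ (I n)) x)%E) =
    (fun n => (F (m + n.+1%:R) - F (m - n.+1%:R))%:E) by apply/funext.
rewrite FTC' in cI.
by rewrite /Rintegral -[0]/(fine 0%:E); congr fine; have := cvg_unique _ cI (cvg_EFin' cF); apply.
Unshelve. all: by end_near. Qed.

(** Differentiating under the integral brings down (x - m) sin, and integration by parts turns this
    back into [psi]: a linear differential equation in [t]. *)
Let derive_psi (a t : R) : is_derive t (1 : R) (psi a) (- (s ^+ 2 * t * psi a t)).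
Proof.
pose f (u x : R) := cos (a + u * (x - m)) * g x.
have df (u x : R) : is_derive u (1 : R) (f ^~ x) (- ((x - m) * sin (a + u * (x - m)) * g x)).
  by apply: is_derive_eq; rewrite /GRing.scale/=; ring.
have It : `](t - 1), (t + 1)[%classic t by rewrite /= in_itv/=; lra.
have d1 u x : (partial1of2 f) u x = - ((x - m) * sin (a + u * (x - m)) * g x).
  by rewrite partial1of2E; have [_ ->] := df u x.
have ub u x : `](t - 1), (t + 1)[%classic u -> setT x -> `|(partial1of2 f) u x| <= `|x - m| * g x.
  move=> _ _; rewrite d1 normrN !normrM [X in _ * X]ger0_norm ?normal_pdf_ge0//.
  by rewrite ler_wpM2r ?normal_pdf_ge0// ler_piMr// sin_max.
have G0 y : 0 <= `|y - m| * g y by rewrite mulr_ge0// normal_pdf_ge0.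
have der u x : `](t - 1), (t + 1)[%classic u -> setT x -> derivable (f ^~ x) u 1.
  by move=> _ _; have [] := df u x.
have intf u : `](t - 1), (t + 1)[%classic u -> mu.-integrable setT (EFin \o f u).
  by move=> _; exact: icos.
have D1 := derivable_under_integral measurableT It intf der G0 integrable_norm_mul_normal_pdf ub.
have D2 := differentiation_under_integral measurableT It intf der G0 integrable_norm_mul_normal_pdf ub.
apply: DeriveDef; first exact: D1.
rewrite -derive1E; move: D2; rewrite /psi => ->.
under eq_Rintegral => x _ do rewrite d1 -mulN1r.
by rewrite RintegralZl// normal_by_parts mulN1r.
Qed.

(** Multiplied by the integrating factor exp (s^2 t^2 / 2), [psi a] has zero derivative, and its
    value at 0 is cos a. *)
Lemma psiE (a t : R) : psi a t = expR (- (s ^+ 2 * t ^+ 2 / 2)) * cos a.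
Proof.
pose Phi (t : R) := expR (s ^+ 2 * t ^+ 2 / 2) * psi a t.
have dPhi (x : R) : is_derive x (1 : R) Phi 0.
  have := derive_psi a x => dp.
  by apply: is_derive_eq; rewrite /GRing.scale/=; field.
have := is_derive_0_is_cst t 0 dPhi.
rewrite /Phi expr0n/= mulr0 mul0r expR0 mul1r => h.
have : psi a 0 = cos a.
  rewrite /psi; under eq_Rintegral => x _ do rewrite mul0r addr0.
  rewrite RintegralZl//; last exact: integrable_normal_pdf.
  by rewrite /Rintegral integral_normal_pdf mulr1.
by move=> <-; rewrite -h mulrA -expRD addNr expR0 mul1r.
Qed.

Lemma Ex_cos_normal_prob (a t : R) :
  Ex (normal_prob m s) (fun x => cos (a + t * x)) =
  expR (- (s ^+ 2 * t ^+ 2 / 2)) * cos (a + t * m).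
Proof.
have mc : measurable_fun setT (fun x : R => cos (a + t * x)).
  by apply: measurable_cosD; exact: measurable_funM.
rewrite Ex_normal_prob//; last first.
  by apply: (@integ_bounded _ _ _ (normal_prob m s) _ 1) => // x; exact: cos_max.
rewrite -psiE; apply: eq_Rintegral => x _; congr (cos _ * _); ring.
Qed.

End NormalDensity.

Section NormalLaw.
Context {R : realType} d (T : measurableType d) (P : probability T R).

(** [X] is compared with the identity under the target law; variance 0 is settled separately with
    the Dirac mass. *)
Lemma normal_law_cos (X : T -> R) (m v : R) : measurable_fun setT X -> 0 <= v ->
  (forall a t : R, Ex P (fun w => cos (a + t * X w)) =
    expR (- (v * t ^+ 2 / 2)) * cos (a + t * m)) ->
  forall A, measurable A -> P (X @^-1` A) = normal_law m v A.
Proof.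
move=> mX v0 hX A mA; rewrite /normal_law; case: eqP => [v00|/eqP vn0].
  transitivity ((\d_m : probability R R) (id @^-1` A)) => //.
  apply: law_cos_unique => // a t; rewrite hX v00 mul0r mul0r oppr0 expR0 mul1r.
  rewrite /Ex /Rintegral integral_dirac//=.
    by rewrite indicT mul1r.
  by apply/measurable_EFinP; apply: measurable_cosD; exact: measurable_funM.
transitivity (normal_prob m (Num.sqrt v) (id @^-1` A)) => //.
apply: law_cos_unique => // a t; rewrite hX Ex_cos_normal_prob.
  by rewrite sqr_sqrtr.
by rewrite gt_eqF// sqrtr_gt0 lt_def vn0.
Qed.

End NormalLaw.

(** * Product spaces and construction of Gaussian vectors *)

Section ProductExpectation.
Context {R : realType} d (T : measurableType d) (P : probability T R)
  d' (T' : measurableType d') (P' : probability T' R).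
Let prod_setT : (P \x P')%E setT = 1%E.
Proof.
rewrite -setXTT product_measure1E// -[RHS]mule1.
by congr (_ * _)%E; exact: probability_setT.
Qed.

Definition product_probability : probability (T * T')%type R :=
  let m := (P \x P')%E in
  let h := Measure_isProbability.Build _ _ R m prod_setT in HB.pack m h.

Local Notation PP := product_probability.

Let int_cst (c : \bar R) : (\int[P']_y c = c)%E.
Proof.
rewrite (integral_cst P' measurableT) -[RHS]mule1.
by congr (_ * _)%E; exact: probability_setT.
Qed.

Let int_cst' (c : \bar R) : (\int[P]_y c = c)%E.
Proof.
rewrite (integral_cst P measurableT) -[RHS]mule1.
by congr (_ * _)%E; exact: probability_setT.
Qed.

Lemma Ex_prod_fst (X : T -> R) : integ P X ->
  integ PP (fun z => X z.1) /\ Ex PP (fun z => X z.1) = Ex P X.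
Proof.
move=> iX; have mX := integ_measurable iX.
have mf : measurable_fun setT (fun z : T * T' => (X z.1)%:E).
  by apply/measurable_EFinP; exact: (measurableT_comp mX).
have i : integ PP (fun z => X z.1).
  apply/(integrable12ltyP P P') => //.
  rewrite (eq_integral (fun x => `|(X x)%:E|%E)); first by have /integrableP[] := iX.
  by move=> x _; exact: (int_cst `|(X x)%:E|%E).
split=> //; rewrite /Ex /Rintegral -(integral12_prod_meas1 (m1 := P) (m2 := P') i).
by congr fine; apply: eq_integral => x _; exact: (int_cst (X x)%:E).
Qed.

Lemma Ex_prod_snd (Y : T' -> R) : integ P' Y ->
  integ PP (fun z => Y z.2) /\ Ex PP (fun z => Y z.2) = Ex P' Y.
Proof.
move=> iY; have mY := integ_measurable iY.
have mf : measurable_fun setT (fun z : T * T' => (Y z.2)%:E).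
  by apply/measurable_EFinP; exact: (measurableT_comp mY).
have i : integ PP (fun z => Y z.2).
  apply/(integrable12ltyP P P') => //.
  rewrite (eq_integral (fun=> \int[P']_y `|(Y y)%:E|)%E)// int_cst'.
  by have /integrableP[] := iY.
split=> //; rewrite /Ex /Rintegral -(integral12_prod_meas1 (m1 := P) (m2 := P') i).
by congr fine; exact: (int_cst' (\int[P']_y (Y y)%:E)%E).
Qed.

Lemma Ex_prod_mul (X : T -> R) (Y : T' -> R) : integ P X -> integ P' Y ->
  integ PP (fun z => X z.1 * Y z.2) /\
  Ex PP (fun z => X z.1 * Y z.2) = Ex P X * Ex P' Y.
Proof.
move=> iX iY; have [i1 e1] := Ex_prod_fst iX; have [i2 e2] := Ex_prod_snd iY.
have mX := integ_measurable iX; have mY := integ_measurable iY.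
rewrite -e1 -e2; apply: indep2_Ex => // A B mA mB.
have mXA : measurable (X @^-1` A) by rewrite -[X in measurable X]setTI; exact: mX.
have mYB : measurable (Y @^-1` B) by rewrite -[X in measurable X]setTI; exact: mY.
have E1 : PP ((X \o fst) @^-1` A `&` (Y \o snd) @^-1` B) = (P (X @^-1` A) * P' (Y @^-1` B))%E.
  by rewrite -(product_measure1E P P' mXA mYB).
have E2 : PP ((X \o fst) @^-1` A) = P (X @^-1` A).
  rewrite -[RHS]mule1 -(probability_setT P') -(product_measure1E P P' mXA measurableT).
  by congr (PP _); apply/seteqP; split => z /=; [|case].
have E3 : PP ((Y \o snd) @^-1` B) = P' (Y @^-1` B).
  rewrite -[RHS]mul1e -(probability_setT P) -(product_measure1E P P' measurableT mYB).
  by congr (PP _); apply/seteqP; split => z /=; [|case].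
by rewrite E1; congr (_ * _)%E.
Qed.

End ProductExpectation.

(** [G] is a sum of independent standard normals times the vectors of [cs]; each induction step adds
    one real factor to the probability space. *)
Lemma gaussian_exists {R : realType} n (cs : seq 'rV[R]_n) :
  exists d (T : measurableType d) (P : probability T R) (G : T -> 'rV[R]_n),
    random_mx G /\ forall (a : R) (t : 'rV[R]_n),
      Ex P (fun w => cos (a + dotv t (G w))) =
      expR (- ((\sum_(c <- cs) dotv t c ^+ 2) / 2)) * cos a.
Proof.
elim: cs => [|c cs [d [T [P [G [mG hG]]]]]].
  exists _, R, (\d_(0 : R) : probability R R), (fun=> 0); split.
    by move=> i j; exact: measurable_cst.
  move=> a t; rewrite big_nil mul0r oppr0 expR0 mul1r.
  have -> : dotv t 0 = 0 by rewrite /dotv big1// => i _; rewrite mxE mulr0.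
  by rewrite addr0 Ex_cst.
exists _, (T * measurableTypeR R)%type, (product_probability P (normal_prob 0 1)), (fun z => G z.1 + z.2 *: c).
split.
  move=> i j; under eq_fun do rewrite !mxE.
  apply: measurable_funD; first exact: (measurableT_comp (mG i j)).
  by apply: measurable_funM => //; exact: measurable_snd.
move=> a t; pose tau := dotv t c.
have cosb a1 : integ P (fun w => cos (a1 + dotv t (G w))).
  apply: (integ_bounded P (C := 1)) => [|w]; last exact: cos_max.
  by apply: measurable_cosD; exact: measurable_dotv.
have cosn a1 : integ (normal_prob 0 1) (fun x => cos (a1 + tau * x)).
  apply: (integ_bounded (normal_prob 0 1) (C := 1)) => [|w]; last exact: cos_max.
  by apply: measurable_cosD; exact: measurable_funM.
have [i1 e1] := Ex_prod_mul (cosb a) (cosn 0).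
have [i2 e2] := Ex_prod_mul (cosb (a - pi / 2)) (cosn (- (pi / 2))).
(* Addition formula, with sines written as cosines of phase - pi / 2. The second product has
   expectation 0, because the sine of a centred normal does. *)
transitivity (Ex (product_probability P (normal_prob 0 1))
  (fun z => cos (a + dotv t (G z.1)) * cos (0 + tau * z.2) -
            cos (a - pi / 2 + dotv t (G z.1)) * cos (- (pi / 2) + tau * z.2))).
  congr Ex; apply/funext => z.
  have -> : dotv t (G z.1 + z.2 *: c) = dotv t (G z.1) + tau * z.2.
    rewrite /tau /dotv mulr_suml -big_split/=; apply: eq_bigr => i _.
    by rewrite !mxE; ring.
  rewrite addrA (_ : a - pi / 2 + _ = (a + dotv t (G z.1)) - pi / 2); last ring.
  by rewrite [LHS]cosD add0r cosBpihalf [- _ + _]addrC cosBpihalf.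
rewrite ExB// e1 e2 !hG !Ex_cos_normal_prob ?oner_eq0//.
rewrite mulr0 !addr0 cosN cos_pihalf !mulr0 subr0 cos0 mulr1 big_cons mulrDl opprD expRD.
by rewrite expr1n mul1r -/tau; ring.
Qed.

(** Completing the square in the first coordinate and induction on the Schur complement [D'].
    Singular [S] is allowed, so the pivot [a] may vanish. *)
Lemma psd_sum_of_squares {R : realType} n (S : 'M[R]_n) : S^T = S ->
  (forall t : 'rV[R]_n, 0 <= (t *m S *m t^T) 0 0) ->
  exists cs : seq 'rV[R]_n, forall t, (t *m S *m t^T) 0 0 = \sum_(c <- cs) dotv t c ^+ 2.
Proof.
elim: n S => [|n IH] S Ssym Spsd.
  exists [::] => t; rewrite big_nil.
  by rewrite [t *m S](_ : _ = 0) ?mul0mx ?mxE//; apply/rowP => -[].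
move: S Ssym Spsd; rewrite -[n.+1]/(1 + n)%N => S Ssym Spsd.
pose a := ulsubmx S 0 0; pose b : 'rV_n := ursubmx S; pose D := drsubmx S.
have Db : dlsubmx S = b^T by rewrite /b trmx_ursub Ssym.
have Dsym : D^T = D by rewrite /D trmx_drsub Ssym.
have dotvE (y z : 'rV[R]_n) : (y *m z^T) 0 0 = dotv y z.
  by rewrite mxE /dotv; apply: eq_bigr => i _; rewrite mxE.
have qE (x : R) (y : 'rV_n) : (row_mx x%:M y *m S *m (row_mx x%:M y)^T) 0 0 =
    a * x ^+ 2 + 2 * x * dotv y b + (y *m D *m y^T) 0 0.
  have aE : ulsubmx S = a%:M by rewrite [LHS]mx11_scalar.
  have -> : S = block_mx a%:M b b^T D by rewrite -aE -Db /b /D submxK.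
  rewrite mul_row_block tr_row_mx tr_scalar_mx mul_row_col !mulmxDl !mul_scalar_mx.
  rewrite !scale_scalar_mx -!scalemxAl.
  have mD (A B : 'M[R]_1) : (A + B) 0 0 = A 0 0 + B 0 0 by rewrite mxE.
  have mZ c (B : 'M[R]_1) : (c *: B) 0 0 = c * B 0 0 by rewrite mxE.
  have mS (c : R) : (c%:M : 'M[R]_1) 0 0 = c by rewrite mxE eqxx.
  rewrite !mul_mx_scalar !mD !mZ !mS !dotvE.
  have -> : dotv b y = dotv y b by apply: eq_bigr => i _; rewrite mulrC.
  ring.
have rowE (t : 'rV[R]_(1 + n)) : t = row_mx (t 0 0)%:M (rsubmx t).
  rewrite -[LHS]hsubmxK [lsubmx t]mx11_scalar; congr (row_mx _%:M _).
  by rewrite mxE; congr (t _ _); exact/val_inj.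
have dotE (x x' : R) (y y' : 'rV_n) :
    @dotv R (1 + n) (row_mx x%:M y) (row_mx x'%:M y') = x * x' + dotv y y'.
  rewrite /dotv big_split_ord /= big_ord1 !row_mxEl !mxE eqxx !mulr1n; congr (_ + _).
  by apply: eq_bigr => i _; rewrite !row_mxEr.
have a0 : 0 <= a.
  have := Spsd (row_mx 1%:M 0); rewrite qE expr1n mulr1 mul0mx mul0mx mxE.
  by rewrite (_ : dotv 0 b = 0) ?mulr0 ?addr0// /dotv big1// => i _; rewrite mxE mul0r.
have [aE|an0] := eqVneq a 0.
  (* With a zero pivot the form is affine in the first coordinate; unless its slope vanishes, the
     chosen coordinate gives it the value -1. *)
  have b0 y : dotv y b = 0.
    apply/eqP/negP => /negP bn0; set q := (y *m D *m y^T) 0 0.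
    have := Spsd (row_mx (- (q + 1) / (2 * dotv y b))%:M y).
    rewrite qE aE mul0r add0r -/q.
    by rewrite (_ : 2 * _ * _ = - (q + 1)); [lra|field].
  have [|cs hcs] := IH D Dsym.
    by move=> y; have := Spsd (row_mx 0%:M y); rewrite qE b0 expr0n/= mulr0 mulr0 !add0r.
  exists [seq row_mx 0%:M c | c <- cs] => t; rewrite (rowE t) qE b0 aE mul0r mulr0 !add0r.
  rewrite big_map hcs; apply: eq_bigr => c _.
  by rewrite dotE mulr0 add0r.
have ap : 0 < a by rewrite lt_def an0.
pose D' := D - a^-1 *: (b^T *m b).
have qD' y : (y *m D' *m y^T) 0 0 = (y *m D *m y^T) 0 0 - a^-1 * dotv y b ^+ 2.
  rewrite /D' mulmxBr mulmxBl -scalemxAr -scalemxAl.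
  rewrite (_ : y *m (b^T *m b) *m y^T = (y *m b^T) *m (b *m y^T)); last by rewrite !mulmxA.
  have mB (A B : 'M[R]_1) : (A - B) 0 0 = A 0 0 - B 0 0 by rewrite !mxE.
  have mZ c (B : 'M[R]_1) : (c *: B) 0 0 = c * B 0 0 by rewrite mxE.
  have mM (A B : 'M[R]_1) : (A *m B) 0 0 = A 0 0 * B 0 0 by rewrite mxE big_ord1.
  rewrite mB mZ mM !dotvE expr2; congr (_ - _ * (_ * _)).
  by apply: eq_bigr => i _; rewrite mulrC.
have [||cs hcs] := IH D'.
- by rewrite /D' linearB/= linearZ/= trmx_mul trmxK Dsym.
- move=> y; have := Spsd (row_mx (- dotv y b / a)%:M y); rewrite qE qD'.
  by congr (0 <= _); field.
(* The completed square is (sqrt a x + (y . b) / sqrt a)^2. *)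
pose c0 : 'rV[R]_(1 + n) := row_mx (Num.sqrt a)%:M ((Num.sqrt a)^-1 *: b).
exists (c0 :: [seq row_mx 0%:M c | c <- cs]) => t.
rewrite (rowE t) qE big_cons big_map.
set x := t 0 0; set y := rsubmx (t : 'rV[R]_(1 + n)).
have s0 : Num.sqrt a != 0 by rewrite gt_eqF// sqrtr_gt0.
have sa : Num.sqrt a ^+ 2 = a by rewrite sqr_sqrtr.
have -> : \sum_(c <- cs) @dotv R (1 + n) (row_mx x%:M y) (row_mx 0%:M c) ^+ 2 =
    (y *m D' *m y^T) 0 0.
  by rewrite hcs; apply: eq_bigr => c _; rewrite dotE mulr0 add0r.
rewrite qD' dotE (_ : dotv y (_ *: b) = (Num.sqrt a)^-1 * dotv y b); last first.
  by rewrite /dotv mulr_sumr; apply: eq_bigr => i _; rewrite !mxE; ring.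
move: sa s0; generalize (Num.sqrt a) => r <- r0; field.
by rewrite r0.
Qed.

(** * Central limit theorem for independent rows *)

Lemma near_cvg {T : Type} {U : topologicalType} {F : set_system T} {FF : Filter F}
  (f g : T -> U) (l : U) : f @ F --> l -> (\forall x \near F, f x = g x) -> g @ F --> l.
Proof. by move=> fl fg; apply: cvg_trans fl; exact: near_eq_cvg. Qed.

Lemma cvg_mean {R : realType} (u : nat -> R) (l : R) : u @ \oo --> l ->
  n%:R^-1 * \sum_(j < n) u j @[n --> \oo] --> l.
Proof.
move=> /cesaro h; rewrite -cvg_shiftS; apply: near_cvg h _; apply: nearW => n /=.
by rewrite /arithmetic_mean /series/= big_mkord.
Qed.

(** * Taylor bounds for sine, cosine and exponential *)

Section RealInequalities.
Context {R : realType}.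
Implicit Types x u : R.

(** Mean value theorem. Applied alternately to sine and cosine, it yields the successive Taylor
    bounds below. *)
Lemma ge0_of_derive (f df : R -> R) : (forall x, is_derive x (1 : R) f (df x)) ->
  f 0 = 0 -> (forall x, 0 <= x -> 0 <= df x) -> forall x, 0 <= x -> 0 <= f x.
Proof.
move=> fd f0 df0 x; rewrite le_eqVlt => /orP[/eqP<-|x0]; first by rewrite f0.
have cf : {within `[0, x], continuous f}.
  apply: continuous_subspaceT => y; apply/differentiable_continuous/derivable1_diffP.
  by have [] := fd y.
have [c] := MVT x0 (fun y _ => fd y) cf; rewrite in_itv/= => /andP[c0 _].
rewrite f0 !subr0 => ->; apply: mulr_ge0; last exact: ltW.
by apply: df0; exact: ltW.
Qed.

Lemma sin_le x : 0 <= x -> sin x <= x.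
Proof.
move=> x0; rewrite -subr_ge0; move: x x0; apply: (@ge0_of_derive (fun x => x - sin x) (fun x => 1 - cos x)) => [|y y0].
- by rewrite sin0 subr0.
- by rewrite subr_ge0 cos_le1.
Qed.

Lemma cos_ge x : 0 <= x -> 1 - x ^+ 2 / 2 <= cos x.
Proof.
move=> x0; rewrite -subr_ge0; move: x x0; apply: (@ge0_of_derive (fun x => cos x - (1 - x ^+ 2 / 2)) (fun x => x - sin x)) => [y||y y0].
- by apply: is_derive_eq; rewrite /GRing.scale/=; field.
- by rewrite cos0 expr0n/= mul0r subr0 subrr.
- by rewrite subr_ge0 sin_le.
Qed.

Lemma sin_ge x : 0 <= x -> x - x ^+ 3 / 6 <= sin x.
Proof.
move=> x0; rewrite -subr_ge0; move: x x0; apply: (@ge0_of_derive (fun x => sin x - (x - x ^+ 3 / 6)) (fun x => cos x - (1 - x ^+ 2 / 2))) => [y||y y0].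
- by apply: is_derive_eq; rewrite /GRing.scale/=; field.
- by rewrite sin0 expr0n/= mul0r subr0 subrr.
- by rewrite subr_ge0 cos_ge.
Qed.

Lemma cos_le x : 0 <= x -> cos x <= 1 - x ^+ 2 / 2 + x ^+ 4 / 24.
Proof.
move=> x0; rewrite -subr_ge0; move: x x0; apply: (@ge0_of_derive (fun x => 1 - x ^+ 2 / 2 + x ^+ 4 / 24 - cos x) (fun x => sin x - (x - x ^+ 3 / 6))) => [y||y y0].
- by apply: is_derive_eq; rewrite /GRing.scale/=; field.
- by rewrite cos0 !expr0n/= !mul0r subr0 addr0 subrr.
- by rewrite subr_ge0 sin_ge.
Qed.

(** A common bound for the remainders sin x - x and cos x - 1 + x^2 / 2: cubic near 0, quadratic far
    away, so that a second moment suffices to integrate it. *)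
Definition cub x := Num.min (x ^+ 2) (`|x| ^+ 3).

Lemma cub_ge0 x : 0 <= cub x.
Proof. by rewrite /cub le_min sqr_ge0 exprn_ge0. Qed.

Lemma cub_norm x : cub `|x| = cub x.
Proof. by rewrite /cub normr_id real_normK ?num_real. Qed.

Lemma cubE x : 0 <= x -> cub x = Num.min (x ^+ 2) (x ^+ 3).
Proof. by move=> x0; rewrite /cub ger0_norm. Qed.

Lemma cub_le x y : `|x| <= `|y| -> cub x <= cub y.
Proof.
move=> xy; rewrite -(cub_norm x) -(cub_norm y) !cubE// le_min !ge_min.
by rewrite !lerXn2r ?nnegrE//= orbT.
Qed.

Lemma cubZ c x : cub (c * x) <= (c ^+ 2 + `|c| ^+ 3) * cub x.
Proof.
have h1 := sqr_ge0 c; have h2 : 0 <= `|c| ^+ 3 by rewrite exprn_ge0.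
rewrite /cub normrM !exprMn; case: (leP (x ^+ 2) (`|x| ^+ 3)) => h.
  by rewrite ge_min ler_wpM2r ?sqr_ge0 ?lerDl.
by rewrite ge_min ler_wpM2r ?orbT ?exprn_ge0 ?lerDr.
Qed.

(** The sum is at most twice the larger term in absolute value, and 12 = 2^2 + 2^3 is the factor of
    [cubZ] at 2. *)
Lemma cubD x y : cub (x + y) <= 12 * (cub x + cub y).
Proof.
wlog xy : x y / `|x| <= `|y|.
  move=> h; case: (leP `|x| `|y|) => [|/ltW]; first exact: h.
  by move=> /h; rewrite addrC [cub y + _]addrC.
have h1 : cub (x + y) <= cub (2 * y).
  apply: cub_le; rewrite normrM ger0_norm// (le_trans (ler_normD _ _))//; lra.
have h2 := cubZ 2 y; rewrite ger0_norm// in h2.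
have := cub_ge0 x; have := cub_ge0 y; move: h1 h2.
have -> : 2 ^+ 2 + 2 ^+ 3 = 12 :> R by ring.
lra.
Qed.

Lemma sin_cub x : `|sin x - x| <= cub x.
Proof.
wlog x0 : x / 0 <= x.
  move=> h; case: (leP 0 x) => [/h//|/ltW]; rewrite -oppr_ge0 => /h.
  by rewrite sinN -opprD normrN -[cub (- x)]cub_norm normrN cub_norm.
have h1 := sin_le x0; have h2 := sin_ge x0; have h3 := sin_geN1 x.
have x30 : 0 <= x ^+ 3 by rewrite exprn_ge0.
rewrite distrC ger0_norm ?subr_ge0// cubE// le_min; apply/andP; split; last lra.
(* Up to 6 the bound x^3 / 6 is below x^2; beyond 6, sin x >= -1 is enough. *)
by case: (leP x 6) => x6; [have : x ^+ 3 = x * x ^+ 2 by rewrite exprS|]; nra.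
Qed.

Lemma cos_cub x : `|cos x - 1 + x ^+ 2 / 2| <= cub x.
Proof.
wlog x0 : x / 0 <= x.
  move=> h; case: (leP 0 x) => [/h//|/ltW]; rewrite -oppr_ge0 => /h.
  by rewrite cosN sqrrN -[cub (- x)]cub_norm normrN cub_norm.
have h1 := cos_ge x0; have h2 := cos_le x0; have h3 := cos_le1 x.
have x30 : 0 <= x ^+ 3 by rewrite exprn_ge0.
have x20 := sqr_ge0 x.
rewrite ger0_norm; last lra.
rewrite cubE// le_min; apply/andP; split; first lra.
have e4 : x ^+ 4 = x * x ^+ 3 by rewrite exprS.
have e3 : x ^+ 3 = x * x ^+ 2 by rewrite exprS.
(* Up to 24 the remainder x^4 / 24 is below x^3; beyond 24, cos x <= 1 is enough. *)
by case: (leP x 24) => x24; nra.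
Qed.

(** exp (- u) <= 1 / (1 + u) <= 1 - u + u^2, the last because (1 - u + u^2) (1 + u) = 1 + u^3. *)
Lemma expR_quad u : 0 <= u -> `|expR (- u) - 1 + u| <= u ^+ 2.
Proof.
move=> u0; have h1 := expR_ge1Dx (- u); have h2 := expR_ge1Dx u.
have h3 : expR (- u) * expR u = 1 by rewrite -expRD addNr expR0.
have h4 := expR_gt0 (- u).
rewrite ger0_norm; last lra.
have h5 : expR (- u) * (1 + u) <= 1 by nra.
have h6 : 1 <= (1 - u + u ^+ 2) * (1 + u).
  have -> : (1 - u + u ^+ 2) * (1 + u) = 1 + u ^+ 3 by ring.
  by rewrite lerDl exprn_ge0.
have : expR (- u) <= 1 - u + u ^+ 2.
  by rewrite -(ler_pM2r (_ : 0 < 1 + u)); [lra|lra].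
lra.
Qed.

Lemma measurable_cub : measurable_fun setT cub.
Proof.
apply: measurable_minr; first exact: exprn_measurable.
by apply: measurable_funX; exact: normr_measurable.
Qed.

Lemma cub_le_sqr x : cub x <= x ^+ 2. Proof. by rewrite /cub ge_min lexx. Qed.

End RealInequalities.

(** * Sums over independent rows and Lindeberg's condition *)

Section IndependentRows.
Context {d} {T : measurableType d} {R : realType} (P : probability T R)
  {I : choiceType} (y : I -> {RV P >-> R}) (row : I -> nat).
Hypothesis indy : mutually_independent P (fun i => sigma_RV (y i)).

Definition of_row (j : nat) (X : T -> R) := fun_of y (fun i => row i == j) X.
Definition before (j : nat) (X : T -> R) := fun_of y (fun i => (row i < j)%N) X.

Lemma of_row_sum (x : nat -> T -> R) n : (forall j, of_row j (x j)) ->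
  before n (fun w => \sum_(j < n) x j w).
Proof.
move=> hx; elim: n => [|n IH].
  have -> : (fun w => \sum_(j < 0) x j w) = cst 0.
    by apply/funext => w; rewrite big_ord0.
  exact: measurable_cst.
have -> : (fun w => \sum_(j < n.+1) x j w) = fun w => \sum_(j < n) x j w + x n w.
  by apply/funext => w; rewrite big_ord_recr.
apply: measurable_funD.
  by apply: fun_of_sub IH => i; exact: ltnW.
by apply: fun_of_sub (hx n) => i /eqP->.
Qed.

Lemma before_row_Ex n X Y : before n X -> of_row n Y -> integ P X -> integ P Y ->
  integ P (fun w => X w * Y w) /\ Ex P (fun w => X w * Y w) = Ex P X * Ex P Y.
Proof.
by apply: fun_of_Ex => // i h /eqP e; rewrite e ltnn in h.
Qed.

Let mcosD K (a : R) X : fun_of y K X -> fun_of y K (fun w => cos (a + X w)).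
Proof.
move=> mX; apply: (measurableT_comp (f := @cos R)).
  by apply: continuous_measurable_fun => x; exact: continuous_cos.
by apply: measurable_funD => //; exact: measurable_cst.
Qed.

Let icosD (a : R) X : measurable_fun setT X -> integ P (fun w => cos (a + X w)).
Proof.
move=> mX; apply: (integ_bounded P (C := 1)) => [|w]; last exact: cos_max.
exact: measurable_cosD.
Qed.

(** Rows are replaced one at a time: the addition formula and independence split off the last row,
    whose cosine mean is traded for exp (- u) and whose sine mean counts as error. *)
Lemma cos_sum_indep (x : nat -> T -> R) (u : nat -> R) n : (forall j, of_row j (x j)) ->
  (forall j, 0 <= u j) -> forall a : R,
  `|Ex P (fun w => cos (a + \sum_(j < n) x j w)) -
    expR (- \sum_(j < n) u j) * cos a| <=
  \sum_(j < n) (`|Ex P (fun w => cos (x j w)) - expR (- u j)| +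
                `|Ex P (fun w => sin (x j w))|).
Proof.
move=> hx u0; elim: n => [|n IH] a.
  under eq_fun => w do rewrite big_ord0 addr0.
  by rewrite Ex_cst !big_ord0 oppr0 expR0 mul1r subrr normr0.
set S := fun w => \sum_(j < n) x j w.
have bS : before n S by exact: of_row_sum.
have mS : measurable_fun setT S by exact: fun_of_measurable bS.
have mx : measurable_fun setT (x n) by exact: fun_of_measurable (hx n).
have cE (b c : R) : integ P (fun w => cos (b + S w) * cos (c + x n w)) /\
    Ex P (fun w => cos (b + S w) * cos (c + x n w)) =
    Ex P (fun w => cos (b + S w)) * Ex P (fun w => cos (c + x n w)).
  by apply: before_row_Ex; [exact: (mcosD b bS)|exact: (mcosD c (hx n))|exact: icosD|exact: icosD].
have [i1 e1] := cE a 0; have [i2 e2] := cE (a - pi / 2) (- (pi / 2)).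
have sinE : (fun w => cos (- (pi / 2) + x n w)) = fun w => sin (x n w).
  by apply/funext => w; rewrite addrC cosBpihalf.
have cosE' : (fun w => cos (0 + x n w)) = fun w => cos (x n w).
  by apply/funext => w; rewrite add0r.
rewrite [Ex P _](_ : _ = Ex P (fun w => cos (a + S w) * cos (0 + x n w) -
    cos (a - pi / 2 + S w) * cos (- (pi / 2) + x n w))); last first.
  congr Ex; apply/funext => w; rewrite big_ord_recr/= -/(S w) addrA [LHS]cosD add0r.
  rewrite (_ : a - pi / 2 + S w = (a + S w) - pi / 2); last ring.
  by rewrite cosBpihalf [- _ + _]addrC cosBpihalf.
rewrite ExB// e1 e2 sinE cosE' !big_ord_recr/=.
set A := Ex P (fun w => cos (a + S w)); set B := Ex P (fun w => cos (a - _ + _)).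
set C := Ex P (fun w => cos (x n w)); set D := Ex P (fun w => sin (x n w)).
have {}IH := IH a; rewrite -/S -/A in IH.
have A1 : `|A| <= 1 by apply: Ex_norm_bounded => [|w]; [exact: icosD|exact: cos_max].
have B1 : `|B| <= 1 by apply: Ex_norm_bounded => [|w]; [exact: icosD|exact: cos_max].
rewrite opprD expRD.
set V := expR (- \sum_(j < n) u j); set W := expR (- u n).
have W0 : 0 <= W by exact: expR_ge0.
have W1 : W <= 1 by rewrite -[leRHS]expR0 ler_expR oppr_le0.
(* [A], [B] and [W] are at most 1 in absolute value, so the errors add up without amplification. *)
have -> : A * C - B * D - V * W * cos a = (A - V * cos a) * W + A * (C - W) - B * D by ring.
apply: (le_trans (ler_normB _ _)); rewrite addrA; apply: lerD; last first.
  by rewrite normrM ler_piMl.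
apply: (le_trans (ler_normD _ _)); apply: lerD; rewrite normrM; last by rewrite ler_piMl.
by rewrite (ger0_norm W0) (le_trans _ IH)// ler_piMr.
Qed.

Lemma integ_cub (X : T -> R) c : measurable_fun setT X -> integ P (fun w => X w ^+ 2) ->
  integ P (fun w => cub (c * X w)).
Proof.
move=> mX iX; apply: (integ_le _ (integZ (c ^+ 2) iX)).
  apply: (measurableT_comp (f := cub)); first exact: measurable_cub.
  exact: measurable_funM.
move=> w; rewrite ger0_norm ?cub_ge0//.
by rewrite -exprMn cub_le_sqr.
Qed.

(* Uniform Lindeberg condition; the truncated moment is replaced by the
   smoother [cub], which is subadditive up to a constant. *)
Definition lindeberg (z : nat -> T -> R) := forall e : R, 0 < e ->
  \forall n \near \oo, forall j,
    n%:R * Ex P (fun w => cub ((Num.sqrt n%:R)^-1 * z j w)) <= e.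

(** Centering removes the linear Taylor term and the common variance fixes the quadratic one; [cub]
    bounds all that remains. *)
Lemma clt_cos (z : nat -> T -> R) (v : R) : (forall j, of_row j (z j)) ->
  (forall j, integ P (fun w => z j w ^+ 2)) -> (forall j, Ex P (z j) = 0) ->
  (forall j, Ex P (fun w => z j w ^+ 2) = v) -> lindeberg z ->
  forall a : R, Ex P (fun w => cos (a + (Num.sqrt n%:R)^-1 * \sum_(j < n) z j w))
    @[n --> \oo] --> expR (- (v / 2)) * cos a.
Proof.
move=> hz iz z0 zv lz a; apply/cvgrPdist_le => e e0.
have v0 : 0 <= v by rewrite -(zv 0%N); apply: Ex_ge0 => w; exact: sqr_ge0.
have e4 : 0 < e / 4 by rewrite divr_gt0.
near=> n.
have n0 : (0 < n)%N by near: n; exact: nbhs_infty_gt.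
have nR : 0 < n%:R :> R by rewrite ltr0n.
have L : forall j, n%:R * Ex P (fun w => cub ((Num.sqrt n%:R)^-1 * z j w)) <= e / 4.
  by near: n; exact: lz.
set s : R := (Num.sqrt n%:R)^-1.
rewrite -/s in L.
have s2 : s ^+ 2 = n%:R^-1 by rewrite exprVn sqr_sqrtr.
pose x j w := s * z j w.
have hx j : of_row j (x j).
  by apply: measurable_funM; [exact: measurable_cst|exact: hz].
(* Half the variance of one normalized row; the [n] rows add up to the exponent v / 2. *)
pose u := v / (2 * n%:R).
have u0 : 0 <= u by rewrite divr_ge0// mulr_ge0.
have sumu : \sum_(j < n) u = v / 2.
  rewrite sumr_const card_ord -[_ *+ n]mulr_natr /u; field.
  by rewrite gt_eqF.
have mz j : measurable_fun setT (z j) by exact: fun_of_measurable (hz j).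
have mx j : measurable_fun setT (x j) by exact: fun_of_measurable (hx j).
have icub j := integ_cub s (mz j) (iz j).
have := cos_sum_indep n hx (fun _ => u0) a; rewrite sumu -/u.
under [X in `|Ex P X - _| <= _]eq_fun => w do rewrite -mulr_sumr.
rewrite distrC => /le_trans; apply.
have Lj j : Ex P (fun w => cub (s * z j w)) <= e / 4 / n%:R.
  by rewrite ler_pdivlMr// mulrC.
have iz1 j : integ P (z j) by apply: integ_sqr.
have b1 j : `|Ex P (fun w => sin (x j w))| <= e / 4 / n%:R.
  apply: le_trans (Lj j).
  have ix : integ P (x j) by exact: integZ.
  have is_ : integ P (fun w => sin (x j w)).
    apply: (integ_bounded P (C := 1)) => [|w]; last exact: sin_max.
    apply: (measurableT_comp (f := @sin R)) => //.
    by apply: continuous_measurable_fun => t; exact: continuous_sin.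
  have -> : Ex P (fun w => sin (x j w)) = Ex P (fun w => sin (x j w) - x j w).
    by rewrite ExB// /x ExZ// z0 mulr0 subr0.
  apply: Ex_norm_le => //; first exact: integB.
  by move=> w; exact: sin_cub.
have b2 j : `|Ex P (fun w => cos (x j w)) - expR (- u)| <= e / 4 / n%:R + u ^+ 2.
  have ic : integ P (fun w => cos (x j w)).
    by have := icosD 0 (mx j); under eq_fun do rewrite add0r.
  have i2 : integ P (fun w => x j w ^+ 2 / 2).
    under eq_fun => w do rewrite /x exprMn mulrAC.
    exact: integZ.
  have E2 : Ex P (fun w => x j w ^+ 2 / 2) = u.
    under eq_fun => w do rewrite /x exprMn mulrAC.
    by rewrite ExZ// zv s2 /u; field; rewrite gt_eqF.
  have E : Ex P (fun w => cos (x j w) - 1 + x j w ^+ 2 / 2) = Ex P (fun w => cos (x j w)) - 1 + u.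
    rewrite ExD//; last by apply: integB => //; exact: integ_cst.
    by rewrite ExB//; [rewrite E2 Ex_cst|exact: integ_cst].
  rewrite [X in `|X|](_ : _ = Ex P (fun w => cos (x j w) - 1 + x j w ^+ 2 / 2) -
    (expR (- u) - 1 + u)); last by rewrite E; ring.
  apply: (le_trans (ler_normB _ _)); apply: lerD; last exact: expR_quad.
  apply: le_trans (Lj j); apply: Ex_norm_le => //.
    by apply: integD => //; apply: integB => //; exact: integ_cst.
  by move=> w; exact: cos_cub.
apply: (@le_trans _ _ (\sum_(j < n) (e / 4 / n%:R + u ^+ 2 + e / 4 / n%:R))).
  by apply: ler_sum => j _; apply: lerD; [exact: b2|exact: b1].
rewrite sumr_const card_ord -[_ *+ n]mulr_natr.
(* The two [cub] errors contribute e / 2 over all rows, and n u^2 = v^2 / (4n) is eventually below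
   the other half. *)
have -> : (e / 4 / n%:R + u ^+ 2 + e / 4 / n%:R) * n%:R = e / 2 + (v ^+ 2 / 4) / n%:R.
  by rewrite /u; field; rewrite gt_eqF.
have : (v ^+ 2 / 4) / n%:R <= e / 2.
  rewrite ler_pdivrMr// -ler_pdivrMl ?divr_gt0//.
  near: n; exact: nbhs_infty_ger.
lra.
Unshelve. all: by end_near. Qed.

Lemma lindebergD (z z' : nat -> T -> R) :
  (forall j, measurable_fun setT (z j)) -> (forall j, measurable_fun setT (z' j)) ->
  (forall j, integ P (fun w => z j w ^+ 2)) -> (forall j, integ P (fun w => z' j w ^+ 2)) ->
  lindeberg z -> lindeberg z' -> lindeberg (fun j w => z j w + z' j w).
Proof.
move=> mz mz' iz iz' lz lz' e e0.
(* 24 is twice the constant 12 of [cubD], one share for each summand. *)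
have e' : 0 < e / 24 by rewrite divr_gt0.
near=> n => j.
have L : forall j, n%:R * Ex P (fun w => cub ((Num.sqrt n%:R)^-1 * z j w)) <= e / 24.
  by near: n; exact: lz.
have L' : forall j, n%:R * Ex P (fun w => cub ((Num.sqrt n%:R)^-1 * z' j w)) <= e / 24.
  by near: n; exact: lz'.
set s : R := (Num.sqrt n%:R)^-1.
have i1 := integ_cub s (mz j) (iz j); have i2 := integ_cub s (mz' j) (iz' j).
have iD : integ P (fun w => cub (s * (z j w + z' j w))).
  apply: (integ_le _ (integZ 12 (integD i1 i2))).
    apply: (measurableT_comp (f := cub)); first exact: measurable_cub.
    by apply: measurable_funM => //; exact: measurable_funD.
  by move=> w; rewrite ger0_norm ?cub_ge0// mulrDr cubD.
have : Ex P (fun w => cub (s * (z j w + z' j w))) <=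
    12 * (Ex P (fun w => cub (s * z j w)) + Ex P (fun w => cub (s * z' j w))).
  rewrite -ExD// -ExZ; last exact: integD.
  apply: Ex_le => //; first by apply: integZ; exact: integD.
  by move=> w; rewrite mulrDr cubD.
have n0 : 0 <= n%:R :> R by [].
move=> /(ler_wpM2l n0); have := L j; have := L' j; rewrite -/s; lra.
Unshelve. all: by end_near. Qed.

Lemma lindebergZ (c : R) (z : nat -> T -> R) :
  (forall j, measurable_fun setT (z j)) -> (forall j, integ P (fun w => z j w ^+ 2)) ->
  lindeberg z -> lindeberg (fun j w => c * z j w).
Proof.
move=> mz iz lz e e0.
pose k := c ^+ 2 + `|c| ^+ 3 + 1.
have k0 : 0 < k by have := sqr_ge0 c; have := exprn_ge0 3 (normr_ge0 c); rewrite /k; lra.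
have e' : 0 < e / k by rewrite divr_gt0.
near=> n => j.
have L : forall j, n%:R * Ex P (fun w => cub ((Num.sqrt n%:R)^-1 * z j w)) <= e / k.
  by near: n; exact: lz.
set s : R := (Num.sqrt n%:R)^-1.
have i1 := integ_cub s (mz j) (iz j).
have le1 w : cub (s * (c * z j w)) <= k * cub (s * z j w).
  rewrite mulrCA (le_trans (cubZ _ _))// ler_wpM2r ?cub_ge0// /k; lra.
have iZ : integ P (fun w => cub (s * (c * z j w))).
  apply: (integ_le _ (integZ k i1)).
    apply: (measurableT_comp (f := cub)); first exact: measurable_cub.
    by apply: measurable_funM => //; exact: measurable_funM.
  by move=> w; rewrite ger0_norm ?cub_ge0.
have : Ex P (fun w => cub (s * (c * z j w))) <= k * Ex P (fun w => cub (s * z j w)).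
  by rewrite -ExZ//; apply: Ex_le => //; exact: integZ.
have n0 : 0 <= n%:R :> R by [].
move=> /(ler_wpM2l n0) /le_trans; apply; rewrite mulrCA.
by rewrite mulrC -ler_pdivlMr//; exact: L.
Unshelve. all: by end_near. Qed.

Lemma lindeberg0 : lindeberg (fun _ _ => 0).
Proof.
move=> e e0; apply: nearW => n j.
have -> : (fun w : T => cub ((Num.sqrt n%:R)^-1 * 0 : R)) = fun=> 0.
  by apply/funext => w; rewrite mulr0 /cub expr0n/= normr0 expr0n/= minxx.
by rewrite Ex_cst mulr0 ltW.
Qed.

Lemma integ_sqrD (X Y : T -> R) : measurable_fun setT X -> measurable_fun setT Y ->
  integ P (fun w => X w ^+ 2) -> integ P (fun w => Y w ^+ 2) ->
  integ P (fun w => (X w + Y w) ^+ 2).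
Proof.
move=> mX mY iX iY; have i := integ_sqr_mul mX mY iX iY.
have -> : (fun w => (X w + Y w) ^+ 2) = fun w => X w ^+ 2 + 2 * (X w * Y w) + Y w ^+ 2.
  by apply/funext => w; ring.
by apply: integD => //; apply: integD => //; exact: integZ.
Qed.

Lemma integ_sqrZ (c : R) (X : T -> R) : integ P (fun w => X w ^+ 2) ->
  integ P (fun w => (c * X w) ^+ 2).
Proof. by move=> iX; under eq_fun => w do rewrite exprMn; exact: integZ. Qed.

Lemma integ_sqr_sum J (s : seq J) (X : J -> T -> R) :
  (forall j, measurable_fun setT (X j)) -> (forall j, integ P (fun w => X j w ^+ 2)) ->
  measurable_fun setT (fun w => \sum_(j <- s) X j w) /\
  integ P (fun w => (\sum_(j <- s) X j w) ^+ 2).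
Proof.
move=> mX iX; elim: s => [|j s [m i]].
  under eq_fun do rewrite big_nil; under [X in integ _ X]eq_fun do rewrite big_nil.
  by split; [exact: measurable_cst|exact: integ_cst].
under eq_fun do rewrite big_cons; under [X in integ _ X]eq_fun do rewrite big_cons.
by split; [exact: measurable_funD|exact: integ_sqrD].
Qed.

Lemma Ex_sqr_row_sum (x : nat -> T -> R) n : (forall j, of_row j (x j)) ->
  (forall j, integ P (fun w => x j w ^+ 2)) -> (forall j, Ex P (x j) = 0) ->
  Ex P (fun w => (\sum_(j < n) x j w) ^+ 2) = \sum_(j < n) Ex P (fun w => x j w ^+ 2).
Proof.
move=> hx ix x0; have mx j : measurable_fun setT (x j) := fun_of_measurable (hx j).
elim: n => [|n IH].
  under eq_fun do rewrite big_ord0 expr0n/=.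
  by rewrite Ex_cst big_ord0.
have [mS iS] := integ_sqr_sum (index_enum 'I_n) (fun j : 'I_n => mx j) (fun j : 'I_n => ix j).
have [i e] := before_row_Ex (of_row_sum (n := n) hx) (hx n) (integ_sqr mS iS) (integ_sqr (mx n) (ix n)).
have -> : (fun w => (\sum_(j < n.+1) x j w) ^+ 2) = fun w => (\sum_(j < n) x j w) ^+ 2 +
    2 * ((\sum_(j < n) x j w) * x n w) + x n w ^+ 2.
  by apply/funext => w; rewrite big_ord_recr/=; ring.
rewrite ExD//; last by apply: integD => //; exact: integZ.
rewrite ExD//; last exact: integZ.
by rewrite ExZ// e x0 mulr0 mulr0 addr0 IH big_ord_recr.
Qed.

End IndependentRows.

(** * L^2-negligible factors *)

Section CauchySchwarz.
Context {d} {T : measurableType d} {R : realType} (P : probability T R).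
Implicit Types X Y : T -> R.

(** The nonnegative quadratic E (tX + Y)^2 is evaluated at its minimizer - b / a; when a = 0 it is
    affine in t, which forces b = 0. *)
Lemma Ex_cauchy_schwarz X Y : measurable_fun setT X -> measurable_fun setT Y ->
  integ P (fun w => X w ^+ 2) -> integ P (fun w => Y w ^+ 2) ->
  Ex P (fun w => X w * Y w) ^+ 2 <= Ex P (fun w => X w ^+ 2) * Ex P (fun w => Y w ^+ 2).
Proof.
move=> mX mY iX iY; have iXY := integ_sqr_mul mX mY iX iY.
set a := Ex P (fun w => X w ^+ 2); set b := Ex P (fun w => X w * Y w).
set c := Ex P (fun w => Y w ^+ 2).
have a0 : 0 <= a by apply: Ex_ge0 => w; exact: sqr_ge0.
have h t : 0 <= a * t ^+ 2 + 2 * t * b + c.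
  have : 0 <= Ex P (fun w => (t * X w + Y w) ^+ 2) by apply: Ex_ge0 => w; exact: sqr_ge0.
  have -> : (fun w => (t * X w + Y w) ^+ 2) =
      fun w => t ^+ 2 * X w ^+ 2 + (2 * t) * (X w * Y w) + Y w ^+ 2.
    by apply/funext => w; ring.
  rewrite ExD//; last by apply: integD; exact: integZ.
  by rewrite ExD ?ExZ//; [rewrite mulrC|exact: integZ|exact: integZ].
have [aE|an0] := eqVneq a 0.
  have b0 : b = 0.
    apply/eqP/negP => /negP bn0; have := h (- (c + 1) / (2 * b)).
    rewrite aE mul0r add0r (_ : 2 * _ * b = - (c + 1)); [lra|field].
    by rewrite bn0.
  by rewrite b0 aE expr0n/= mul0r.
have ap : 0 < a by rewrite lt_def an0.
have := h (- b / a); rewrite (_ : a * _ + _ + c = (a * c - b ^+ 2) / a); last by field.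
by rewrite pmulr_lge0 ?invr_gt0// subr_ge0.
Qed.

Lemma cvg_Ex_mul (A r : nat -> T -> R) (C : R) :
  (forall n, measurable_fun setT (A n)) -> (forall n, measurable_fun setT (r n)) ->
  (forall n, integ P (fun w => A n w ^+ 2)) -> (forall n, integ P (fun w => r n w ^+ 2)) ->
  (\forall n \near \oo, Ex P (fun w => A n w ^+ 2) <= C) ->
  Ex P (fun w => r n w ^+ 2) @[n --> \oo] --> (0 : R) ->
  Ex P (fun w => A n w * r n w) @[n --> \oo] --> (0 : R).
Proof.
move=> mA mr iA ir AC /cvgrPdist_le r0; apply/cvgrPdist_le => e e0.
have e' : 0 < e ^+ 2 / (`|C| + 1) by rewrite divr_gt0 ?exprn_gt0// ltr_wpDl.
have r0' := r0 _ e'; near=> n; rewrite sub0r normrN.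
have h : `|0 - Ex P (fun w => r n w ^+ 2)| <= e ^+ 2 / (`|C| + 1) by near: n.
have AC' : Ex P (fun w => A n w ^+ 2) <= C by near: n.
have EA0 : 0 <= Ex P (fun w => A n w ^+ 2) by apply: Ex_ge0 => w; exact: sqr_ge0.
have Er0 : 0 <= Ex P (fun w => r n w ^+ 2) by apply: Ex_ge0 => w; exact: sqr_ge0.
move: h; rewrite sub0r normrN ger0_norm// ler_pdivlMr ?ltr_wpDl//.
rewrite (ger0_norm (le_trans EA0 AC')).
move=> h; have cs := Ex_cauchy_schwarz (mA n) (mr n) (iA n) (ir n).
rewrite -[leRHS]ger0_norm ?(ltW e0)// -ler_sqr ?nnegrE// !real_normK ?num_real//.
by nra.
Unshelve. all: by end_near. Qed.

Lemma cvg_Ex_norm (r : nat -> T -> R) :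
  (forall n, measurable_fun setT (r n)) -> (forall n, integ P (fun w => r n w ^+ 2)) ->
  Ex P (fun w => r n w ^+ 2) @[n --> \oo] --> (0 : R) ->
  Ex P (fun w => `|r n w|) @[n --> \oo] --> (0 : R).
Proof.
move=> mr ir /cvgrPdist_le r0; apply/cvgrPdist_le => e e0.
have e' : 0 < e ^+ 2 by rewrite exprn_gt0.
have r0' := r0 _ e'; near=> n; rewrite sub0r normrN.
have h : `|0 - Ex P (fun w => r n w ^+ 2)| <= e ^+ 2 by near: n.
rewrite sub0r normrN in h.
rewrite -[leRHS]ger0_norm ?(ltW e0)// -ler_sqr ?nnegrE// !real_normK ?num_real//.
apply: (le_trans (Ex_sqr_ge (mr n) (ir n))); exact: le_trans (ler_norm _) h.
Unshelve. all: by end_near. Qed.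

Lemma cos_lipschitz (u v : R) : `|cos u - cos v| <= `|u - v|.
Proof.
pose p := (u + v) / 2; pose q := (u - v) / 2.
have -> : u = p + q by rewrite /p /q; field.
have -> : v = p - q by rewrite /p /q; field.
rewrite cosD cosB (_ : _ - _ - (_ + _) = - (2 * (sin p * sin q))); last ring.
rewrite (_ : p + q - (p - q) = 2 * q); last ring.
rewrite normrN normrM [leRHS]normrM ler_wpM2l// normrM -[leRHS]mul1r ler_pM// ?sin_max//.
clearbody q.
have h (z : R) : 0 <= z -> `|sin z| <= z.
  move=> z0; rewrite ler_norml sin_le// andbT.
  have := sin_ge z0; have := sin_geN1 z; case: (leP z 1) => z1; last lra.
  by have : z ^+ 3 <= z; [rewrite exprS ler_piMr// exprn_ile1|lra].
case: (leP 0 q) => q0; first by rewrite [leRHS]ger0_norm ?h.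
by have := h (- q); rewrite sinN normrN (ltr0_norm q0); apply; lra.
Qed.

End CauchySchwarz.

(** * Statistics asymptotically linear in centred row features *)

Section Asymptotics.
Context {d} {T : measurableType d} {R : realType} (P : probability T R)
  {I : choiceType} (y : I -> {RV P >-> R}) (row : I -> nat).
Hypothesis indy : mutually_independent P (fun i => sigma_RV (y i)).
Context {F : finType} (phi : nat -> F -> T -> R) (Gam : F -> F -> R).
Hypothesis phi_row : forall j f, of_row y row j (phi j f).
Hypothesis phi_sqr : forall j f, integ P (fun w => phi j f w ^+ 2).
Hypothesis phi0 : forall j f, Ex P (phi j f) = 0.
Hypothesis phiG : forall j f g, Ex P (fun w => phi j f w * phi j g w) = Gam f g.
Hypothesis phi_lind : forall f, lindeberg P (fun j => phi j f).

Let mphi (j : nat) (f : F) : measurable_fun setT (phi j f).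
Proof. exact (fun_of_measurable (@phi_row j f)). Qed.

Definition comb (c : F -> R) j w := \sum_f c f * phi j f w.
Definition lin (c : F -> R) n w := (Num.sqrt n%:R)^-1 * \sum_(j < n) comb c j w.
(** The covariance of [comb c j] and [comb c' j], the same for every row [j]. *)
Definition quad (c c' : F -> R) := \sum_f \sum_g c f * c' g * Gam f g.

Lemma comb_row c j : of_row y row j (comb c j).
Proof.
apply: measurable_sum => f; apply: measurable_funM; first exact: measurable_cst.
exact: phi_row.
Qed.

Let mcomb (c : F -> R) (j : nat) : measurable_fun setT (comb c j).
Proof. exact (fun_of_measurable (@comb_row c j)). Qed.

Lemma comb_sqr c j : integ P (fun w => comb c j w ^+ 2).
Proof.
have := @integ_sqr_sum _ _ _ P _ (index_enum F) (fun f w => c f * phi j f w).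
case=> // f; last exact: integ_sqrZ.
by apply: measurable_funM => //; exact: mphi.
Qed.

Lemma comb0 c j : Ex P (comb c j) = 0.
Proof.
rewrite /comb Ex_sum => [|f _]; last by apply: integZ; apply: integ_sqr.
by rewrite big1// => f _; rewrite ExZ ?phi0 ?mulr0//; apply: integ_sqr.
Qed.

Lemma comb_mul c c' j : Ex P (fun w => comb c j w * comb c' j w) = quad c c'.
Proof.
have ip f g : integ P (fun w => phi j f w * phi j g w) by exact: integ_sqr_mul.
have -> : (fun w => comb c j w * comb c' j w) =
    fun w => \sum_f \sum_g (c f * c' g) * (phi j f w * phi j g w).
  apply/funext => w; rewrite /comb big_distrl/=; apply: eq_bigr => f _.
  by rewrite big_distrr/=; apply: eq_bigr => g _; ring.
rewrite Ex_sum => [|f _]; last by apply: integ_sum => g _; exact: integZ.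
apply: eq_bigr => f _; rewrite Ex_sum => [|g _]; last exact: integZ.
by apply: eq_bigr => g _; rewrite ExZ// phiG.
Qed.

Lemma comb_lind c : lindeberg P (comb c).
Proof.
rewrite /comb; elim: (index_enum F) => [|f s IH].
  rewrite (_ : (fun j w => _) = fun _ _ => 0); first exact: lindeberg0.
  by apply/funext => j; apply/funext => w; rewrite big_nil.
rewrite (_ : (fun j w => _) = fun j w => c f * phi j f w + \sum_(g <- s) c g * phi j g w); last first.
  by apply/funext => j; apply/funext => w; rewrite big_cons.
have H j := @integ_sqr_sum _ _ _ P _ s (fun f w => c f * phi j f w)
  (fun f => measurable_funM (measurable_cst (c f)) (mphi j f))
  (fun f => integ_sqrZ (c f) (phi_sqr j f)).
apply: lindebergD => // [j|j|j|j|].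
- by apply: measurable_funM => //; exact: mphi.
- by have [] := H j.
- exact: integ_sqrZ.
- by have [] := H j.
- by apply: lindebergZ => // j; exact: mphi.
Qed.

Lemma lin_cos c (a : R) : Ex P (fun w => cos (a + lin c n w)) @[n --> \oo] -->
  expR (- (quad c c / 2)) * cos a.
Proof.
apply: (clt_cos indy) => // [j|j|j|j|].
- exact: comb_row.
- exact: comb_sqr.
- exact: comb0.
- by rewrite -(comb_mul c c j); congr Ex.
- exact: comb_lind.
Qed.

Lemma lin_measurable c n : measurable_fun setT (lin c n).
Proof.
apply: measurable_funM; first exact: measurable_cst.
by apply: measurable_sum => j; exact: mcomb.
Qed.

Lemma Ex_sqr_weighted (m : nat -> R) (z : nat -> T -> R) (v : R) n :
  (forall j, of_row y row j (z j)) -> (forall j, integ P (fun w => z j w ^+ 2)) ->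
  (forall j, Ex P (z j) = 0) -> (forall j, Ex P (fun w => z j w ^+ 2) = v) ->
  integ P (fun w => ((Num.sqrt n%:R)^-1 * \sum_(j < n) m j * z j w) ^+ 2) /\
  Ex P (fun w => ((Num.sqrt n%:R)^-1 * \sum_(j < n) m j * z j w) ^+ 2) =
  n%:R^-1 * (\sum_(j < n) m j ^+ 2) * v.
Proof.
move=> hz iz z0 zv.
have mz j : measurable_fun setT (z j) := fun_of_measurable (hz j).
have i2 j : integ P (fun w => (m j * z j w) ^+ 2) by exact: integ_sqrZ.
have mm j : measurable_fun setT (fun w => m j * z j w) by exact: measurable_funM.
have [m1 i1] := integ_sqr_sum (index_enum 'I_n) (fun j : 'I_n => mm j) (fun j : 'I_n => i2 j).
have s2 : ((Num.sqrt n%:R)^-1) ^+ 2 = n%:R^-1 :> R by rewrite exprVn sqr_sqrtr.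
split; first exact: integ_sqrZ.
have -> : (fun w => ((Num.sqrt n%:R)^-1 * \sum_(j < n) m j * z j w) ^+ 2) =
    fun w => n%:R^-1 * (\sum_(j < n) m j * z j w) ^+ 2.
  by apply/funext => w; rewrite exprMn s2.
rewrite ExZ// (Ex_sqr_row_sum (row := row) (x := fun j w => m j * z j w) indy) //.
- rewrite -mulrA mulr_suml; congr (_ * _); apply: eq_bigr => j _.
  under eq_fun do rewrite exprMn.
  by rewrite ExZ// zv.
- by move=> j; apply: measurable_funM; [exact: measurable_cst|exact: hz].
- by move=> j; rewrite ExZ ?z0 ?mulr0//; apply: integ_sqr.
Qed.

(** The factor [n%:R^-1 * n%:R] is kept because it is 1 for positive [n] but 0 for [n = 0]. *)
Lemma lin_sqr c n : integ P (fun w => lin c n w ^+ 2) /\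
  Ex P (fun w => lin c n w ^+ 2) = n%:R^-1 * n%:R * quad c c.
Proof.
have := Ex_sqr_weighted (fun=> 1) n (comb_row c) (comb_sqr c) (comb0 c)
  (fun j => comb_mul c c j).
rewrite (_ : (fun w => _) = fun w => lin c n w ^+ 2); last first.
  by apply/funext => w; rewrite /lin; under eq_bigr do rewrite mul1r.
by rewrite expr1n sumr_const card_ord.
Qed.

(** Asymptotic linearity in L^2 with coefficients [c]. The notion is stable under sums and
    convergent deterministic factors, and [c] alone determines the limiting covariances and the
    limit law. *)
Definition asymp (Q : nat -> T -> R) (c : F -> R) :=
  [/\ forall n, measurable_fun setT (Q n), forall n, integ P (fun w => Q n w ^+ 2) &
      Ex P (fun w => (Q n w - lin c n w) ^+ 2) @[n --> \oo] --> (0 : R)].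

Let mlin (c : F -> R) (n : nat) : measurable_fun setT (lin c n).
Proof. exact: lin_measurable. Qed.

Let ilin (c : F -> R) (n : nat) : integ P (fun w => lin c n w ^+ 2).
Proof. by have [] := lin_sqr c n. Qed.

Lemma quad_ge0 c : 0 <= quad c c.
Proof. by rewrite -(comb_mul c c 0%N); apply: Ex_ge0 => w; rewrite -expr2 sqr_ge0. Qed.

Lemma lin_sqr_le c n : Ex P (fun w => lin c n w ^+ 2) <= quad c c.
Proof.
have [_ ->] := lin_sqr c n; case: n => [|n]; first by rewrite mulr0 mul0r quad_ge0.
by rewrite mulVf ?pnatr_eq0// mul1r.
Qed.

Let asymp_sub Q c n : asymp Q c ->
  measurable_fun setT (fun w => Q n w - lin c n w) /\
  integ P (fun w => (Q n w - lin c n w) ^+ 2).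
Proof.
case=> mQ iQ _; split; first exact: measurable_funB.
have h := @integ_sqrD _ _ _ P (Q n) (fun w => (-1) * lin c n w) (mQ n) (measurable_funM (measurable_cst _) (mlin c n)) (iQ n) (integ_sqrZ (-1) (ilin c n)).
by move: h; under eq_fun do rewrite mulN1r.
Qed.

Lemma Ex_sqrD_le (X Y : T -> R) : measurable_fun setT X -> measurable_fun setT Y ->
  integ P (fun w => X w ^+ 2) -> integ P (fun w => Y w ^+ 2) ->
  Ex P (fun w => (X w + Y w) ^+ 2) <=
  2 * Ex P (fun w => X w ^+ 2) + 2 * Ex P (fun w => Y w ^+ 2).
Proof.
move=> mX mY iX iY.
have i2 : integ P (fun w => 2 * X w ^+ 2 + 2 * Y w ^+ 2) by apply: integD; exact: integZ.
rewrite -!ExZ// -ExD; [|exact: integZ|exact: integZ].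
apply: Ex_le => //; first exact: integ_sqrD.
move=> w; have := sqr_ge0 (X w - Y w); nra.
Qed.

Let squeeze0 (f g : nat -> R) : (forall n, 0 <= f n <= g n) ->
  g @ \oo --> (0 : R) -> f @ \oo --> (0 : R).
Proof.
move=> fg g0; apply: (squeeze_cvgr _ (cvg_cst 0) g0).
by apply: nearW => n; exact: fg.
Qed.

Lemma linD c c' n w : lin (fun f => c f + c' f) n w = lin c n w + lin c' n w.
Proof.
rewrite /lin -mulrDr -big_split/=; congr (_ * _); apply: eq_bigr => j _.
by rewrite /comb -big_split/=; apply: eq_bigr => f _; rewrite mulrDl.
Qed.

Lemma linZ (k : R) c n w : lin (fun f => k * c f) n w = k * lin c n w.
Proof.
rewrite /lin mulrCA; congr (_ * _); rewrite mulr_sumr; apply: eq_bigr => j _.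
by rewrite /comb mulr_sumr; apply: eq_bigr => f _; rewrite mulrA.
Qed.

Lemma asympD Q Q' c c' : asymp Q c -> asymp Q' c' ->
  asymp (fun n w => Q n w + Q' n w) (fun f => c f + c' f).
Proof.
move=> h h'; have [mQ iQ cQ] := h; have [mQ' iQ' cQ'] := h'; split.
- by move=> n; exact: measurable_funD.
- by move=> n; exact: integ_sqrD.
apply: (@squeeze0 _ (fun n => 2 * Ex P (fun w => (Q n w - lin c n w) ^+ 2) +
  2 * Ex P (fun w => (Q' n w - lin c' n w) ^+ 2))); last first.
  by rewrite -[0](addr0 0) -[in X in X + _](mulr0 2) -[in X in _ + X](mulr0 2);
    apply: cvgD; apply: cvgMr.
move=> n; rewrite Ex_ge0/=; last by move=> w; exact: sqr_ge0.
have [m1 i1] := asymp_sub n h; have [m2 i2] := asymp_sub n h'.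
apply: le_trans (Ex_sqrD_le m1 m2 i1 i2).
rewrite le_eqVlt; apply/orP; left; apply/eqP; congr Ex; apply/funext => w.
by rewrite linD; ring.
Qed.

(** The error splits into k_n (Q_n - lin) and (k_n - l) lin; the first inherits the L^2 convergence
    of [Q], and the second moment of [lin] is bounded by [quad c c]. *)
Lemma asympZ (k : nat -> R) (l : R) Q c : k @ \oo --> l -> asymp Q c ->
  asymp (fun n w => k n * Q n w) (fun f => l * c f).
Proof.
move=> kl h; have [mQ iQ cQ] := h; split.
- by move=> n; exact: measurable_funM.
- by move=> n; exact: integ_sqrZ.
apply: (@squeeze0 _ (fun n => 2 * (k n ^+ 2 * Ex P (fun w => (Q n w - lin c n w) ^+ 2)) +
  2 * ((k n - l) ^+ 2 * quad c c))); last first.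
  rewrite (_ : 0 = 2 * (l ^+ 2 * 0) + 2 * ((l - l) ^+ 2 * quad c c)); last by ring.
  apply: cvgD; apply: cvgMr; apply: cvgM => //; last exact: cvg_cst.
    by rewrite expr2; under eq_fun do rewrite expr2; apply: cvgM.
  have : (k n - l) @[n --> \oo] --> l - l by apply: cvgB => //; exact: cvg_cst.
  by move=> kl0; rewrite expr2; under eq_fun do rewrite expr2; apply: cvgM.
move=> n; rewrite Ex_ge0/=; last by move=> w; exact: sqr_ge0.
have [m1 i1] := asymp_sub n h.
have mA : measurable_fun setT (fun w => k n * (Q n w - lin c n w)) by exact: measurable_funM.
have mB : measurable_fun setT (fun w => (k n - l) * lin c n w) by exact: measurable_funM.
have := Ex_sqrD_le mA mB (integ_sqrZ (k n) i1) (integ_sqrZ (k n - l) (ilin c n)).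
rewrite [X in X <= _](_ : _ = Ex P (fun w => (k n * Q n w - lin (fun f => l * c f) n w) ^+ 2)); last first.
  by congr Ex; apply/funext => w; rewrite linZ; ring.
move=> /le_trans; apply.
under eq_fun => w do rewrite exprMn; under [X in _ + 2 * Ex P X <= _]eq_fun => w do rewrite exprMn.
rewrite ExZ// ExZ; last exact: ilin.
by rewrite lerD2l ler_pM2l// ler_wpM2l ?sqr_ge0// lin_sqr_le.
Qed.

Lemma asymp_lin c : asymp (lin c) c.
Proof.
split; [exact: lin_measurable|exact: ilin|].
under eq_fun => n do under eq_fun => w do rewrite subrr expr0n/=.
by under eq_fun do rewrite Ex_cst; exact: cvg_cst.
Qed.

Lemma asymp0 : asymp (fun _ _ => 0) (fun=> 0).
Proof.
have c0 : (fun=> 0 : R) @ \oo --> (0 : R) by exact: cvg_cst.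
have := asympZ c0 (asymp_lin (fun=> 0)).
under eq_fun => n do under eq_fun => w do rewrite mul0r.
by under [X in asymp _ X]eq_fun do rewrite mul0r.
Qed.

Lemma asymp_sum J (s : seq J) (Q : J -> nat -> T -> R) (c : J -> F -> R) :
  (forall j, asymp (Q j) (c j)) ->
  asymp (fun n w => \sum_(j <- s) Q j n w) (fun f => \sum_(j <- s) c j f).
Proof.
move=> h; elim: s => [|j s IH].
  under eq_fun => n do under eq_fun => w do rewrite big_nil.
  under [X in asymp _ X]eq_fun do rewrite big_nil.
  exact: asymp0.
under eq_fun => n do under eq_fun => w do rewrite big_cons.
under [X in asymp _ X]eq_fun do rewrite big_cons.
exact: asympD.
Qed.

(** Replacing the weights by their limit leaves an error with second moment n^-1 \sum (m_j - l)^2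
    times [Gam f f], a Cesàro mean tending to 0. *)
Lemma asymp_weight (m : nat -> R) (l : R) (f : F) : m @ \oo --> l ->
  asymp (fun n w => (Num.sqrt n%:R)^-1 * \sum_(j < n) m j * phi j f w)
    (fun g => l * (g == f)%:R).
Proof.
move=> ml.
have W (m' : nat -> R) n := Ex_sqr_weighted m' n (@phi_row^~ f) (phi_sqr^~ f) (phi0^~ f)
  (fun j => phiG j f f).
split.
- move=> n; apply: measurable_funM => //; apply: measurable_sum => j.
  exact: measurable_funM.
- by move=> n; have [] := W m n.
have E n w : (Num.sqrt n%:R)^-1 * (\sum_(j < n) m j * phi j f w) -
    lin (fun g => l * (g == f)%:R) n w =
    (Num.sqrt n%:R)^-1 * (\sum_(j < n) (m j - l) * phi j f w).
  rewrite /lin -mulrBr -sumrB; congr (_ * _); apply: eq_bigr => j _.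
  rewrite mulrBl; congr (_ - _); rewrite /comb (bigD1 f)//= eqxx mulr1 big1 ?addr0// => g /negPf->.
  by rewrite mulr0 mul0r.
under eq_fun => n do under eq_fun => w do rewrite E.
under eq_fun => n do rewrite (W (fun j => m j - l) n).2.
have h : (m j - l) ^+ 2 @[j --> \oo] --> (0 : R).
  have h : (m j - l) @[j --> \oo] --> l - l by apply: cvgB => //; exact: cvg_cst.
  have := cvgM h h; rewrite subrr mul0r => /(_ _) {}h; apply: near_cvg h _.
  by apply: nearW => j; rewrite expr2.
have {}h := cvg_mean h.
have hc : (fun=> Gam f f) @ \oo --> Gam f f by exact: cvg_cst.
by have := cvgM h hc; rewrite mul0r => /(_ _).
Qed.

Lemma quad_sym c c' : quad c c' = quad c' c.
Proof. by rewrite -!(comb_mul _ _ 0%N); congr Ex; apply/funext => w; rewrite mulrC. Qed.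

(** Polarization: [lin_sqr] is used at [c], [c'] and their sum. *)
Lemma lin_mul c c' n : (0 < n)%N -> Ex P (fun w => lin c n w * lin c' n w) = quad c c'.
Proof.
move=> n0; have S e : Ex P (fun w => lin e n w ^+ 2) = quad e e.
  by have [_ ->] := lin_sqr e n; rewrite mulVf ?mul1r// pnatr_eq0 -lt0n.
have i := integ_sqr_mul (mlin c n) (mlin c' n) (ilin c n) (ilin c' n).
have := S (fun f => c f + c' f).
rewrite (_ : (fun w => _) = fun w => lin c n w ^+ 2 + 2 * (lin c n w * lin c' n w) + lin c' n w ^+ 2); last first.
  by apply/funext => w; rewrite linD; ring.
rewrite ExD//; last by apply: integD => //; exact: integZ.
rewrite ExD//; last exact: integZ.
rewrite ExZ// !S (_ : quad (fun f => c f + c' f) _ = quad c c + quad c c' + quad c' c + quad c' c'); last first.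
  rewrite /quad -!big_split/=; apply: eq_bigr => f _; rewrite -!big_split/=.
  by apply: eq_bigr => g _; rewrite !(mulrDl, mulrDr) !addrA addrAC.
rewrite (quad_sym c' c); lra.
Qed.

Lemma asymp_bounded Q c : asymp Q c ->
  \forall n \near \oo, Ex P (fun w => Q n w ^+ 2) <= 2 + 2 * quad c c.
Proof.
move=> h; have [mQ iQ /cvgrPdist_le/(_ _ ltr01) cQ] := h; near=> n.
have : `|0 - Ex P (fun w => (Q n w - lin c n w) ^+ 2)| <= 1 by near: n.
rewrite sub0r normrN ger0_norm; last by apply: Ex_ge0 => w; exact: sqr_ge0.
have [m i] := asymp_sub n h.
have := Ex_sqrD_le m (mlin c n) i (ilin c n).
under eq_fun do rewrite subrK; have := lin_sqr_le c n; lra.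
Unshelve. all: by end_near. Qed.

(** Q Q' = lin lin' + lin (Q' - lin') + Q' (Q - lin); the last two terms vanish in mean by
    Cauchy-Schwarz. This gives the existence and the value of the limit defining [Lambda]. *)
Lemma asymp_prod Q Q' c c' : asymp Q c -> asymp Q' c' ->
  Ex P (fun w => Q n w * Q' n w) @[n --> \oo] --> quad c c'.
Proof.
move=> h h'; have [mQ iQ cQ] := h; have [mQ' iQ' cQ'] := h'.
have c1 : Ex P (fun w => lin c n w * (Q' n w - lin c' n w)) @[n --> \oo] --> (0 : R).
  apply: (@cvg_Ex_mul _ _ _ _ _ _ (quad c c)) => // [n|n|].
  - by have [] := asymp_sub n h'.
  - by have [] := asymp_sub n h'.
  - by apply: nearW => n; exact: lin_sqr_le.
have c2 : Ex P (fun w => Q' n w * (Q n w - lin c n w)) @[n --> \oo] --> (0 : R).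
  apply: (@cvg_Ex_mul _ _ _ _ _ _ (2 + 2 * quad c' c')) => // [n|n|].
  - by have [] := asymp_sub n h.
  - by have [] := asymp_sub n h.
  - exact: asymp_bounded.
have c0 : (fun=> quad c c') @ \oo --> quad c c' by exact: cvg_cst.
have := cvgD (cvgD c0 c1) c2; rewrite !addr0 => /(_ _ _) h0; apply: near_cvg h0 _; near=> n.
have n0 : (0 < n)%N by near: n; exact: nbhs_infty_gt.
rewrite /= -(lin_mul c c' n0).
have [m1 i1] := asymp_sub n h; have [m2 i2] := asymp_sub n h'.
have j0 := integ_sqr_mul (mlin c n) (mlin c' n) (ilin c n) (ilin c' n).
have j1 := integ_sqr_mul (mlin c n) m2 (ilin c n) i2.
have j2 := integ_sqr_mul (mQ' n) m1 (iQ' n) i1.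
rewrite !fctE -ExD// -ExD//; last exact: integD.
by congr Ex; apply/funext => w; ring.
Unshelve. all: by end_near. Qed.

(** The cosine is 1-Lipschitz, so an L^1-small error changes the transform of [lin] negligibly. *)
Lemma asymp_law Q c (a : R) : asymp Q c ->
  Ex P (fun w => cos (a + Q n w)) @[n --> \oo] --> expR (- (quad c c / 2)) * cos a.
Proof.
move=> h; have [mQ iQ cQ] := h.
have ic X : measurable_fun setT X -> integ P (fun w => cos (a + X w)).
  move=> mX; apply: (integ_bounded P (C := 1)) => [|w]; last exact: cos_max.
  exact: measurable_cosD.
have c1 : Ex P (fun w => `|Q n w - lin c n w|) @[n --> \oo] --> (0 : R).
  by apply: cvg_Ex_norm => // n; have [] := asymp_sub n h.
have c2 : Ex P (fun w => cos (a + Q n w)) - Ex P (fun w => cos (a + lin c n w))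
    @[n --> \oo] --> (0 : R).
  apply/norm_cvg0P; apply: squeeze0 c1 => n; rewrite normr_ge0/=.
  have [m1 i1] := asymp_sub n h; have i2 := integ_sqr m1 i1.
  have iQn := ic _ (mQ n); have il := ic _ (mlin c n).
  rewrite -ExB//; apply: Ex_norm_le => //; [exact: integB|exact: integ_norm|].
  move=> w; apply: le_trans (cos_lipschitz _ _) _.
  by rewrite opprD addrACA subrr add0r.
have := cvgD c2 (@lin_cos c a); rewrite add0r => /(_ _) h0; apply: near_cvg h0 _.
by apply: nearW => n /=; rewrite subrK.
Qed.

Lemma asymp_tight Q c (e : R) : asymp Q c -> 0 < e -> exists2 L : R, 0 < L &
  \forall n \near \oo, (P [set w | (L <= `|Q n w|)%R] <= e%:E)%E.
Proof.
move=> h e0; have [mQ iQ _] := h.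
set C := 2 + 2 * quad c c.
have C0 : 0 < C by have := quad_ge0 c; rewrite /C; lra.
(* Chebyshev's bound C / L^2 equals [e] at this [L]. *)
have L0 : 0 < Num.sqrt (C / e) by rewrite sqrtr_gt0 divr_gt0.
exists (Num.sqrt (C / e)) => //; near=> n.
have hC : Ex P (fun w => Q n w ^+ 2) <= C by near: n; exact: asymp_bounded h.
rewrite -(fineK (fin_num_measure P _ (measurable_norm_ge _ (mQ n)))) lee_fin.
apply: (le_trans (chebyshev_Ex (mQ n) (iQ n) L0)).
rewrite sqr_sqrtr; last by rewrite divr_ge0// ltW.
by rewrite ler_pdivrMr ?divr_gt0// mulrCA divff ?mulr1// gt_eqF.
Unshelve. all: by end_near. Qed.

End Asymptotics.

(** * Moments and features of a row *)

Section Grouping.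
Context {d} {T : measurableType d} {R : realType} (P : probability T R).

Lemma big_setI_in {I : eqType} (Q : set (set T)) (J : seq I) (A : I -> set T) :
  Q setT -> (forall B C, Q B -> Q C -> Q (B `&` C)) ->
  (forall i, i \in J -> Q (A i)) -> Q (\big[setI/setT]_(i <- J) A i).
Proof.
move=> QT QI; elim: J => [|i J IH] QA; first by rewrite big_nil.
rewrite big_cons; apply: QI; first by apply: QA; rewrite mem_head.
by apply: IH => j jJ; apply: QA; rewrite inE jJ orbT.
Qed.

(** A finite intersection is split by [kind]: independence of the systems [G k] separates the
    groups, and [hF] factors each group. *)
Lemma mutually_independent_group {I : eqType} {K : finType} (F : I -> set (set T))
    (G : K -> set (set T)) (kind : I -> K) :
  (forall k J (A : I -> set T), uniq J -> (forall i, i \in J -> kind i = k) ->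
    (forall i, i \in J -> F i (A i)) ->
    P (\big[setI/setT]_(i <- J) A i) = (\prod_(i <- J) P (A i))%E) ->
  (forall i, F i `<=` G (kind i)) -> (forall k, G k setT) ->
  (forall k B C, G k B -> G k C -> G k (B `&` C)) ->
  mutually_independent P G -> mutually_independent P F.
Proof.
move=> hF FG GT GI indG J A uJ FA.
pose Jk k := [seq i <- J | kind i == k].
have Jk_kind k i : i \in Jk k -> kind i = k by rewrite mem_filter => /andP[/eqP].
have Jk_F k i : i \in Jk k -> F i (A i) by rewrite mem_filter => /andP[_ /FA].
rewrite (partition_big kind predT)//=.
rewrite [RHS](partition_big kind predT)//=.
have -> : \big[setI/setT]_k \big[setI/setT]_(i <- J | kind i == k) A i =
    \big[setI/setT]_k \big[setI/setT]_(i <- Jk k) A i.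
  by apply: eq_bigr => k _; rewrite big_filter.
rewrite (indG (index_enum K) (fun k => \big[setI/setT]_(i <- Jk k) A i)) ?index_enum_uniq//.
  apply: eq_bigr => k _; rewrite (hF k) ?filter_uniq//; last by move=> i /Jk_F.
    by rewrite big_filter.
  by move=> i /Jk_kind.
move=> k _; apply: big_setI_in => //; first exact: GI.
by move=> i ik; rewrite -(Jk_kind k i ik); apply: FG; exact: Jk_F ik.
Qed.

Lemma seq_in_image {I I' : eqType} (f : I' -> I) (J : seq I) :
  (forall i, i \in J -> exists i', i = f i') -> exists J', J = map f J'.
Proof.
elim: J => [|i J IH] h; first by exists [::].
have [i' ->] := h i (mem_head _ _).
have [|J' ->] := IH; last by exists (i' :: J').
by move=> k kJ; apply: h; rewrite inE kJ orbT.
Qed.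

(** A list contained in the image of [f] is the image of a list, again without repetition, to which
    independence of [F \o f] applies. *)
Lemma mutually_independent_image {I I' : eqType} (f : I' -> I) (F : I -> set (set T))
    (J : seq I) (A : I -> set T) :
  mutually_independent P (F \o f) ->
  (forall i, i \in J -> exists i', i = f i') -> uniq J ->
  (forall i, i \in J -> F i (A i)) ->
  P (\big[setI/setT]_(i <- J) A i) = (\prod_(i <- J) P (A i))%E.
Proof.
move=> ind /seq_in_image[J' ->] /map_uniq uJ' FA.
rewrite !big_map (ind J' (A \o f))// => i iJ; apply: FA.
exact: map_f.
Qed.

Definition model_index p q := (nat * (('I_p + 'I_p) + 'I_q))%type.

Definition model_var {p q} (delta psi : nat -> 'I_p -> {RV P >-> R})
    (eps : nat -> 'I_q -> {RV P >-> R}) (i : model_index p q) : {RV P >-> R} :=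
  match i.2 with
  | inl (inl a) => psi i.1 a
  | inl (inr a) => delta i.1 a
  | inr b => eps i.1 b
  end.

Lemma sub_sigma_array k (X : nat -> 'I_k -> {RV P >-> R}) i j :
  sigma_RV (X i j) `<=` sigma_array X.
Proof.
move=> A hA; apply: sub_sigma_algebra; exists i => //; exists j => //.
Qed.

Lemma model_var_independent p q (delta psi : nat -> 'I_p -> {RV P >-> R})
    (eps : nat -> 'I_q -> {RV P >-> R}) :
  independent_array eps -> independent_array delta -> independent_array psi ->
  mutually_independent P (fun k : 'I_3 =>
    nth set0 [:: sigma_array delta; sigma_array psi; sigma_array eps] k) ->
  mutually_independent P (fun i : model_index p q => sigma_RV (model_var delta psi eps i)).
Proof.
move=> ieps idelta ipsi ind.
(* The numbering follows the list in the independence hypothesis: 0 for [delta], 1 for [psi], 2 for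
   [eps]. *)
pose kind (i : model_index p q) : 'I_3 := match i.2 with
  | inl (inl _) => 1 | inl (inr _) => 0 | inr _ => 2%:R end.
have sT k X : sigma_array (k := k) X setT.
  exact: (@measurableT _ (g_sigma_algebraType (\bigcup_i \bigcup_j sigma_RV (X i j)))).
have sI k X B C : sigma_array (k := k) X B -> sigma_array X C -> sigma_array X (B `&` C).
  exact: (@measurableI _ (g_sigma_algebraType (\bigcup_i \bigcup_j sigma_RV (X i j)))).
apply: (@mutually_independent_group _ _ _ _ kind _ _ _ _ ind) => [k J A uJ kJ FA|i|k|k].
- have [k0|[k1|k2]] : k = 0 \/ k = 1 \/ k = 2%:R.
    case: k {kJ} => -[|[|[|//]]] h; [left|right; left|right; right]; exact/val_inj.
  + refine (mutually_independent_image (f := fun ij : nat * 'I_p => (ij.1, inl (inr ij.2)))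
      (F := fun i => sigma_RV (model_var delta psi eps i)) idelta _ uJ FA).
    move=> [n [[a|a]|b]] /kJ; rewrite /kind/= k0 //.
    by move=> _; exists (n, a).
  + refine (mutually_independent_image (f := fun ij : nat * 'I_p => (ij.1, inl (inl ij.2)))
      (F := fun i => sigma_RV (model_var delta psi eps i)) ipsi _ uJ FA).
    move=> [n [[a|a]|b]] /kJ; rewrite /kind/= k1 //.
    by move=> _; exists (n, a).
  + refine (mutually_independent_image (f := fun ij : nat * 'I_q => (ij.1, inr ij.2))
      (F := fun i => sigma_RV (model_var delta psi eps i)) ieps _ uJ FA).
    move=> [n [[a|a]|b]] /kJ; rewrite /kind/= k2 //.
    by move=> _; exists (n, b).
- case: i => n [[a|a]|b]; exact: sub_sigma_array.
- by case: k => -[|[|[|//]]] h /=; exact: sT.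
- by case: k => -[|[|[|//]]] h /= B C; exact: sI.
Qed.

End Grouping.

Section Moments.
Context {d} {T : measurableType d} {R : realType} (P : probability T R).

Lemma integ_ge0 (X : T -> R) (c : R) : measurable_fun setT X -> (forall w, 0 <= X w) ->
  'E_P[X]%E = c%:E -> integ P X /\ Ex P X = c.
Proof.
move=> mX X0 e; split; last by rewrite Ex_expectation e.
apply/integrableP; split; first exact/measurable_EFinP.
rewrite (eq_integral (EFin \o X)) => [|w _]; last by rewrite /= ger0_norm.
by move: e; rewrite unlock => ->; rewrite ltry.
Qed.

(** The fourth power is nonnegative, so its finite expectation means integrability; |X|^k <= 1 + X^4
    then gives the lower powers. *)
Lemma has_moments_Ex (X : {RV P >-> R}) s g1 g2 : has_moments P X s g1 g2 ->
  forall k, (k <= 4)%N ->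
  integ P (fun w => X w ^+ k) /\ Ex P (fun w => X w ^+ k) =
  nth 0 [:: 1; 0; s ^+ 2; g1 * s ^+ 3; (g2 + 3) * s ^+ 4] k.
Proof.
move=> [e1 e2 e3 e4].
have mX : measurable_fun setT X by [].
have mk k : measurable_fun setT (fun w => X w ^+ k) by exact: measurable_funX.
have [|i4 E4] := integ_ge0 (mk 4%N) _ e4; first by move=> w; rewrite exprn_even_ge0.
have ik k : (k <= 4)%N -> integ P (fun w => X w ^+ k).
  move=> k4; apply: (integ_le (mk k) (integD (integ_cst P 1) i4)) => w /=.
  rewrite normrX -[X w ^+ 4]ger0_norm ?exprn_even_ge0// normrX.
  case: (leP `|X w| 1) => h.
    by have h1 : `|X w| ^+ k <= 1 by [rewrite exprn_ile1]; rewrite (le_trans h1)// lerDl exprn_ge0.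
  by rewrite (le_trans (ler_weXn2l (ltW h) k4))// lerDr.
move=> k k4; split; first exact: ik.
case: k k4 => [|[|[|[|[|//]]]]] _ /=.
- by under eq_fun do rewrite expr0; exact: Ex_cst.
- by under eq_fun do rewrite expr1; rewrite Ex_expectation e1.
- rewrite Ex_expectation.
  have : 'V_P[X]%E = 'E_P[(fun w => X w ^+ 2)%R]%E.
    rewrite /variance unlock e1/=; congr 'E_P[_]%E; apply/funext => w.
    by rewrite !fctE/= subr0 expr2.
  by rewrite e2 => <-.
- by rewrite Ex_expectation e3.
- exact: E4.
Qed.

Lemma Ex_same_distribution (X Y : {RV P >-> R}) (g : R -> R) :
  (forall A : set R, measurable A -> distribution P X A = distribution P Y A) ->
  measurable_fun setT g -> (forall x, 0 <= g x) ->
  Ex P (g \o X) = Ex P (g \o Y).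
Proof.
move=> XY mg g0; rewrite /Ex /Rintegral; congr fine.
rewrite -[LHS](@ge0_integral_distribution _ _ _ _ _ P X (EFin \o g)); last 2 first.
- exact/measurable_EFinP.
- by move=> x; rewrite lee_fin.
rewrite -[RHS](@ge0_integral_distribution _ _ _ _ _ P Y (EFin \o g)); last 2 first.
- exact/measurable_EFinP.
- by move=> x; rewrite lee_fin.
by apply: eq_measure_integral => A mA _; exact: XY.
Qed.

End Moments.

(** * Moments of monomials in the variables of one row *)

Section Monomials.
Context {d} {T : measurableType d} {R : realType} (P : probability T R)
  {V : finType} (y : nat * V -> {RV P >-> R}) (m : V -> nat -> R).
Hypothesis indy : mutually_independent P (fun i => sigma_RV (y i)).
Hypothesis ym : forall j v k, (k <= 4)%N ->
  integ P (fun w => y (j, v) w ^+ k) /\ Ex P (fun w => y (j, v) w ^+ k) = m v k.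
Notation of_row := (of_row y (fun i : nat * V => i.1)).

Definition monomial (k : V -> nat) j w := \prod_v y (j, v) w ^+ k v.

Lemma monomial_row k j : of_row j (monomial k j).
Proof.
rewrite /monomial; elim: (index_enum V) => [|v s IH].
  by rewrite (_ : (fun w : T => _) = cst 1); [exact: measurable_cst|apply/funext => w; rewrite big_nil].
rewrite (_ : (fun w : T => _) = fun w => y (j, v) w ^+ k v * \prod_(u <- s) y (j, u) w ^+ k u); last first.
  by apply/funext => w; rewrite big_cons.
apply: measurable_funM => //.
by apply: measurable_funX; exact: fun_of_var.
Qed.

(** The variables are multiplied in one by one, each independent of the product of those already
    taken; the induction therefore also carries measurability for the block of variables used. *)
Lemma monomial_Ex k j : (forall v, (k v <= 4)%N) ->
  integ P (monomial k j) /\ Ex P (monomial k j) = \prod_v m v (k v).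
Proof.
move=> k4; pose X s w := \prod_(v <- s) y (j, v) w ^+ k v.
suff : fun_of y (fun i => i.2 \in index_enum V) (X (index_enum V)) /\
  (integ P (X (index_enum V)) /\ Ex P (X (index_enum V)) =
   \prod_(v <- index_enum V) m v (k v)) by case.
elim: (index_enum V) (index_enum_uniq V) => [_|v s IH /= /andP[vs us]].
  have -> : X [::] = cst 1 by apply/funext => w; rewrite /X big_nil.
  rewrite big_nil Ex_cst; split; last by split => //; exact: integ_cst.
  exact: measurable_cst.
have [fX [iX eX]] := IH us; have [iv ev] := ym j v (k4 v).
have fv : fun_of y (fun i => i == (j, v)) (fun w => y (j, v) w ^+ k v).
  by apply: measurable_funX; apply: fun_of_var; rewrite eqxx.
have -> : X (v :: s) = fun w => y (j, v) w ^+ k v * X s w.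
  by apply/funext => w; rewrite /X big_cons.
have [|i e] := fun_of_Ex indy _ fv fX iv iX.
  by move=> [a b] /eqP[_ ->] /=; apply/negP.
split; last by split => //; rewrite e ev eX big_cons.
apply: measurable_funM.
  by apply: measurable_funX; apply: fun_of_var; rewrite /= mem_head.
by apply: fun_of_sub fX => u us'; rewrite inE us' orbT.
Qed.

(** A centred monomial. In use the scale [s] is 0 or 1: it switches a feature off without changing
    the index set. *)
Definition monomial0 (s : R) k j w := s * (monomial k j w - \prod_v m v (k v)).

Lemma monomialD k l j w : monomial k j w * monomial l j w = monomial (fun v => k v + l v)%N j w.
Proof. by rewrite /monomial -big_split/=; apply: eq_bigr => v _; rewrite exprD. Qed.

Lemma monomial0_row s k j : of_row j (monomial0 s k j).
Proof.
apply: measurable_funM; first exact: measurable_cst.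
by apply: measurable_funB; [exact: monomial_row|exact: measurable_cst].
Qed.

Lemma monomial0_Ex s k j : (forall v, (k v <= 4)%N) -> Ex P (monomial0 s k j) = 0.
Proof.
move=> k4; have [i e] := monomial_Ex j k4.
have ic := integ_cst P (\prod_v m v (k v)).
by rewrite /monomial0 ExZ; [rewrite ExB// e Ex_cst subrr mulr0|exact: integB].
Qed.

Lemma monomial0_mul s k s' k' j : (forall v, (k v + k' v <= 4)%N) ->
  integ P (fun w => monomial0 s k j w * monomial0 s' k' j w) /\
  Ex P (fun w => monomial0 s k j w * monomial0 s' k' j w) =
  s * s' * (\prod_v m v (k v + k' v)%N - (\prod_v m v (k v)) * \prod_v m v (k' v)).
Proof.
move=> k4; have [i e] := monomial_Ex j k4.
have [|i1 e1] := @monomial_Ex k j.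
  by move=> v; rewrite (leq_trans _ (k4 v))// leq_addr.
have [|i2 e2] := @monomial_Ex k' j.
  by move=> v; rewrite (leq_trans _ (k4 v))// leq_addl.
set c := \prod_v m v (k v) in e1 *; set c' := \prod_v m v (k' v) in e2 *.
have -> : (fun w => monomial0 s k j w * monomial0 s' k' j w) = fun w => s * s' *
    (monomial (fun v => k v + k' v)%N j w - c' * monomial k j w - c * monomial k' j w + c * c').
  by apply/funext => w; rewrite -monomialD /monomial0 -/c -/c'; ring.
have iZ1 := integZ c' i1; have iZ2 := integZ c i2; have ic := integ_cst P (c * c').
have iB := integB (integB i iZ1) iZ2.
have iD := integD iB ic.
split; first exact: integZ.
rewrite (ExZ _ iD) (ExD iB ic) (ExB (integB i iZ1) iZ2).
rewrite (ExB i iZ1) (ExZ c' i1) (ExZ c i2) e1 e2 e Ex_cst; congr (_ * _); ring.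
Qed.

End Monomials.

(** * Two sufficient conditions for Lindeberg's condition *)

Section LindebergCriteria.
Context {d} {T : measurableType d} {R : realType} (P : probability T R).

Lemma cub_scale_le (n : nat) (x : R) :
  n%:R * cub ((Num.sqrt n%:R)^-1 * x) <= (Num.sqrt n%:R)^-1 * `|x| ^+ 3.
Proof.
case: n => [|n]; first by rewrite mul0r mulr_ge0 ?invr_ge0 ?exprn_ge0.
set s := Num.sqrt _; have s0 : 0 < s by rewrite sqrtr_gt0.
have -> : n.+1%:R = s ^+ 2 :> R by rewrite sqr_sqrtr.
apply: (@le_trans _ _ (s ^+ 2 * `|s^-1 * x| ^+ 3)).
  by rewrite ler_wpM2l ?sqr_ge0// /cub ge_min lexx orbT.
rewrite normrM exprMn (@ger0_norm _ s^-1) ?invr_ge0 ?(ltW s0)// le_eqVlt.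
by apply/orP; left; apply/eqP; field; rewrite gt_eqF.
Qed.

Lemma cub_scale_le_sqr (n : nat) (x : R) : n%:R * cub ((Num.sqrt n%:R)^-1 * x) <= x ^+ 2.
Proof.
case: n => [|n]; first by rewrite mul0r sqr_ge0.
apply: (@le_trans _ _ (n.+1%:R * ((Num.sqrt n.+1%:R)^-1 * x) ^+ 2)).
  by rewrite ler_wpM2l// cub_le_sqr.
by rewrite exprMn exprVn sqr_sqrtr// mulrA divff ?mul1r// pnatr_eq0.
Qed.

Lemma cvg_invsqrtn : (Num.sqrt n%:R)^-1 @[n --> \oo] --> (0 : R).
Proof.
apply/cvgrPdist_le => e e0; near=> n.
have n0 : 0 < n%:R :> R by rewrite ltr0n; near: n; exact: nbhs_infty_gt.
have hn : e ^- 2 <= n%:R by near: n; exact: nbhs_infty_ger.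
rewrite sub0r normrN ger0_norm ?invr_ge0// -[leRHS]invrK lef_pV2 ?posrE ?sqrtr_gt0 ?invr_gt0//.
by rewrite -[leLHS]ger0_norm ?invr_ge0 ?(ltW e0)// -sqrtr_sqr ler_wsqrtr// exprVn.
Unshelve. all: by end_near. Qed.

(** |z|^3 <= z^2 + z^4, so the Lindeberg quantity is at most C / sqrt n, uniformly over rows of
    possibly different laws. *)
Lemma lindeberg_fourth_moment (z : nat -> T -> R) (C : R) :
  (forall j, measurable_fun setT (z j)) -> (forall j, integ P (fun w => z j w ^+ 2)) ->
  (forall j, integ P (fun w => z j w ^+ 4)) ->
  (forall j, Ex P (fun w => z j w ^+ 2) + Ex P (fun w => z j w ^+ 4) <= C) ->
  lindeberg P z.
Proof.
move=> mz i2 i4 zC e e0.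
have C0 : 0 <= C.
  apply: le_trans (zC 0%N); apply: addr_ge0; apply: Ex_ge0 => w.
    exact: sqr_ge0.
  by rewrite exprn_even_ge0.
have /cvgrPdist_le/(_ e e0) hs : (Num.sqrt n%:R)^-1 * C @[n --> \oo] --> (0 : R).
  rewrite -[0](mul0r C); apply: cvgM; [exact: cvg_invsqrtn|exact: cvg_cst].
near=> n => j.
have : `|0 - (Num.sqrt n%:R)^-1 * C| <= e by near: n.
rewrite sub0r normrN ger0_norm ?mulr_ge0 ?invr_ge0//; apply: le_trans.
set s := (Num.sqrt n%:R)^-1; have s0 : 0 <= s by rewrite invr_ge0.
have ic := integ_cub s (mz j) (i2 j).
rewrite -ExZ//; apply: (@le_trans _ _ (Ex P (fun w => s * (z j w ^+ 2 + z j w ^+ 4)))).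
  apply: Ex_le; [exact: integZ|by apply: integZ; exact: integD|move=> w].
  apply: le_trans (cub_scale_le n (z j w)) _; apply: ler_wpM2l => //.
  have := sqr_ge0 (`|z j w| ^+ 2 - `|z j w|); have := sqr_ge0 (z j w).
  have -> : z j w ^+ 4 = `|z j w| ^+ 4 by rewrite -normrX ger0_norm// exprn_even_ge0.
  rewrite -(real_normK (num_real (z j w))); have := exprn_ge0 4 (normr_ge0 (z j w)).
  by have := sqr_ge0 (`|z j w|); nra.
have iD := integD (i2 j) (i4 j).
by rewrite ExZ// ler_wpM2l// ExD.
Unshelve. all: by end_near. Qed.

(** Dominated convergence for row 0 with dominating function z^2; equality of the [cub] expectations
    transfers it to all rows. Only a second moment of [z] is needed, which suits squares of
    variables with four moments. *)
Lemma lindeberg_same_law (z : nat -> T -> R) :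
  measurable_fun setT (z 0%N) -> integ P (fun w => z 0%N w ^+ 2) ->
  (forall j (c : R), Ex P (fun w => cub (c * z j w)) = Ex P (fun w => cub (c * z 0%N w))) ->
  lindeberg P z.
Proof.
move=> mz iz hz e e0.
have ic n := integ_cub (Num.sqrt n%:R)^-1 mz iz.
have : Ex P (fun w => n%:R * cub ((Num.sqrt n%:R)^-1 * z 0%N w)) @[n --> \oo] --> Ex P (fun=> 0).
  apply: (dominated_Ex (Y := fun w => z 0%N w ^+ 2)) => //.
  - by move=> n; apply: integ_measurable; exact: integZ.
  - move=> w; apply: (squeeze_cvgr _ (cvg_cst 0) (h := fun n => (Num.sqrt n%:R)^-1 * `|z 0%N w| ^+ 3)).
      by apply: nearW => n; rewrite mulr_ge0 ?cub_ge0//= cub_scale_le.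
    rewrite -[0](mul0r (`|z 0%N w| ^+ 3)); apply: cvgM; [exact: cvg_invsqrtn|exact: cvg_cst].
  - by move=> n w; rewrite ger0_norm ?mulr_ge0 ?cub_ge0// cub_scale_le_sqr.
rewrite Ex_cst => /cvgrPdist_le/(_ e e0) h; near=> n => j.
rewrite hz -ExZ//.
have : `|0 - Ex P (fun w => n%:R * cub ((Num.sqrt n%:R)^-1 * z 0%N w))| <= e by near: n.
by rewrite sub0r normrN; apply: le_trans; exact: ler_norm.
Unshelve. all: by end_near. Qed.

End LindebergCriteria.

(** * The features of a row: its variables and their pairwise products, centred *)

Section Features.
Context {d} {T : measurableType d} {R : realType} (P : probability T R)
  {V : finType} (y : nat * V -> {RV P >-> R}) (m : V -> nat -> R) (good : pred V).
Hypothesis indy : mutually_independent P (fun i => sigma_RV (y i)).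
Hypothesis ym : forall j v k, (k <= 4)%N ->
  integ P (fun w => y (j, v) w ^+ k) /\ Ex P (fun w => y (j, v) w ^+ k) = m v k.
Hypothesis m1 : forall v, m v 1 = 0.
Hypothesis y_good : forall v, good v -> forall j (A : set R), measurable A ->
  distribution P (y (j, v)) A = distribution P (y (0%N, v)) A.
Notation row := (fun i : nat * V => i.1).

Notation feature := (V + V * V)%type.

Definition expo (f : feature) (u : V) : nat :=
  match f with inl v => (u == v) | inr (v, w) => (u == v) + (u == w) end.

(* The squares of variables that are not identically distributed are dropped:
   they do not satisfy a Lindeberg condition. *)
Definition scal (f : feature) : R :=
  match f with inl _ => 1 | inr (v, w) => ((v != w) || good v)%:R end.

Definition phi j (f : feature) : T -> R := monomial0 y m (scal f) (expo f) j.

Definition Gam (f g : feature) : R := scal f * scal g *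
  (\prod_v m v (expo f v + expo g v)%N - (\prod_v m v (expo f v)) * \prod_v m v (expo g v)).

Lemma m0 v : m v 0 = 1.
Proof. by have [_ <-] := ym 0 v (leq0n 4); under eq_fun do rewrite expr0; rewrite Ex_cst. Qed.

Lemma expo_le2 f v : (expo f v <= 2)%N.
Proof. by case: f => [u|[u1 u2]] /=; do ?case: (_ == _). Qed.

Lemma phi_row j f : of_row y row j (phi j f).
Proof. exact: monomial0_row. Qed.

Lemma phi_sqr j f : integ P (fun w => phi j f w ^+ 2).
Proof.
under eq_fun do rewrite expr2.
have [|//] := @monomial0_mul _ _ _ _ _ y m indy ym (scal f) (expo f) (scal f) (expo f) j.
by move=> v; rewrite (leq_add (expo_le2 f v) (expo_le2 f v)).
Qed.

Lemma phi0 j f : Ex P (phi j f) = 0.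
Proof.
by apply: (monomial0_Ex (m := m)) => // v; rewrite (leq_trans (expo_le2 f v)).
Qed.

Lemma phiG j f g : Ex P (fun w => phi j f w * phi j g w) = Gam f g.
Proof.
have [|//] := @monomial0_mul _ _ _ _ _ y m indy ym (scal f) (expo f) (scal g) (expo g) j.
by move=> v; rewrite (leq_add (expo_le2 f v) (expo_le2 g v)).
Qed.

Lemma phi_var j v w : phi j (inl v) w = y (j, v) w.
Proof.
rewrite /phi /monomial0 /monomial /= mul1r (bigD1 v)//= eqxx expr1 big1; last first.
  by move=> u /negPf->; rewrite expr0.
by rewrite (bigD1 v)//= eqxx m1 mul0r subr0 mulr1.
Qed.

Lemma phi_mul j u v w : (u != v) || good u ->
  phi j (inr (u, v)) w = y (j, u) w * y (j, v) w - (u == v)%:R * m u 2.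
Proof.
move=> uv; rewrite /phi /monomial0 /monomial /= uv mul1r.
congr (_ - _).
  under eq_bigr do rewrite exprD.
  rewrite big_split/=; congr (_ * _).
    by rewrite (bigD1 u)//= eqxx expr1 big1 ?mulr1// => a /negPf->; rewrite expr0.
  by rewrite (bigD1 v)//= eqxx expr1 big1 ?mulr1// => a /negPf->; rewrite expr0.
have [<-|/negPf nuv] := eqVneq u v.
  rewrite mul1r (bigD1 u)//= eqxx big1 ?mulr1// => a /negPf->.
  exact: m0.
by rewrite mul0r (bigD1 u)//= eqxx nuv m1 mul0r.
Qed.

Let mphi (j : nat) (f : feature) : measurable_fun setT (phi j f).
Proof. exact (fun_of_measurable (@phi_row j f)). Qed.

(** Single variables and products of two distinct ones have fourth moments that do not depend on the
    row. A retained square is handled by the common law of its variable, and a dropped one is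
    identically 0. *)
Lemma phi_lind f : lindeberg P (fun j => phi j f).
Proof.
case: f => [v|[u v]].
  apply: (lindeberg_fourth_moment (C := m v 2 + m v 4)) => [//|j|j|j].
  - exact: phi_sqr.
  - by under eq_fun do rewrite phi_var; have [] := @ym j v 4 isT.
  - under eq_fun do rewrite phi_var; under [X in _ + Ex P X <= _]eq_fun do rewrite phi_var.
    by have [_ ->] := @ym j v 2 isT; have [_ ->] := @ym j v 4 isT.
have [uv|uv] := eqVneq u v; last first.
  have E j : phi j (inr (u, v)) = fun w => y (j, u) w * y (j, v) w.
    apply/funext => w; rewrite phi_mul ?uv//= (negPf uv) mul0r subr0 //.
  have mono k j : (fun w => phi j (inr (u, v)) w ^+ k) =
      monomial y (fun a => (a == u) * k + (a == v) * k)%N j.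
    apply/funext => w; rewrite E exprMn /monomial.
    under eq_bigr do rewrite exprD.
    rewrite big_split/=; congr (_ * _).
      by rewrite (bigD1 u)//= eqxx mul1n big1 ?mulr1// => a /negPf->; rewrite mul0n expr0.
    by rewrite (bigD1 v)//= eqxx mul1n big1 ?mulr1// => a /negPf->; rewrite mul0n expr0.
  have le4 k a : (k <= 4)%N -> ((a == u) * k + (a == v) * k <= 4)%N.
    have [->|_] := eqVneq a u; last by rewrite mul0n add0n; case: (_ == _); rewrite ?mul1n ?mul0n.
    by rewrite (negPf uv) mul1n mul0n addn0.
  pose M k := \prod_a m a ((a == u) * k + (a == v) * k)%N.
  have hM k j : (k <= 4)%N -> integ P (fun w => phi j (inr (u, v)) w ^+ k) /\
      Ex P (fun w => phi j (inr (u, v)) w ^+ k) = M k.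
    by move=> k4; rewrite mono; apply: monomial_Ex => // a; exact: le4.
  apply: (lindeberg_fourth_moment (C := M 2 + M 4)) => [//|j|j|j].
  - exact: phi_sqr.
  - by have [] := @hM 4 j isT.
  - by have [_ ->] := @hM 2 j isT; have [_ ->] := @hM 4 j isT.
rewrite -uv {v uv}; have [gu|/negPf gu] := boolP (good u); last first.
  rewrite (_ : (fun j => phi j _) = fun _ _ => 0); first exact: lindeberg0.
  by apply/funext => j; apply/funext => w; rewrite /phi /monomial0/= eqxx gu mul0r.
apply: lindeberg_same_law => [//||j c]; first exact: phi_sqr.
have E j' : (fun w => cub (c * phi j' (inr (u, u)) w)) =
    (fun x => cub (c * (x ^+ 2 - m u 2))) \o y (j', u).
  by apply/funext => w /=; rewrite phi_mul ?gu ?orbT// eqxx mul1r expr2.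
rewrite !E; apply: Ex_same_distribution => [||x]; last exact: cub_ge0.
  exact: y_good.
apply: (measurableT_comp (f := cub)); first exact: measurable_cub.
by apply: measurable_funM => //; apply: measurable_funB.
Qed.

End Features.

(** * Limits in probability of random matrices *)

Section MatrixLimits.
Context {R : realType} {X : Type} (F : set_system X) {FF : Filter F}.

(** The filter is arbitrary so that the same calculus serves deterministic limits along [\oo] and
    limits in probability along [whp]. *)
Definition mcvg a b (f : X -> 'M[R]_(a, b)) (l : 'M[R]_(a, b)) :=
  forall i j, f x i j @[x --> F] --> l i j.

Lemma cvg_sum_fin (I : Type) (s : seq I) (f : I -> X -> R) (l : I -> R) :
  (forall i, f i x @[x --> F] --> l i) ->
  \sum_(i <- s) f i x @[x --> F] --> \sum_(i <- s) l i.
Proof.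
move=> fl; apply: (@cvg_big _ _ +%R) => //; exact: add_continuous.
Qed.

Lemma cvg_prod_fin (I : Type) (s : seq I) (f : I -> X -> R) (l : I -> R) :
  (forall i, f i x @[x --> F] --> l i) ->
  \prod_(i <- s) f i x @[x --> F] --> \prod_(i <- s) l i.
Proof.
move=> fl; elim: s => [|i s IH].
  by under eq_fun do rewrite big_nil; rewrite big_nil; exact: cvg_cst.
by under eq_fun do rewrite big_cons; rewrite big_cons; exact: cvgM.
Qed.

Lemma mcvg_cst a b (l : 'M[R]_(a, b)) : mcvg (fun=> l) l.
Proof. by move=> i j; exact: cvg_cst. Qed.

Lemma mcvgD a b (f g : X -> 'M[R]_(a, b)) l k :
  mcvg f l -> mcvg g k -> mcvg (fun x => f x + g x) (l + k).
Proof. by move=> fl gk i j; under eq_fun do rewrite mxE; rewrite mxE; exact: cvgD. Qed.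

Lemma mcvgN a b (f : X -> 'M[R]_(a, b)) l : mcvg f l -> mcvg (fun x => - f x) (- l).
Proof. by move=> fl i j; under eq_fun do rewrite mxE; rewrite mxE; exact: cvgN. Qed.

Lemma mcvgB a b (f g : X -> 'M[R]_(a, b)) l k :
  mcvg f l -> mcvg g k -> mcvg (fun x => f x - g x) (l - k).
Proof. by move=> fl gk; apply: mcvgD => //; exact: mcvgN. Qed.

Lemma mcvg_mul a b c (f : X -> 'M[R]_(a, b)) (g : X -> 'M[R]_(b, c)) l k :
  mcvg f l -> mcvg g k -> mcvg (fun x => f x *m g x) (l *m k).
Proof.
move=> fl gk i j; under eq_fun do rewrite mxE; rewrite mxE.
by apply: cvg_sum_fin => u; exact: cvgM.
Qed.

Lemma mcvgZ a b (k : X -> R) (c : R) (f : X -> 'M[R]_(a, b)) l :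
  k @ F --> c -> mcvg f l -> mcvg (fun x => k x *: f x) (c *: l).
Proof. by move=> kc fl i j; under eq_fun do rewrite mxE; rewrite mxE; exact: cvgM. Qed.

Lemma mcvg_tr a b (f : X -> 'M[R]_(a, b)) l : mcvg f l -> mcvg (fun x => (f x)^T) l^T.
Proof. by move=> fl i j; under eq_fun do rewrite mxE; rewrite mxE; exact: fl. Qed.

Lemma mcvg_near a b (f g : X -> 'M[R]_(a, b)) l : mcvg f l ->
  (\forall x \near F, f x = g x) -> mcvg g l.
Proof.
move=> fl fg i j; apply: near_cvg (fl i j) _.
by apply: filterS fg => x ->.
Qed.

Lemma cvg_det n (f : X -> 'M[R]_n) l : mcvg f l -> \det (f x) @[x --> F] --> \det l.
Proof.
move=> fl; rewrite /determinant; apply: cvg_sum_fin => s.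
by apply: cvgM; [exact: cvg_cst|apply: cvg_prod_fin => i; exact: fl].
Qed.

Lemma mcvg_unit n (f : X -> 'M[R]_n) l : mcvg f l -> l \in unitmx ->
  \forall x \near F, f x \in unitmx.
Proof.
move=> /cvg_det fl; rewrite unitmxE unitfE => l0.
have /cvgrPdist_lt/(_ `|\det l|) := fl; rewrite normr_gt0 => /(_ l0).
apply: filterS => x; rewrite unitmxE unitfE.
by apply: contraTN => /eqP->; rewrite subr0 ltxx.
Qed.

Lemma mcvg_adj n (f : X -> 'M[R]_n) l : mcvg f l -> mcvg (fun x => \adj (f x)) (\adj l).
Proof.
move=> fl i j; under eq_fun do rewrite mxE; rewrite mxE /cofactor.
apply: cvgM; first exact: cvg_cst.
by apply: cvg_det => u v; under eq_fun do rewrite !mxE; rewrite !mxE; exact: fl.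
Qed.

(** Near an invertible limit the inverse is the adjugate over the determinant, continuous in the
    entries. [invmx] returns its argument on a singular matrix, so the formula is used only
    eventually. *)
Lemma mcvg_inv n (f : X -> 'M[R]_n) l : mcvg f l -> l \in unitmx ->
  mcvg (fun x => invmx (f x)) (invmx l).
Proof.
move=> fl lu; have fu := mcvg_unit fl lu.
apply: (@mcvg_near _ _ (fun x => (\det (f x))^-1 *: \adj (f x))).
  rewrite /invmx lu; apply: mcvgZ; last exact: mcvg_adj.
  by apply: cvgV; [move: lu; rewrite unitmxE unitfE|exact: cvg_det].
by apply: filterS fu => x ux; rewrite /invmx ux.
Qed.

Lemma mcvg_gain p r (f : X -> 'M[R]_p) l (A : 'M[R]_(r, p)) : mcvg f l ->
  A *m l *m A^T \in unitmx -> mcvg (fun x => gain (f x) A) (gain l A).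
Proof.
move=> fl u; apply: mcvg_mul; first by apply: mcvg_mul => //; exact: mcvg_cst.
apply: mcvg_inv => //; apply: mcvg_mul; last exact: mcvg_cst.
by apply: mcvg_mul => //; exact: mcvg_cst.
Qed.

End MatrixLimits.

Section RandomMatrices.
Context {d} {T : measurableType d} {R : realType}.

(** x^-1 is the pointwise limit of the continuous functions x / (x^2 + 1/(n+1)), also at 0, where
    both sides are 0. *)
Lemma measurable_invr : measurable_fun setT (fun x : R => x^-1).
Proof.
pose h n (x : R) : R := x / (x ^+ 2 + n.+1%:R^-1).
have mh n : measurable_fun setT (h n).
  apply: continuous_measurable_fun => x; apply: cvgM => //; apply: cvgV.
    by rewrite gt_eqF// ltr_wpDl// sqr_ge0.
  apply: cvgD; last exact: cvg_cst.
  exact: exprn_continuous.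
apply: (measurable_fun_cvg mh) => x _; rewrite /h.
have [->|x0] := eqVneq x 0.
  by under eq_fun do rewrite mul0r; rewrite invr0; exact: cvg_cst.
have -> : x^-1 = x / (x ^+ 2 + 0) by rewrite addr0; field.
apply: cvgM; first exact: cvg_cst.
apply: cvgV; first by rewrite addr0 expf_neq0.
by apply: cvgD; [exact: cvg_cst|exact: cvg_harmonic].
Qed.

Lemma random_cst a b (A : 'M[R]_(a, b)) : random_mx (fun _ : T => A).
Proof. by move=> i j; exact: measurable_cst. Qed.

Lemma randomD a b (Y Z : T -> 'M[R]_(a, b)) : random_mx Y -> random_mx Z ->
  random_mx (fun w => Y w + Z w).
Proof. by move=> mY mZ i j; under eq_fun do rewrite mxE; exact: measurable_funD. Qed.

Lemma randomN a b (Y : T -> 'M[R]_(a, b)) : random_mx Y -> random_mx (fun w => - Y w).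
Proof.
move=> mY i j; under eq_fun do rewrite mxE.
by apply: (measurableT_comp (f := @GRing.opp R)).
Qed.

Lemma randomB a b (Y Z : T -> 'M[R]_(a, b)) : random_mx Y -> random_mx Z ->
  random_mx (fun w => Y w - Z w).
Proof. by move=> mY mZ; apply: randomD => //; exact: randomN. Qed.

Lemma random_mul a b c (Y : T -> 'M[R]_(a, b)) (Z : T -> 'M[R]_(b, c)) :
  random_mx Y -> random_mx Z -> random_mx (fun w => Y w *m Z w).
Proof.
move=> mY mZ i j; under eq_fun do rewrite mxE.
by apply: measurable_sum => k; exact: measurable_funM.
Qed.

Lemma randomZ a b (k : R) (Y : T -> 'M[R]_(a, b)) : random_mx Y ->
  random_mx (fun w => k *: Y w).
Proof. by move=> mY i j; under eq_fun do rewrite mxE; exact: measurable_funM. Qed.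

Lemma random_tr a b (Y : T -> 'M[R]_(a, b)) : random_mx Y -> random_mx (fun w => (Y w)^T).
Proof. by move=> mY i j; under eq_fun do rewrite mxE; exact: mY. Qed.

Lemma random_det n (Y : T -> 'M[R]_n) : random_mx Y ->
  measurable_fun setT (fun w => \det (Y w)).
Proof.
move=> mY; rewrite /determinant; apply: measurable_sum => s.
by apply: measurable_funM => //; apply: measurable_prod => i _; exact: mY.
Qed.

Lemma random_inv n (Y : T -> 'M[R]_n) : random_mx Y -> random_mx (fun w => invmx (Y w)).
Proof.
move=> mY i j.
(* The first branch is the convention that [invmx] fixes singular matrices. *)
have -> : (fun w => invmx (Y w) i j) =
    fun w => if \det (Y w) == 0 then Y w i j else (\det (Y w))^-1 * cofactor (Y w) j i.
  apply/funext => w; rewrite /invmx unitmxE unitfE.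
  by case: eqVneq => // _; rewrite !mxE.
apply: measurable_fun_ifT => //.
  by apply: measurable_fun_eqr => //; exact: random_det.
apply: measurable_funM.
  by apply: (measurableT_comp measurable_invr); exact: random_det.
apply: measurable_funM => //; apply: random_det => u v.
by under eq_fun do rewrite !mxE; exact: mY.
Qed.

Lemma random_col a b c (Y : T -> 'M[R]_(a, c)) (Z : T -> 'M[R]_(b, c)) :
  random_mx Y -> random_mx Z -> random_mx (fun w => col_mx (Y w) (Z w)).
Proof.
move=> mY mZ i j; under eq_fun do rewrite mxE.
by case: (fintype.split i) => k; [exact: mY|exact: mZ].
Qed.

End RandomMatrices.

(** * Convergence and boundedness in probability as a filter *)

Section HighProbability.
Context {d} {T : measurableType d} {R : realType} (P : probability T R).

(** The failure of [Q] is enclosed in a measurable set [N], so [Q] itself need not be measurable. *)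
Definition wp (e : R) (Q : set (nat * T)) := \forall n \near \oo,
  exists N : set T, [/\ measurable N, (P N <= e%:E)%E & forall w, ~ N w -> Q (n, w)].

(* Convergence in probability is convergence along this filter. *)
Definition whp : set_system (nat * T) := [set Q | forall e, 0 < e -> wp e Q].

Lemma wpS e Q Q' : Q `<=` Q' -> wp e Q -> wp e Q'.
Proof.
move=> QQ'; rewrite /wp => h; apply: filterS h => n [N [mN PN NQ]]; exists N; split => // w /NQ.
exact: QQ'.
Qed.

Lemma wp_near e Q (G : set nat) : (forall n N, measurable N -> (P N <= e%:E)%E ->
    (forall w, ~ N w -> Q (n, w)) -> G n) -> wp e Q -> \forall n \near \oo, G n.
Proof. by move=> h; rewrite /wp => hQ; apply: filterS hQ => n [N [mN PN NQ]]; exact: h mN PN NQ. Qed.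

Lemma wpI e e' Q Q' : wp e Q -> wp e' Q' -> wp (e + e') (Q `&` Q').
Proof.
rewrite /wp => h h'; apply: filterS2 h h' => n [N [mN PN NQ]] [N' [mN' PN' NQ']].
exists (N `|` N'); split; first exact: measurableU.
  by rewrite EFinD (le_trans (measureU2 P mN mN'))// leeD.
by move=> w /not_orP[/NQ ? /NQ' ?].
Qed.

Lemma wpT e Q : 0 <= e -> (\forall n \near \oo, forall w, Q (n, w)) -> wp e Q.
Proof.
move=> e0; apply: filterS => n h; exists set0; split => //.
by rewrite measure0 lee_fin.
Qed.

Global Instance whp_filter : Filter whp.
Proof.
split => [e e0|Q Q' hQ hQ' e e0|Q Q' QQ' hQ e e0].
- by apply: wpT; [exact: ltW|exact: nearW].
- by rewrite (splitr e); apply: wpI; [apply: hQ|apply: hQ']; rewrite divr_gt0.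
- exact: wpS (hQ e e0).
Qed.

Lemma whp_fst : fst @ whp --> (\oo : set_system nat).
Proof.
by move=> A hA e e0; apply: wpT; [exact: ltW|apply: filterS hA => n An w].
Qed.

Lemma whp_near (Q : set nat) : (\forall n \near \oo, Q n) -> \forall x \near whp, Q x.1.
Proof. by move=> h; apply: whp_fst. Qed.

Lemma mcvg_whp a b (f : nat -> 'M[R]_(a, b)) l : mcvg \oo f l -> mcvg whp (fun x => f x.1) l.
Proof. by move=> fl i j; apply: cvg_comp (fl i j); exact: whp_fst. Qed.

(** Boundedness in probability, O_P(1). *)
Definition stoch_bounded (X : nat * T -> R) := forall e : R, 0 < e ->
  exists2 L : R, 0 < L & wp e [set x | `|X x| <= L].

(** o_P(1) times O_P(1) is o_P(1): [k] below e / L and [U] below [L] hold together up to two halves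
    of the allowed probability. *)
Lemma cvg_mul_bounded (k U : nat * T -> R) : k @ whp --> (0 : R) -> stoch_bounded U ->
  k x * U x @[x --> whp] --> (0 : R).
Proof.
move=> /cvgrPdist_le hk hU; apply/cvgrPdist_le => e e0 h h0.
have h2 : 0 < h / 2 by rewrite divr_gt0.
have [L L0 hL] := hU _ h2.
have eL : 0 < e / L by rewrite divr_gt0.
have hk' := hk _ eL _ h2.
rewrite (splitr h); apply: wpS (wpI hk' hL) => x /= [].
rewrite !sub0r !normrN normrM => a b.
by rewrite -(divfK (lt0r_neq0 L0) e) ler_pM.
Qed.

Lemma stoch_boundedD X Y : stoch_bounded X -> stoch_bounded Y ->
  stoch_bounded (fun x => X x + Y x).
Proof.
move=> hX hY e e0; have e2 : 0 < e / 2 by rewrite divr_gt0.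
have [L L0 hL] := hX _ e2; have [L' L'0 hL'] := hY _ e2.
exists (L + L'); first exact: addr_gt0.
rewrite (splitr e); apply: wpS (wpI hL hL') => x /= [a b].
by rewrite (le_trans (ler_normD _ _))// lerD.
Qed.

Lemma stoch_bounded_cvg X (l : R) : X @ whp --> l -> stoch_bounded X.
Proof.
move=> /cvgrPdist_le/(_ _ ltr01) h e e0; exists (`|l| + 1).
  by rewrite ltr_wpDl.
apply: wpS (h e e0) => x /= a; rewrite -[X x](subrK l) addrC.
by rewrite (le_trans (ler_normD _ _))// lerD2l distrC.
Qed.

Lemma stoch_boundedZ c X : stoch_bounded X -> stoch_bounded (fun x => c * X x).
Proof.
move=> hX e e0; have [L L0 hL] := hX e e0; exists ((`|c| + 1) * L).
  by rewrite mulr_gt0// ltr_wpDl.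
apply: wpS hL => x /= a; rewrite normrM ler_pM// lerDl//.
Qed.

Lemma stoch_bounded_sum I (s : seq I) (X : I -> nat * T -> R) :
  (forall i, stoch_bounded (X i)) -> stoch_bounded (fun x => \sum_(i <- s) X i x).
Proof.
move=> hX; elim: s => [|i s IH].
  under eq_fun do rewrite big_nil.
  by apply: (@stoch_bounded_cvg _ 0); exact: cvg_cst.
by under eq_fun do rewrite big_cons; exact: stoch_boundedD.
Qed.

Lemma mcvg_mul_bounded a b c (A : nat * T -> 'M[R]_(a, b)) (U : nat * T -> 'M[R]_(b, c)) :
  mcvg whp A 0 -> (forall i j, stoch_bounded (fun x => U x i j)) ->
  mcvg whp (fun x => A x *m U x) 0.
Proof.
move=> hA hU i j.
have h : \sum_k A x i k * U x k j @[x --> whp] --> \sum_(k < b) (0 : R).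
  apply: cvg_sum_fin => k; apply: cvg_mul_bounded => //.
  by have := hA i k; rewrite mxE.
rewrite big1// in h; rewrite mxE.
by rewrite (_ : (fun x => _) = fun x => \sum_k A x i k * U x k j)//; apply/funext => x; rewrite mxE.
Qed.

Lemma stoch_bounded_tight m (Y : nat -> T -> 'rV[R]_m) :
  (forall i, stoch_bounded (fun x => Y x.1 x.2 0 i)) -> tight P Y.
Proof.
move=> hY e e0.
suff [L L0 hL] : exists2 L : R, 0 < L & wp e [set x | forall i, i \in index_enum 'I_m -> `|Y x.1 x.2 0 i| <= L].
  exists L => //; apply: wp_near hL => n N mN PN NQ; exists N; split => // w /NQ h i.
  by apply: h; rewrite mem_index_enum.
elim: (index_enum 'I_m) e e0 => [|i s IH] e e0.
  by exists 1 => //; apply: wpT; [exact: ltW|exact: nearW].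
have e2 : 0 < e / 2 by rewrite divr_gt0.
have [L L0 hL] := IH _ e2; have [L' L'0 hL'] := hY i _ e2.
exists (L + L'); first exact: addr_gt0.
rewrite (splitr e); apply: wpS (wpI hL hL') => x /= [a b] k; rewrite inE => /orP[/eqP->|/a h].
  by rewrite (le_trans b)// lerDr ltW.
by rewrite (le_trans h)// lerDl ltW.
Qed.

Lemma slutsky_cos (X X' : nat -> T -> R) (a l : R) :
  (forall n, measurable_fun setT (X n)) -> (forall n, measurable_fun setT (X' n)) ->
  X x.1 x.2 - X' x.1 x.2 @[x --> whp] --> (0 : R) ->
  Ex P (fun w => cos (a + X' n w)) @[n --> \oo] --> l ->
  Ex P (fun w => cos (a + X n w)) @[n --> \oo] --> l.
Proof.
move=> mX mX' /cvgrPdist_le hXX' hl.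
have ic Y : measurable_fun setT Y -> integ P (fun w => cos (a + Y w)).
  move=> mY; apply: (integ_bounded P (C := 1)) => [|w]; last exact: cos_max.
  exact: measurable_cosD.
have h0 : Ex P (fun w => cos (a + X n w)) - Ex P (fun w => cos (a + X' n w))
    @[n --> \oo] --> (0 : R).
  apply/cvgrPdist_le => e e0; have e2 : 0 < e / 2 by rewrite divr_gt0.
  have e4 : 0 < e / 4 by rewrite divr_gt0.
  apply: wp_near (hXX' _ e2 _ e4) => n N mN PN hN.
  rewrite sub0r normrN -ExB; [|exact: ic|exact: ic].
  (* Off [N] the Lipschitz bound gives e / 2; on [N] two cosines differ by at most 2, and [N] has
     probability at most e / 4. *)
  apply: (@le_trans _ _ (Ex P (fun w => e / 2 + 2 * \1_N w))).
    apply: Ex_norm_le => [||w].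
    - by apply: integB; exact: ic.
    - by apply: integD; [exact: integ_cst|apply: integZ; exact: integ_indic].
    rewrite indicE; have [Nw|/negP Nw] := boolP (w \in N).
      rewrite mulr1 (le_trans (ler_normB _ _))//.
      have := cos_max (a + X n w); have := cos_max (a + X' n w); lra.
    rewrite mulr0 addr0; apply: (le_trans (cos_lipschitz _ _)).
    rewrite opprD addrACA subrr add0r.
    have /hN/= : ~ N w by move=> h; apply: Nw; rewrite inE.
    by rewrite sub0r normrN.
  rewrite ExD; [|exact: integ_cst|by apply: integZ; exact: integ_indic].
  rewrite Ex_cst ExZ ?Ex_indic//; last exact: integ_indic.
  have : fine (P N) <= e / 4.
    by rewrite -lee_fin fineK// fin_num_measure.
  lra.
have := cvgD h0 hl; rewrite add0r => /(_ _) h; apply: near_cvg h _.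
by apply: nearW => n; rewrite fctE subrK.
Qed.

End HighProbability.

(** * The errors-in-variables model *)

Lemma quad_sum {R : realType} {F : finType} (G : F -> F -> R) (K : finType)
    (t : K -> R) (c : K -> F -> R) :
  quad G (fun f => \sum_k t k * c k f) (fun f => \sum_k t k * c k f) =
  \sum_k \sum_l t k * t l * quad G (c k) (c l).
Proof.
rewrite /quad.
under eq_bigr => f _ do under eq_bigr => g _ do rewrite big_distrlr mulr_suml/=.
under eq_bigr => f _ do rewrite exchange_big/=.
rewrite exchange_big/=; apply: eq_bigr => k _.
under eq_bigr => f _ do under eq_bigr => g _ do rewrite mulr_suml.
under eq_bigr => f _ do rewrite exchange_big/=.
rewrite exchange_big/=; apply: eq_bigr => l _.
rewrite mulr_sumr; apply: eq_bigr => f _; rewrite mulr_sumr; apply: eq_bigr => g _.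
by ring.
Qed.

Section RowSums.
Context {R : realType}.

Definition rsum n (f : nat -> R) : R := (Num.sqrt n%:R)^-1 * \sum_(j < n) f j.

Lemma rsumD n f g : rsum n f + rsum n g = rsum n (fun j => f j + g j).
Proof. by rewrite /rsum big_split/= mulrDr. Qed.

Lemma rsumZ n c f : c * rsum n f = rsum n (fun j => c * f j).
Proof. by rewrite /rsum mulrCA mulr_sumr. Qed.

Lemma rsum_sum n (J : Type) (s : seq J) (f : J -> nat -> R) :
  \sum_(i <- s) rsum n (f i) = rsum n (fun j => \sum_(i <- s) f i j).
Proof. by rewrite /rsum -mulr_sumr exchange_big. Qed.

Lemma rsum_cst n (c : R) : rsum n (fun=> c) = Num.sqrt n%:R * c.
Proof.
rewrite /rsum sumr_const card_ord -[c *+ n]mulr_natl mulrA; congr (_ * c).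
case: n => [|n]; first by rewrite mulr0 sqrtr0.
by rewrite -{2}(sqr_sqrtr (ler0n R n.+1)) expr2 mulrA mulVf ?mul1r// gt_eqF// sqrtr_gt0.
Qed.

Lemma sqrt_mean n : Num.sqrt n%:R * n%:R^-1 = (Num.sqrt n%:R)^-1 :> R.
Proof.
case: n => [|n]; first by rewrite sqrtr0 mul0r invr0.
rewrite -{2}(sqr_sqrtr (ler0n R n.+1)); field.
by rewrite gt_eqF// sqrtr_gt0.
Qed.

Lemma eq_rsum n f g : (forall j, f j = g j) -> rsum n f = rsum n g.
Proof. by move=> fg; congr (_ * _); apply: eq_bigr => j _; exact: fg. Qed.

End RowSums.

Section Model.
Context {d} {T : measurableType d} {R : realType} (P : probability T R)
  (p q : nat) (B : nat -> 'M[R]_(p, q)) (Blim : 'M[R]_(p, q)) (M : nat -> 'I_p -> R)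
  (eps : nat -> 'I_q -> {RV P >-> R}) (delta psi : nat -> 'I_p -> {RV P >-> R})
  (seps g1eps g2eps sdelta g1delta g2delta spsi g1psi g2psi : R) (sigmaM : 'cV[R]_p).
Hypothesis ieps : independent_array eps.
Hypothesis heps : forall i j, has_moments P (eps i j) seps g1eps g2eps.
Hypothesis iiddelta : iid_array delta.
Hypothesis hdelta : forall i j, has_moments P (delta i j) sdelta g1delta g2delta.
Hypothesis iidpsi : iid_array psi.
Hypothesis hpsi : forall i j, has_moments P (psi i j) spsi g1psi g2psi.
Hypothesis ind3 : mutually_independent P (fun k : 'I_3 =>
    nth set0 [:: sigma_array delta; sigma_array psi; sigma_array eps] k).
Hypothesis cvg_row_M : forall a, M n a @[n --> \oo] --> sigmaM a 0.
Hypothesis cvg_B : mcvg \oo B Blim.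
Hypothesis Su : Sigma sigmaM spsi sdelta \in unitmx.

Local Notation V := (('I_p + 'I_p) + 'I_q)%type.
Local Notation y := (model_var delta psi eps).

Definition model_moments (v : V) : nat -> R := nth 0
  match v with
  | inl (inl _) => [:: 1; 0; spsi ^+ 2; g1psi * spsi ^+ 3; (g2psi + 3) * spsi ^+ 4]
  | inl (inr _) => [:: 1; 0; sdelta ^+ 2; g1delta * sdelta ^+ 3; (g2delta + 3) * sdelta ^+ 4]
  | inr _ => [:: 1; 0; seps ^+ 2; g1eps * seps ^+ 3; (g2eps + 3) * seps ^+ 4]
  end.
Local Notation mom := model_moments.

(** The entries of [psi] and [delta] are identically distributed; those of [eps] only share moments,
    so their squares are the excluded features. *)
Definition model_iid (v : V) : bool := if v is inl _ then true else false.
Local Notation iid := model_iid.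

Let indy : mutually_independent P (fun i : nat * V => sigma_RV (y i)).
Proof. exact (model_var_independent ieps iiddelta.1 iidpsi.1 ind3). Qed.

Let ym : forall j v k, (k <= 4)%N -> integ P (fun w => y (j, v) w ^+ k) /\
  Ex P (fun w => y (j, v) w ^+ k) = mom v k.
Proof.
move=> j [[a|a]|b] k k4.
- exact (has_moments_Ex (hpsi j a) k4).
- exact (has_moments_Ex (hdelta j a) k4).
- exact (has_moments_Ex (heps j b) k4).
Qed.

Let m1 (v : V) : mom v 1 = 0. Proof. by case: v => [[]|]. Qed.

Let yg : forall v, iid v -> forall j (A : set R), measurable A ->
  distribution P (y (j, v)) A = distribution P (y (0%N, v)) A.
Proof.
move=> [[a|a]|//] _ j A mA; [exact: iidpsi.2|exact: iiddelta.2].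
Qed.

Local Notation ph := (phi y mom iid).
Local Notation asy := (asymp P ph).
Local Notation G := (Gam mom iid).
Local Notation row := (fun i : nat * V => i.1).

Let hrow (j : nat) (f : V + V * V) : of_row y row j (ph j f).
Proof. exact: phi_row. Qed.
Let hsqr (j : nat) (f : V + V * V) : integ P (fun w => ph j f w ^+ 2).
Proof. exact (phi_sqr iid indy ym j f). Qed.
Let h0 (j : nat) (f : V + V * V) : Ex P (ph j f) = 0.
Proof. exact (phi0 iid indy ym j f). Qed.
Let hG (j : nat) (f g : V + V * V) : Ex P (fun w => ph j f w * ph j g w) = G f g.
Proof. exact (phiG iid indy ym j f g). Qed.
Let hlind (f : V + V * V) : lindeberg P (fun j => ph j f).
Proof. exact (@phi_lind _ _ _ _ _ _ _ _ indy ym m1 yg f). Qed.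

Definition asylin (Q : nat -> T -> R) := exists c, asy Q c.

Let asylinD Q Q' : asylin Q -> asylin Q' -> asylin (fun n w => Q n w + Q' n w).
Proof. by move=> [c h] [c' h']; eexists; exact: (asympD indy hrow hsqr h0 hG h h'). Qed.

Let asylinZ (k : nat -> R) (l : R) Q : k @ \oo --> l -> asylin Q ->
  asylin (fun n w => k n * Q n w).
Proof. by move=> kl [c h]; eexists; exact: (asympZ indy hrow hsqr h0 hG kl h). Qed.

Let asylin_sum (J : Type) (s : seq J) (Q : J -> nat -> T -> R) :
  (forall j, asylin (Q j)) -> asylin (fun n w => \sum_(j <- s) Q j n w).
Proof.
by move=> /choice[c h]; eexists; exact: (asymp_sum indy hrow hsqr h0 hG s h).
Qed.

Let asylin_weight (a : 'I_p) (v : V) : asylin (fun n w => rsum n (fun j => M j a * y (j, v) w)).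
Proof.
exists (fun g => sigmaM a 0 * (g == inl v)%:R).
have := asymp_weight indy hrow hsqr h0 hG (inl v) (cvg_row_M (a := a)).
rewrite (_ : (fun n w => _) = fun n w => rsum n (fun j => M j a * y (j, v) w))//.
apply/funext => n; apply/funext => w; rewrite /rsum; congr (_ * _).
by apply: eq_bigr => j _; rewrite (phi_var y iid m1).
Qed.

Let asylin_mul (u v : V) : (u != v) || iid u ->
  asylin (fun n w => rsum n (fun j => y (j, u) w * y (j, v) w - (u == v)%:R * mom u 2)).
Proof.
move=> uv; exists (fun g => 1 * (g == inr (u, v))%:R).
have c1 : (fun=> 1 : R) @ \oo --> (1 : R) by exact: cvg_cst.
have := asymp_weight indy hrow hsqr h0 hG (inr (u, v)) c1.
rewrite (_ : (fun n w => _) = fun n w => rsum n (fun j => y (j, u) w * y (j, v) w - (u == v)%:R * mom u 2))//.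
apply/funext => n; apply/funext => w; rewrite /rsum; congr (_ * _).
by apply: eq_bigr => j _; rewrite mul1r (phi_mul ym m1 _ _ uv).
Qed.

Definition Xent (j : nat) (a : 'I_p) w := M j a + psi j a w + delta j a w.

(** [Xent] is M + psi + delta, so the product splits into a weighted linear feature and two product
    features whose first factor is never an [eps]. Centering is nonzero only when [v] is the [psi]
    or the [delta] of the same column. *)
Let asylin_X (a : 'I_p) (v : V) : asylin (fun n w => rsum n (fun j => Xent j a w * y (j, v) w -
   ((inl (inl a) == v)%:R * spsi ^+ 2 + (inl (inr a) == v)%:R * sdelta ^+ 2))).
Proof.
have := asylinD (asylinD (asylin_weight a v) (@asylin_mul (inl (inl a)) v (orbT _)))
  (@asylin_mul (inl (inr a)) v (orbT _)).
rewrite (_ : (fun n w => _) = fun n w => rsum n (fun j => Xent j a w * y (j, v) w -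
   ((inl (inl a) == v)%:R * spsi ^+ 2 + (inl (inr a) == v)%:R * sdelta ^+ 2)))//.
apply/funext => n; apply/funext => w; rewrite !rsumD; apply: eq_rsum => j.
rewrite /Xent /model_moments/=; ring.
Qed.

Local Notation Mn n := (array_mx M n).
Definition Xmx n w : 'M[R]_(n, p) := Mn n + random_array_mx psi n w + random_array_mx delta n w.
Definition Hn n w := Hmx (Mn n) (Xmx n w) spsi sdelta.
Definition hn n w := hmx (Xmx n w) (random_array_mx delta n w) (random_array_mx eps n w) (B n) sdelta.
(** The transpose makes the row-stacking [vec (Un n w)] equal to the vector [u_n]. *)
Definition Un n w : 'M[R]_(p, q) :=
  ((hn n w)^T + (B n)^T *m KbarX (Mn n) spsi sdelta *m Hn n w)^T.

Lemma XmxE n w j a : Xmx n w j a = Xent j a w.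
Proof. by rewrite !mxE. Qed.

Lemma Hn_entry n w a b : Hn n w a b = rsum n (fun j => Xent j a w * Xent j b w -
  (M j a * M j b + (spsi ^+ 2 + sdelta ^+ 2) * (a == b)%:R)).
Proof.
have e1 : (Num.sqrt n%:R)^-1 * ((Xmx n w)^T *m Xmx n w) a b =
    rsum n (fun j => Xent j a w * Xent j b w).
  by rewrite mxE; congr (_ * _); apply: eq_bigr => j _; rewrite mxE !XmxE.
have e2 : Num.sqrt n%:R * SigmaX (Mn n) spsi sdelta a b =
    rsum n (fun j => M j a * M j b + (spsi ^+ 2 + sdelta ^+ 2) * (a == b)%:R).
  rewrite -rsumD rsum_cst /SigmaX !mxE !mulrDr mulrA sqrt_mean -(mulr_natr (spsi ^+ 2)) -(mulr_natr (sdelta ^+ 2)) -addrA -mulrDr mulrDl.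
  by congr (_ * _ + _); apply: eq_bigr => j _; rewrite !mxE.
rewrite /Hn /Hmx [LHS]mxE mxE [X in _ + X]mxE [X in _ - X]mxE e1 e2.
by rewrite -mulN1r rsumZ rsumD; apply: eq_rsum => j; rewrite mulN1r.
Qed.

(** X_a X_b - M_a M_b = M_b (psi_a + delta_a) + X_a (psi_b + delta_b), and the variance terms of
    [SigmaX] are exactly the centering. *)
Lemma asylin_H a b : asylin (fun n w => Hn n w a b).
Proof.
have := asylinD (asylinD (asylin_weight b (inl (inl a))) (asylin_weight b (inl (inr a))))
  (asylinD (asylin_X a (inl (inl b))) (asylin_X a (inl (inr b)))).
rewrite (_ : (fun n w => _) = fun n w => Hn n w a b)//.
apply/funext => n; apply/funext => w; rewrite !rsumD Hn_entry; apply: eq_rsum => j.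
rewrite /Xent /=; ring.
Qed.

Lemma hn_entry n w a b : hn n w a b = rsum n (fun j =>
  Xent j a w * (eps j b w - \sum_c delta j c w * B n c b) + sdelta ^+ 2 * B n a b).
Proof.
have e1 : (Num.sqrt n%:R)^-1 * ((Xmx n w)^T *m (random_array_mx eps n w -
      random_array_mx delta n w *m B n)) a b =
    rsum n (fun j => Xent j a w * (eps j b w - \sum_c delta j c w * B n c b)).
  rewrite mxE; congr (_ * _); apply: eq_bigr => j _; rewrite mxE XmxE [in LHS]mxE !mxE.
  by congr (_ * (_ - _)); apply: eq_bigr => c _; rewrite !mxE.
rewrite /hn /hmx [LHS]mxE mxE [X in _ + X]mxE e1 -rsumD; congr (_ + _).
by rewrite rsum_cst -[LHS]mulrA.
Qed.

(** The drift sdelta^2 B of [h] is the centering of the products of X_a and delta_c, present only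
    for c = a; the entries of [B n] act as convergent weights. *)
Lemma asylin_h a b : asylin (fun n w => hn n w a b).
Proof.
have nB c : - B n c b @[n --> \oo] --> - Blim c b by apply: cvgN; exact: cvg_B.
have := asylinD (asylin_X a (inr b))
  (asylin_sum (index_enum 'I_p) (fun c => asylinZ (nB c) (asylin_X a (inl (inr c))))).
rewrite (_ : (fun n w => _) = fun n w => hn n w a b)//.
apply/funext => n; apply/funext => w; rewrite hn_entry.
under eq_bigr do rewrite rsumZ.
rewrite rsum_sum rsumD; apply: eq_rsum => j /=.
have -> : sdelta ^+ 2 * B n a b = \sum_c B n c b * ((a == c)%:R * sdelta ^+ 2).
  rewrite (bigD1 a)//= eqxx mul1r mulrC big1 ?addr0// => c.
  by rewrite eq_sym => /negPf->; rewrite mul0r mulr0.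
rewrite mulrBr mulr_sumr -!addrA; congr (_ + _).
rewrite !mul0r addr0 oppr0 add0r -sumrN -big_split/=; apply: eq_bigr => c _.
have -> : (inl (inr a) == inl (inr c) :> V) = (a == c) by [].
ring.
Qed.

Local Notation S := (Sigma sigmaM spsi sdelta).

Lemma cvg_MM : mcvg \oo (fun n => n%:R^-1 *: ((Mn n)^T *m Mn n)) (sigmaM *m sigmaM^T).
Proof.
move=> a b.
have h : M j a * M j b @[j --> \oo] --> sigmaM a 0 * sigmaM b 0 by exact: cvgM.
have {}h := cvg_mean h.
rewrite (_ : (fun n => _) = fun n => n%:R^-1 * \sum_(j < n) (M j a * M j b)); last first.
  by apply/funext => n; rewrite !mxE; congr (_ * _); apply: eq_bigr => j _; rewrite !mxE.
by rewrite mxE big_ord1 mxE.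
Qed.

Lemma cvg_SigmaD : mcvg \oo (fun n => SigmaD (Mn n) spsi) (S - (sdelta ^+ 2)%:M).
Proof. by rewrite /Sigma addrK; apply: mcvgD; [exact: cvg_MM|exact: mcvg_cst]. Qed.

Lemma cvg_SigmaX : mcvg \oo (fun n => SigmaX (Mn n) spsi sdelta) S.
Proof.
by apply: mcvgD; [apply: mcvgD; [exact: cvg_MM|exact: mcvg_cst]|exact: mcvg_cst].
Qed.

Lemma cvg_KX : mcvg \oo (fun n => KX (Mn n) spsi sdelta) (Kmx sigmaM spsi sdelta).
Proof. by apply: mcvg_mul; [exact: mcvg_inv cvg_SigmaX Su|exact: cvg_SigmaD]. Qed.

Lemma cvg_KbarX : exists L, mcvg \oo (fun n => KbarX (Mn n) spsi sdelta) L.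
Proof.
eexists; apply: mcvg_mul; last exact: mcvg_inv cvg_SigmaX Su.
by apply: mcvgB; [exact: cvg_SigmaX|exact: cvg_SigmaD].
Qed.

Lemma asylin_U a b : asylin (fun n w => Un n w a b).
Proof.
have [L hL] := cvg_KbarX.
have /(_ _) hk := mcvg_mul (mcvg_tr cvg_B) hL.
have := asylinD (asylin_h a b) (asylin_sum (index_enum 'I_p)
  (fun c => asylinZ (hk b c) (asylin_H c a))).
rewrite (_ : (fun n w => _) = fun n w => Un n w a b)//.
by apply/funext => n; apply/funext => w; rewrite !mxE.
Qed.

Lemma asylin_stoch_bounded Q : asylin Q -> stoch_bounded P (fun x => Q x.1 x.2).
Proof.
move=> [c h] e e0.
have [L L0 hL] := asymp_tight indy hrow hsqr h0 hG h e0.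
have [mQ _ _] := h; exists L => //; rewrite /wp; apply: filterS hL => n PL.
exists [set w | L <= `|Q n w|]; split => //; first exact: measurable_norm_ge.
by move=> w /negP; rewrite -ltNge => /ltW.
Qed.

Lemma Un_bounded a b : stoch_bounded P (fun x => Un x.1 x.2 a b).
Proof. exact: asylin_stoch_bounded (asylin_U a b). Qed.

Lemma random_Un n : random_mx (Un n).
Proof. by move=> a b; have [c [mU _ _]] := asylin_U a b; exact: mU. Qed.

(** X'X / n = SigmaX + n^(-1/2) H by definition of [H], and [H] is bounded in probability. *)
Lemma cvg_XX : mcvg (whp P) (fun x => x.1%:R^-1 *: ((Xmx x.1 x.2)^T *m Xmx x.1 x.2)) S.
Proof.
have h1 : mcvg (whp P) (fun x => SigmaX (Mn x.1) spsi sdelta) S.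
  exact: (mcvg_whp P cvg_SigmaX).
have h2 : mcvg (whp P) (fun x => (Num.sqrt x.1%:R)^-1 *: Hn x.1 x.2) 0.
  move=> a b; rewrite mxE.
  have c0 : (Num.sqrt x.1%:R)^-1 @[x --> whp P] --> (0 : R).
    exact: (cvg_comp _ _ (@whp_fst _ _ _ P) (@cvg_invsqrtn R)).
  have := cvg_mul_bounded c0 (asylin_stoch_bounded (asylin_H a b)).
  by rewrite (_ : (fun x : nat * T => _) = fun x => ((Num.sqrt x.1%:R)^-1 *: Hn x.1 x.2) a b)//;
    apply/funext => x; rewrite [RHS]mxE.
have := mcvgD h1 h2; rewrite addr0 => /(_ _) h; apply: mcvg_near h _.
near=> x; have n0 : (0 < x.1)%N by near: x; exact: (@whp_near _ _ _ P (fun n => (0 < n)%N) (nbhs_infty_gt 0)).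
have n0' : Num.sqrt x.1%:R != 0 :> R by rewrite gt_eqF// sqrtr_gt0 ltr0n.
by rewrite /Hn /Hmx scalerBr !scalerA mulVf// scale1r addrC subrK -invfM -expr2 sqr_sqrtr.
Unshelve. all: by end_near. Qed.

(** [Lam] is the Gram matrix of the coefficient vectors under [quad], hence symmetric and positive
    semidefinite. Any linear combination of the entries is again asymptotically linear, which gives
    the joint law in the Cramér-Wold manner. *)
Lemma Un_law : exists Lam : 'M[R]_(p * q),
  [/\ mcvg \oo (fun n => second_moment_mx P (fun w => vec (Un n w))) Lam,
      Lam^T = Lam,
      forall t : 'rV[R]_(p * q), 0 <= (t *m Lam *m t^T) 0 0 &
      forall (t : 'rV[R]_(p * q)) (a : R),
        Ex P (fun w => cos (a + (t *m vec (Un n w)) 0 0)) @[n --> \oo] -->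
        expR (- ((t *m Lam *m t^T) 0 0 / 2)) * cos a].
Proof.
have /choice[c hc] : forall k : 'I_(p * q), exists c, asy (fun n w => vec (Un n w) k 0) c.
  move=> k; have [c h] := asylin_U (mxtens_unindex k).1 (mxtens_unindex k).2.
  by exists c; under eq_fun => n do under eq_fun => w do rewrite mxE.
pose Lam : 'M[R]_(p * q) := \matrix_(k, l) quad G (c k) (c l).
have quadE t : (t *m Lam *m t^T) 0 0 =
    quad G (fun f => \sum_k t 0 k * c k f) (fun f => \sum_k t 0 k * c k f).
  rewrite quad_sum mxE exchange_big/=; apply: eq_bigr => l _.
  rewrite !mxE mulr_suml; apply: eq_bigr => k _; rewrite mxE.
  by rewrite mulrAC.
exists Lam; split.
- move=> k l; rewrite mxE.
  have := asymp_prod indy hrow hsqr h0 hG (hc k) (hc l).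
  rewrite (_ : (fun n => _) = fun n => second_moment_mx P (fun w => vec (Un n w)) k l)//.
  apply/funext => n; rewrite [RHS]mxE -Ex_expectation; congr Ex; apply/funext => w.
  by rewrite [RHS]mxE big_ord1; congr (_ * _); rewrite [RHS]mxE.
- by apply/matrixP => k l; rewrite !mxE (quad_sym hrow hsqr hG).
- by move=> t; rewrite quadE; exact: (quad_ge0 hrow hsqr hG).
- move=> t a; rewrite quadE.
  have ht k : asy (fun n w => t 0 k * vec (Un n w) k 0) (fun f => t 0 k * c k f).
    have ct : (fun=> t 0 k) @ \oo --> t 0 k by exact: cvg_cst.
    exact: (asympZ indy hrow hsqr h0 hG ct (hc k)).
  have := @asymp_law _ _ _ _ _ _ _ indy _ _ _ hrow hsqr h0 hG hlind _ _ a
    (asymp_sum indy hrow hsqr h0 hG (index_enum 'I_(p * q)) ht).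
  rewrite (_ : (fun n => _) = fun n => Ex P (fun w => cos (a + (t *m vec (Un n w)) 0 0)))//.
  by apply/funext => n; congr Ex; apply/funext => w; rewrite [in RHS]mxE.
Qed.

End Model.

(** * Limit law of the estimators *)

Section MatrixAlgebra.
Context {R : realType}.

Lemma invmx_mulmx n (A C : 'M[R]_n) : A \in unitmx -> C \in unitmx ->
  invmx (A *m C) = invmx C *m invmx A.
Proof.
move=> uA uC; have uAC : A *m C \in unitmx by rewrite unitmx_mul uA.
by rewrite -[RHS](mulmxK uAC) !mulmxA (mulmxKV uA) mulVmx// mul1mx.
Qed.

Lemma SigmaX_sym n p (M : 'M[R]_(n, p)) spsi sdelta :
  (SigmaX M spsi sdelta)^T = SigmaX M spsi sdelta.
Proof. by rewrite /SigmaX !linearD linearZ/= !tr_scalar_mx trmx_mul trmxK. Qed.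

Lemma gainZ p r (c : R) (G : 'M[R]_p) (A : 'M[R]_(r, p)) : c != 0 ->
  A *m G *m A^T \in unitmx -> gain (c *: G) A = gain G A.
Proof.
move=> c0 u; rewrite /gain -!(scalemxAl, scalemxAr) invmxZ; last first.
  by rewrite unitmxZ// unitfE.
by rewrite -!(scalemxAl, scalemxAr) scalerA divff// scale1r.
Qed.

(** The transpose of [KbarX] is sdelta^2 SigmaX^-1 = 1 - K. Hence in h + H KbarX' B the terms of
    order sqrt n cancel, and what remains is n^(-1/2) (X'Z - X'X K B). *)
Lemma Bhat1_dev n p q (M X Delta : 'M[R]_(n, p)) (D : 'M[R]_(n, p)) (E : 'M[R]_(n, q))
    (B : 'M[R]_(p, q)) (spsi sdelta : R) :
  (0 < n)%N -> X = D + Delta -> SigmaX M spsi sdelta \in unitmx ->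
  KX M spsi sdelta \in unitmx -> X^T *m X \in unitmx ->
  Num.sqrt n%:R *: (Bhat1 (KX M spsi sdelta) X (D *m B + E) - B) =
  invmx (KX M spsi sdelta) *m invmx (n%:R^-1 *: (X^T *m X)) *m
  ((hmx X Delta E B sdelta)^T + B^T *m KbarX M spsi sdelta *m Hmx M X spsi sdelta)^T.
Proof.
move=> n0 XD Su Ku XXu.
set K := KX M spsi sdelta; set S := SigmaX M spsi sdelta in Su *.
have nn0 : n%:R != 0 :> R by rewrite pnatr_eq0 -lt0n.
have sn0 : Num.sqrt n%:R != 0 :> R by rewrite gt_eqF// sqrtr_gt0 ltr0n.
have SDE : SigmaD M spsi = S - (sdelta ^+ 2)%:M by rewrite /S /SigmaX addrK.
have KE : sdelta ^+ 2 *: invmx S = 1%:M - K.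
  by rewrite /K /KX -/S SDE mulmxBr mulVmx// opprB addrC subrK mul_mx_scalar.
have HT : (Hmx M X spsi sdelta)^T = Hmx M X spsi sdelta.
  by rewrite /Hmx linearB !linearZ/= trmx_mul trmxK SigmaX_sym.
have KbT : (KbarX M spsi sdelta)^T = sdelta ^+ 2 *: invmx S.
  rewrite /KbarX -/S SDE opprB addrC subrK mul_scalar_mx linearZ/= trmx_inv.
  by rewrite SigmaX_sym.
rewrite [(_ + _)^T]linearD/= (trmx_mul (B^T *m _)) (trmx_mul B^T) !trmxK HT KbT mulmxA.
have e1 : Num.sqrt n%:R *: S *m (sdelta ^+ 2 *: invmx S) *m B =
    (Num.sqrt n%:R * sdelta ^+ 2) *: B.
  by rewrite -!(scalemxAl, scalemxAr) scalerA mulmxV// mul1mx mulrC.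
have e2 : (Num.sqrt n%:R)^-1 *: (X^T *m (E - Delta *m B)) +
    (Num.sqrt n%:R)^-1 *: (X^T *m X *m B) = (Num.sqrt n%:R)^-1 *: (X^T *m (D *m B + E)).
  rewrite -scalerDr -mulmxA -mulmxDr; congr (_ *: (_ *m _)).
  by rewrite XD mulmxDl addrC -addrA [_ + (E - _)]addrC subrK.
have -> : hmx X Delta E B sdelta + Hmx M X spsi sdelta *m (sdelta ^+ 2 *: invmx S) *m B =
    (Num.sqrt n%:R)^-1 *: (X^T *m (D *m B + E)) -
    (Num.sqrt n%:R)^-1 *: (X^T *m X *m K *m B).
  have e4 : (Num.sqrt n%:R)^-1 *: (X^T *m X) *m (sdelta ^+ 2 *: invmx S) *m B =
      (Num.sqrt n%:R)^-1 *: (X^T *m X *m B) - (Num.sqrt n%:R)^-1 *: (X^T *m X *m K *m B).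
    by rewrite KE mulmxBr mulmx1 mulmxBl -!scalemxAl.
  rewrite -e2 /Hmx -/S [_ *m (_ *: _)]mulmxBl mulmxBl e1 e4 /hmx.
  by rewrite addrACA subrr addr0 addrA.
have W : invmx (n%:R^-1 *: (X^T *m X)) = n%:R *: invmx (X^T *m X).
  by rewrite invmxZ ?invrK// unitmxZ// unitfE invr_eq0.
have e3 : Num.sqrt n%:R = n%:R / Num.sqrt n%:R :> R.
  by rewrite -{2}(sqr_sqrtr (ler0n R n)) expr2 mulfK.
rewrite W -scalerBr -!(scalemxAl, scalemxAr) scalerA [_^-1 * _]mulrC -e3 mulmxBr.
congr (_ *: (_ - _)); first by rewrite /Bhat1 !mulmxA.
have F (L Q : 'M[R]_p) : L \in unitmx -> Q \in unitmx -> invmx L *m invmx Q *m (Q *m L *m B) = B.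
  by move=> Lu Qu; rewrite !mulmxA mulmxKV// mulVmx// mul1mx.
by rewrite F.
Qed.

(** R1 B1 R2 - theta is R1 (B1 - B) R2 plus theta0 / sqrt n, so after scaling the local alternative
    is the constant shift [theta0]. *)
Lemma restricted_dev n p q r1 r2 (W : 'M[R]_(p, r1)) (R1 : 'M[R]_(r1, p)) (R2 : 'M[R]_(q, r2))
    (theta theta0 : 'M[R]_(r1, r2)) (B1 B : 'M[R]_(p, q)) : (0 < n)%N ->
  R1 *m B *m R2 = theta + (Num.sqrt n%:R)^-1 *: theta0 ->
  Num.sqrt n%:R *: (restricted W R1 R2 theta B1 - B) =
  Num.sqrt n%:R *: (B1 - B) - W *m (R1 *m (Num.sqrt n%:R *: (B1 - B)) *m R2 + theta0)
    *m invmx (R2^T *m R2) *m R2^T.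
Proof.
move=> n0 hB; have sn0 : Num.sqrt n%:R != 0 :> R by rewrite gt_eqF// sqrtr_gt0 ltr0n.
rewrite /restricted addrAC scalerBr; congr (_ - _).
have -> : R1 *m (Num.sqrt n%:R *: (B1 - B)) *m R2 + theta0 =
    Num.sqrt n%:R *: (R1 *m B1 *m R2 - theta).
  rewrite -scalemxAr -scalemxAl mulmxBr mulmxBl hB opprD addrA [RHS]scalerBr.
  by rewrite [in LHS]scalerBr scalerA divff// scale1r subrK scalerBr.
by rewrite -scalemxAr -!scalemxAl.
Qed.

End MatrixAlgebra.

Section LimitMap.
Context {R : realType} {p q r1 r2 : nat} (R1 : 'M[R]_(r1, p)) (R2 : 'M[R]_(q, r2))
  (theta0 : 'M[R]_(r1, r2)).

(** The map from the scaled error of the unrestricted estimator to that of the restricted one with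
    gain [W]; [W = 0] gives the unrestricted estimator itself. *)
Definition correct (W : 'M[R]_(p, r1)) (Q : 'M[R]_(p, q)) : 'M[R]_(p, q) :=
  Q - W *m (R1 *m Q *m R2 + theta0) *m invmx (R2^T *m R2) *m R2^T.

Definition correct_mean (W : 'M[R]_(p, r1)) : 'M[R]_(p, q) :=
  - (W *m theta0 *m invmx (R2^T *m R2) *m R2^T).

Definition correct_gain (G : 'M[R]_p) (W : 'M[R]_(p, r1)) : 'M[R]_(p * q) :=
  G *t (1%:M : 'M[R]_q) - (W *m R1 *m G) *t (R2 *m invmx (R2^T *m R2) *m R2^T).

Lemma correct0 Q : correct 0 Q = Q.
Proof. by rewrite /correct !mul0mx subr0. Qed.

(** The map is affine, and [vec_mulmx] reads off its matrix; the transpose required on the right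
    factor disappears because the projection onto the range of R2 is symmetric. *)
Lemma vec_correct G W U :
  vec (correct W (G *m U)) = correct_gain G W *m vec U + vec (correct_mean W).
Proof.
have vD a b (A C : 'M[R]_(a, b)) : vec (A + C) = vec A + vec C.
  by apply/colP => k; rewrite !mxE.
have PT : (R2 *m invmx (R2^T *m R2) *m R2^T)^T = R2 *m invmx (R2^T *m R2) *m R2^T.
  by rewrite !trmx_mul trmxK trmx_inv trmx_mul trmxK mulmxA.
rewrite /correct_gain -{1}PT -{1}(trmx1 R q) mulmxBl -!vec_mulmx mulmx1.
rewrite /correct /correct_mean mulmxDr !mulmxDl opprD !vD addrA; congr (_ + _).
have vN a b (A : 'M[R]_(a, b)) : vec (- A) = - vec A by apply/colP => k; rewrite !mxE.
by rewrite vN !mulmxA.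
Qed.

Context {d} {T : measurableType d} (P : probability T R).

(** The difference telescopes into terms that each contain a coefficient error tending to 0 in
    probability, multiplied by convergent factors and at most one bounded [U]. *)
Lemma mcvg_correct (Wn : nat * T -> 'M[R]_(p, r1)) (Gn : nat * T -> 'M[R]_p)
    (U : nat * T -> 'M[R]_(p, q)) W G :
  mcvg (whp P) Wn W -> mcvg (whp P) Gn G ->
  (forall i j, stoch_bounded P (fun x => U x i j)) ->
  mcvg (whp P) (fun x => correct (Wn x) (Gn x *m U x) - correct W (G *m U x)) 0.
Proof.
move=> hW hG hU.
pose J := invmx (R2^T *m R2) *m R2^T.
have sub0 a b (A : nat * T -> 'M[R]_(a, b)) l : mcvg (whp P) A l -> mcvg (whp P) (fun x => A x - l) 0.
  by move=> h; rewrite -(subrr l); apply: mcvgB => //; exact: mcvg_cst.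
have h1 : mcvg (whp P) (fun x => (Gn x - G) *m U x) 0.
  by apply: mcvg_mul_bounded => //; exact: sub0.
have h2 : mcvg (whp P) (fun x => Wn x *m R1 *m ((Gn x - G) *m U x) *m R2 *m J) 0.
  rewrite -(mul0mx _ J) -[X in X *m J](mul0mx _ R2) -[X in X *m R2](mulmx0 _ (W *m R1)).
  apply: mcvg_mul; last exact: mcvg_cst.
  apply: mcvg_mul; last exact: mcvg_cst.
  by apply: mcvg_mul => //; apply: mcvg_mul => //; exact: mcvg_cst.
have h3 : mcvg (whp P) (fun x => ((Wn x - W) *m R1 *m G) *m U x *m R2 *m J) 0.
  rewrite -(mul0mx _ J) -[X in X *m J](mul0mx _ R2).
  apply: mcvg_mul; last exact: mcvg_cst.
  apply: mcvg_mul; last exact: mcvg_cst.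
  apply: mcvg_mul_bounded => //.
  rewrite -(mul0mx _ G) -[X in X *m G](mul0mx _ R1).
  apply: mcvg_mul; last exact: mcvg_cst.
  by apply: mcvg_mul; [exact: sub0|exact: mcvg_cst].
have h4 : mcvg (whp P) (fun x => (Wn x - W) *m theta0 *m J) 0.
  rewrite -(mul0mx _ J) -[X in X *m J](mul0mx _ theta0).
  apply: mcvg_mul; last exact: mcvg_cst.
  by apply: mcvg_mul; [exact: sub0|exact: mcvg_cst].
have := mcvgB (mcvgB (mcvgB h1 h2) h3) h4; rewrite !subr0 => /(_ _ _ _) h.
apply: mcvg_near h _; apply: nearW => x.
have E (a b x1 x2 x3 t1 t2 : 'M[R]_(p, q)) :
    a - b - (x1 - x2) - (x2 - x3) - (t1 - t2) = a - (x1 + t1) - (b - (x3 + t2)).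
  by apply/matrixP => i j; rewrite !mxE; ring.
rewrite /correct -!(mulmxA _ (invmx _)) -/J.
rewrite !(mulmxBl, mulmxBr, mulmxDl, mulmxDr) !mulmxA.
exact: E.
Qed.

End LimitMap.

Section Blocks.
Context {R : realType}.

Lemma castmx_affine m m' n (e : m = m') (C : 'M[R]_(m, n)) (v : 'cV[R]_n) (w : 'cV[R]_m) :
  castmx (e, erefl 1%N) (C *m v + w) =
  castmx (e, erefl n) C *m v + castmx (e, erefl 1%N) w.
Proof. by case: m' / e; rewrite !castmx_id. Qed.

Lemma castmx_conj m m' n (e : m = m') (C : 'M[R]_(m, n)) (L : 'M[R]_n) :
  castmx (e, e) (C *m L *m C^T) = castmx (e, erefl n) C *m L *m (castmx (e, erefl n) C)^T.
Proof. by case: m' / e; rewrite !castmx_id. Qed.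

Lemma col4_affine a b c (A1 A2 A3 A4 : 'M[R]_(a, b)) (v : 'M[R]_(b, c)) (w1 w2 w3 w4 : 'M[R]_(a, c)) :
  col4 (A1 *m v + w1) (A2 *m v + w2) (A3 *m v + w3) (A4 *m v + w4) =
  col4 A1 A2 A3 A4 *m v + col4 w1 w2 w3 w4.
Proof. by rewrite /col4 !mul_col_mx !add_col_mx. Qed.

Lemma block4_conj a b (A : 'I_4 -> 'M[R]_(a, b)) (L : 'M[R]_b) :
  block4 (fun i j => A i *m L *m (A j)^T) =
  col4 (A 0) (A 1) (A 2%:R) (A 3%:R) *m L *m (col4 (A 0) (A 1) (A 2%:R) (A 3%:R))^T.
Proof.
by rewrite /block4 /col4 /row4 !mul_col_mx !tr_col_mx !mul_mx_row.
Qed.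

Lemma dotvE m (t x : 'rV[R]_m) : dotv t x = (t *m x^T) 0 0.
Proof. by rewrite mxE; apply: eq_bigr => i _; rewrite mxE. Qed.

Definition unvec a b (v : 'rV[R]_(a * b)) : 'M[R]_(a, b) :=
  \matrix_(i, j) v 0 (mxtens_index (i, j)).

Lemma vecK a b (Y : 'M[R]_(a, b)) : unvec (vec Y)^T = Y.
Proof. by apply/matrixP => i j; rewrite !mxE mxtens_indexK. Qed.

Lemma continuous_unvec a b : continuous (@unvec a b).
Proof.
move=> v; apply: (cvg_mx (F := nbhs v)) => i j; rewrite mxE.
under eq_fun do rewrite mxE.
exact: coord_continuous.
Qed.

End Blocks.

Section LimitLaw.
Context {R : realType}.

(** The covariance form is split into squares, realized by [gaussian_exists] and shifted by [m]. The
    cosine transform is returned together with normality, as it is what convergence is tested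
    against. *)
Lemma normal_mx_exists a b (m : 'M[R]_(a, b)) (Omega : 'M[R]_(a * b)) :
  Omega^T = Omega -> (forall t : 'rV[R]_(a * b), 0 <= (t *m Omega *m t^T) 0 0) ->
  exists d (T : measurableType d) (P : probability T R) (eta : T -> 'M[R]_(a, b)),
    normal_mx P eta m Omega /\
    forall (x : R) (t : 'rV[R]_(a * b)), Ex P (fun w => cos (x + dotv t (vec (eta w))^T)) =
      expR (- ((t *m Omega *m t^T) 0 0 / 2)) * cos (x + (t *m vec m) 0 0).
Proof.
move=> Osym Opsd; have [cs hcs] := psd_sum_of_squares Osym Opsd.
have [d [T [P [G [mG hG]]]]] := gaussian_exists cs.
pose eta w := m + unvec (G w).
have vE w : (vec (eta w))^T = (vec m)^T + G w.
  apply/rowP => k; rewrite !mxE -surjective_pairing mxtens_unindexK.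
  by congr (_ + _).
have law x t : Ex P (fun w => cos (x + dotv t (vec (eta w))^T)) =
    expR (- ((t *m Omega *m t^T) 0 0 / 2)) * cos (x + (t *m vec m) 0 0).
  rewrite hcs -hG; congr Ex; apply/funext => w.
  by rewrite vE -addrA !dotvE linearD/= trmxK mulmxDr [in LHS]mxE.
have meta : random_mx eta.
  by move=> i j; under eq_fun do rewrite !mxE; apply: measurable_funD => //; exact: mG.
exists d, T, P, eta; split; last exact: law.
split => // c; set v := (c^T *m _ *m _) 0 0.
have v0 : 0 <= v by have := Opsd c^T; rewrite trmxK.
split => //; apply: normal_law_cos => //.
  under eq_fun do rewrite mxE; apply: measurable_sum => k.
  by apply: measurable_funM => //; under eq_fun do rewrite mxE; exact: meta.
move=> x t; have := law x (t *: c^T).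
have -> : (t *: c^T)^T = t *: c by apply/colP => k; rewrite !mxE.
rewrite -!scalemxAl -!scalemxAr scalerA [X in expR (- (X / 2))]mxE.
rewrite [X in cos (x + X)]mxE -/v -expr2 [t ^+ 2 * v]mulrC => <-.
by congr Ex; apply/funext => w; rewrite dotvE trmxK -scalemxAl [in RHS]mxE.
Qed.

(** Matrices are flattened by [vec], whose inverse [unvec] is continuous, so test functions of
    matrices become test functions of row vectors. *)
Lemma cvg_in_dist_cos d (T : measurableType d) (P : probability T R)
    d' (T' : measurableType d') (P' : probability T' R) a b
    (Y : nat -> T -> 'M[R]_(a, b)) (eta : T' -> 'M[R]_(a, b)) :
  (forall n, random_mx (Y n)) -> random_mx eta ->
  (forall k, stoch_bounded P (fun x => vec (Y x.1 x.2) k 0)) ->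
  (forall (x : R) (t : 'rV[R]_(a * b)),
     Ex P (fun w => cos (x + dotv t (vec (Y n w))^T)) @[n --> \oo] -->
     Ex P' (fun w => cos (x + dotv t (vec (eta w))^T))) ->
  cvg_in_dist P P' Y eta.
Proof.
move=> mY meta tY hY; split => // f cf [C fC].
have rv d0 (T0 : measurableType d0) (Z : T0 -> 'M[R]_(a, b)) : random_mx Z ->
    random_mx (fun w => (vec (Z w))^T).
  by move=> mZ i k; under eq_fun do rewrite !mxE; exact: mZ.
pose g (v : 'rV[R]_(a * b)) := f (unvec v).
have cg : continuous g.
  by move=> v; apply: continuous_comp; [exact: continuous_unvec|exact: cf].
have gC v : `|g v| <= C by exact: fC.
have gE d0 (T0 : measurableType d0) (Z : T0 -> 'M[R]_(a, b)) :
    g \o (fun w => (vec (Z w))^T) = f \o Z.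
  by apply/funext => w; rewrite /g/= vecK.
have iZ d0 (T0 : measurableType d0) (P0 : probability T0 R) (Z : T0 -> 'M[R]_(a, b)) :
    random_mx Z -> integ P0 (f \o Z).
  move=> mZ; apply: (integ_bounded P0 (C := C)) => [|w]; last exact: fC.
  by have := measurable_bounded_continuous (rv _ _ _ mZ) cg gC; rewrite gE.
have tY' : tight P (fun n w => (vec (Y n w))^T).
  by apply: stoch_bounded_tight => k; under eq_fun do rewrite mxE; exact: tY.
have := cvg_in_law_cos (fun n => rv _ _ _ (mY n)) (rv _ _ _ meta) tY' hY cg gC.
rewrite gE; under eq_fun => n do rewrite gE.
move=> h; rewrite (expectationE (iZ _ _ _ _ meta)).
under eq_fun => n do rewrite (expectationE (iZ _ _ _ _ (mY n))).
exact: cvg_EFin'.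
Qed.

End LimitLaw.

Section DeltaMethod.
Context {R : realType} {d : measure_display} {T : measurableType d} (P : probability T R).

(** For every [t] the combination t . vec Y differs by o_P(1) from an affine function of [u], so its
    transform has the Gaussian limit with covariance A Lam A'; tightness comes from that of [u]. *)
Lemma affine_image_normal a b k (Y : nat -> T -> 'M[R]_(a, b)) (u : nat -> T -> 'cV[R]_k)
    (A : 'M[R]_(a * b, k)) (m : 'M[R]_(a, b)) (Lam : 'M[R]_k) :
  (forall n, random_mx (Y n)) -> (forall n, random_mx (u n)) ->
  (forall l, stoch_bounded P (fun x => u x.1 x.2 l 0)) ->
  Lam^T = Lam -> (forall t : 'rV[R]_k, 0 <= (t *m Lam *m t^T) 0 0) ->
  (forall (t : 'rV[R]_k) (x : R),
    Ex P (fun w => cos (x + (t *m u n w) 0 0)) @[n --> \oo] -->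
    expR (- ((t *m Lam *m t^T) 0 0 / 2)) * cos x) ->
  mcvg (whp P) (fun x => vec (Y x.1 x.2) - (A *m u x.1 x.2 + vec m)) 0 ->
  exists d' (T' : measurableType d') (P' : probability T' R) (eta : T' -> 'M[R]_(a, b)),
    normal_mx P' eta m (A *m Lam *m A^T) /\ cvg_in_dist P P' Y eta.
Proof.
move=> mY mu bu Lsym Lpsd Llaw hY.
have Osym : (A *m Lam *m A^T)^T = A *m Lam *m A^T.
  by rewrite !trmx_mul trmxK Lsym mulmxA.
have quadE (t : 'rV[R]_(a * b)) : t *m (A *m Lam *m A^T) *m t^T = t *m A *m Lam *m (t *m A)^T.
  by rewrite trmx_mul !mulmxA.
have [|d' [T' [P' [eta [Neta law]]]]] := normal_mx_exists m Osym.
  by move=> t; rewrite quadE; exact: Lpsd.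
exists d', T', P', eta; split => //; have [meta _ _] := Neta.
have mdot (t : 'rV[R]_(a * b)) n : measurable_fun setT (fun w => dotv t (vec (Y n w))^T).
  by apply: measurable_dotv => i l; under eq_fun do rewrite !mxE; exact: mY.
apply: cvg_in_dist_cos => // [l|x t].
  have bA : stoch_bounded P (fun x => (A *m u x.1 x.2 + vec m) l 0).
    under eq_fun do rewrite mxE [X in X + _]mxE.
    apply: stoch_boundedD; first by apply: stoch_bounded_sum => i; exact: stoch_boundedZ.
    by apply: (@stoch_bounded_cvg _ _ _ _ _ (vec m l 0)); exact: cvg_cst.
  have := stoch_boundedD (stoch_bounded_cvg (hY l 0)) bA.
  by rewrite (_ : (fun x => _) = fun x => vec (Y x.1 x.2) l 0)//; apply/funext => x; rewrite [X in X + _]mxE [X in _ + X + _]mxE subrK.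
rewrite law quadE.
apply: (@slutsky_cos _ _ _ _ _ (fun n w => (t *m vec m) 0 0 + (t *m A *m u n w) 0 0)) => //.
- move=> n; apply: measurable_funD => //; under eq_fun do rewrite mxE.
  by apply: measurable_sum => i; apply: measurable_funM => //; exact: mu.
- have h : \sum_l t 0 l * (vec (Y x.1 x.2) - (A *m u x.1 x.2 + vec m)) l 0
      @[x --> whp P] --> \sum_(l < a * b) t 0 l * 0.
    apply: cvg_sum_fin => l; apply: cvgM; first exact: cvg_cst.
    by have := hY l 0; rewrite mxE.
  rewrite big1 in h; last by move=> l _; rewrite mulr0.
  rewrite (_ : (fun z : nat * T => _) = fun z =>
    \sum_l t 0 l * (vec (Y z.1 z.2) - (A *m u z.1 z.2 + vec m)) l 0)//.
  apply/funext => z; transitivity ((t *m (vec (Y z.1 z.2) - (A *m u z.1 z.2 + vec m))) 0 0).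
    rewrite mulmxBr mulmxDr mulmxA dotvE trmxK [RHS]mxE [X in _ = _ + X]mxE.
    by rewrite [X in _ = _ - X]mxE [X in _ - X = _]addrC.
  by rewrite mxE.
- under eq_fun => n do under eq_fun => w do rewrite addrA.
  exact: Llaw.
Qed.

End DeltaMethod.

Lemma random_array k {R : realType} d (T : measurableType d) (P : probability T R)
    (X : nat -> 'I_k -> {RV P >-> R}) n : random_mx (random_array_mx X n).
Proof.
move=> i j; rewrite (_ : (fun w => _) = (X i j : T -> R))//.
by apply/funext => w; rewrite !mxE.
Qed.

Lemma random_restricted {R : realType} d (T : measurableType d) p q r1 r2
    (W : T -> 'M[R]_(p, r1)) (R1 : 'M[R]_(r1, p)) (R2 : 'M[R]_(q, r2)) (theta : 'M[R]_(r1, r2))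
    (B1 : T -> 'M[R]_(p, q)) : random_mx W -> random_mx B1 ->
  random_mx (fun w => restricted (W w) R1 R2 theta (B1 w)).
Proof.
move=> mW mB; apply: randomB => //.
do 2 (apply: random_mul; last exact: random_cst).
apply: random_mul => //; apply: randomB; last exact: random_cst.
apply: random_mul; last exact: random_cst.
by apply: random_mul => //; exact: random_cst.
Qed.

Lemma random_gain {R : realType} d (T : measurableType d) p r (G : T -> 'M[R]_p)
    (A : 'M[R]_(r, p)) : random_mx G -> random_mx (fun w => gain (G w) A).
Proof.
move=> mG; have mGA : random_mx (fun w => G w *m A^T).
  by apply: random_mul => //; exact: random_cst.
apply: random_mul => //; apply: random_inv; apply: random_mul; last exact: random_cst.
by apply: random_mul => //; exact: random_cst.
Qed.

Lemma mcvg_col4 {R : realType} {X : Type} (F : set_system X) {FF : Filter F} a b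
    (f1 f2 f3 f4 : X -> 'M[R]_(a, b)) l1 l2 l3 l4 :
  mcvg F f1 l1 -> mcvg F f2 l2 -> mcvg F f3 l3 -> mcvg F f4 l4 ->
  mcvg F (fun x => col4 (f1 x) (f2 x) (f3 x) (f4 x)) (col4 l1 l2 l3 l4).
Proof.
have col c c' (f : X -> 'M[R]_(c, b)) (g : X -> 'M[R]_(c', b)) l k : mcvg F f l -> mcvg F g k ->
    mcvg F (fun x => col_mx (f x) (g x)) (col_mx l k).
  move=> fl gk i j; under eq_fun do rewrite mxE; rewrite mxE.
  by case: (fintype.split i) => u; [exact: fl|exact: gk].
by move=> h1 h2 h3 h4; do 3 (apply: (col) => //).
Qed.

Theorem theorem3p3 (R : realType) (d : measure_display) (T : measurableType d)
    (P : probability T R) (p q r1 r2 : nat)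
    (B : nat -> 'M[R]_(p, q)) (M : nat -> 'I_p -> R)
    (eps : nat -> 'I_q -> {RV P >-> R})
    (delta psi : nat -> 'I_p -> {RV P >-> R})
    (R1 : 'M[R]_(r1, p)) (R2 : 'M[R]_(q, r2)) (theta theta0 : 'M[R]_(r1, r2))
    (seps g1eps g2eps sdelta g1delta g2delta spsi g1psi g2psi : R)
    (sigmaM : 'cV[R]_p) :
  let Mn n := array_mx M n in
  let E n w := random_array_mx eps n w in
  let Delta n w := random_array_mx delta n w in
  let Psi n w := random_array_mx psi n w in
  let D n w := Mn n + Psi n w in
  let X n w := D n w + Delta n w in
  let Z n w := D n w *m B n + E n w in
  let SX n := SigmaX (Mn n) spsi sdelta in
  let K_X n := KX (Mn n) spsi sdelta in
  let XXK n w := (X n w)^T *m X n w *m K_X n in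
  let S := Sigma sigmaM spsi sdelta in
  let K := Kmx sigmaM spsi sdelta in
  let SK := S *m K in
  let u n w :=
    uvec (Mn n) (X n w) (Delta n w) (E n w) (B n) spsi sdelta in
  let Lambda := lim_mx (fun n => second_moment_mx P (u n)) in
  let B1 n w := Bhat1 (K_X n) (X n w) (Z n w) in
  let B2 n w :=
    restricted (gain (invmx (XXK n w)) R1) R1 R2 theta (B1 n w) in
  let B3 n w :=
    restricted (gain (invmx ((X n w)^T *m X n w)) R1) R1 R2 theta (B1 n w) in
  let B4 n w := restricted (gain_id R1) R1 R2 theta (B1 n w) in
  let P2 := R2 *m invmx (R2^T *m R2) *m R2^T in
  let W2 := gain (invmx SK) R1 in
  let W3 := gain (invmx S) R1 in
  let W4 := gain_id R1 in
  let A1 := invmx SK *t (1%:M : 'M[R]_q) in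
  let A2 := A1 - (W2 *m R1 *m invmx SK) *t P2 in
  let A3 := A1 - (W3 *m R1 *m invmx SK) *t P2 in
  let A4 := A1 - (W4 *m R1 *m invmx SK) *t P2 in
  let A (i : 'I_4) := nth A1 [:: A1; A2; A3; A4] i in
  let mu W := - (W *m theta0 *m invmx (R2^T *m R2) *m R2^T) in
  independent_array eps ->
  (forall i j, has_moments P (eps i j) seps g1eps g2eps) ->
  iid_array delta ->
  (forall i j, has_moments P (delta i j) sdelta g1delta g2delta) ->
  iid_array psi ->
  (forall i j, has_moments P (psi i j) spsi g1psi g2psi) ->
  mutually_independent P (fun k : 'I_3 =>
    nth set0 [:: sigma_array delta; sigma_array psi; sigma_array eps] k) ->
  (\col_j M n j) @[n --> \oo] --> sigmaM ->
  cvgn B ->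
  {ae P, forall w, \forall n \near \oo, \rank (X n w) = p} ->
  \rank R1 = r1 ->
  \rank R2 = r2 ->
  (\forall n \near \oo, SX n \in unitmx /\ K_X n \in unitmx) ->
  {ae P, forall w, \forall n \near \oo,
    [/\ (X n w)^T *m X n w \in unitmx,
        XXK n w \in unitmx,
        R1 *m invmx (XXK n w) *m R1^T \in unitmx &
        R1 *m invmx ((X n w)^T *m X n w) *m R1^T \in unitmx]} ->
  S \in unitmx ->
  SK \in unitmx ->
  R1 *m invmx SK *m R1^T \in unitmx ->
  R1 *m invmx S *m R1^T \in unitmx ->
  R1 *m R1^T \in unitmx ->
  R2^T *m R2 \in unitmx ->
  (forall n, (0 < n)%N ->
    R1 *m B n *m R2 = theta + (Num.sqrt n%:R)^-1 *: theta0) ->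
  exists (d' : measure_display) (T' : measurableType d')
      (P' : probability T' R) (eta : T' -> 'M[R]_(p + (p + (p + p)), q)),
    normal_mx P' eta (col4 0 (mu W2) (mu W3) (mu W4))
      (block4_vec (fun i j => A i *m Lambda *m (A j)^T)) /\
    cvg_in_dist P P'
      (fun n w => col4 (Num.sqrt n%:R *: (B1 n w - B n))
                       (Num.sqrt n%:R *: (B2 n w - B n))
                       (Num.sqrt n%:R *: (B3 n w - B n))
                       (Num.sqrt n%:R *: (B4 n w - B n))) eta.
Proof.
move=> Mn E Delta Psi D X Z SX K_X XXK S K SK u Lambda B1 B2 B3 B4 P2 W2 W3 W4 A1 A2 A3 A4 A mu.
move=> ieps heps iiddelta hdelta iidpsi hpsi ind3 hM hB _ _ _ hunit _ Su SKu u2 u3 _ _ hlocal.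
have hM' a : M n a @[n --> \oo] --> sigmaM a 0.
  rewrite (_ : (fun n => _) = fun n => (\col_j M n j) a 0); first exact: cvg_mx_coord hM.
  by apply/funext => n; rewrite mxE.
have hB' : mcvg \oo B (limn B) by move=> i j; exact: cvg_mx_coord.
pose U n w := Un B M eps delta psi sdelta spsi n w.
have [Lam [LamE Lsym Lpsd Llaw]] :=
  Un_law ieps heps iiddelta hdelta iidpsi hpsi ind3 hM' hB' Su.
have bU i j : stoch_bounded P (fun x => U x.1 x.2 i j).
  exact: (Un_bounded ieps heps iiddelta hdelta iidpsi hpsi ind3 hM' hB' Su i j).
have mU n : random_mx (U n).
  exact: (random_Un ieps heps iiddelta hdelta iidpsi hpsi ind3 hM' hB' Su n).
(* Since the second moments converge entrywise, the default-valued [limn] in [lim_mx] is their true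
   limit. *)
have -> : Lambda = Lam.
  by apply/matrixP => i j; rewrite mxE; apply/cvg_lim => //; exact: LamE.
have hW : mcvg (whp P) (fun x => x.1%:R^-1 *: ((X x.1 x.2)^T *m X x.1 x.2)) S.
  exact: (cvg_XX ieps heps iiddelta hdelta iidpsi hpsi ind3 hM').
pose W (x : nat * T) := x.1%:R^-1 *: ((X x.1 x.2)^T *m X x.1 x.2).
have hK : mcvg (whp P) (fun x => K_X x.1) K.
  have h : mcvg \oo K_X K by apply: cvg_KX.
  exact (mcvg_whp P h).
have Ku : K \in unitmx by move: SKu; rewrite unitmx_mul => /andP[].
have hWK : mcvg (whp P) (fun x => W x *m K_X x.1) SK by exact: mcvg_mul.
(* The inverse of S K is K^-1 S^-1, the order in which [Bhat1_dev] produces the two factors. *)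
have hG : mcvg (whp P) (fun x => invmx (K_X x.1) *m invmx (W x)) (invmx SK).
  by rewrite invmx_mulmx//; apply: mcvg_mul; exact: mcvg_inv.
have hW2 : mcvg (whp P) (fun x => gain (invmx (W x *m K_X x.1)) R1) W2.
  by apply: mcvg_gain => //; exact: mcvg_inv.
have hW3 : mcvg (whp P) (fun x => gain (invmx (W x)) R1) W3.
  by apply: mcvg_gain => //; exact: mcvg_inv.
pose cor := correct R1 R2 theta0; pose G := invmx SK.
pose Y n w := col4 (Num.sqrt n%:R *: (B1 n w - B n)) (Num.sqrt n%:R *: (B2 n w - B n))
  (Num.sqrt n%:R *: (B3 n w - B n)) (Num.sqrt n%:R *: (B4 n w - B n)).
pose m : 'M[R]_(p + (p + (p + p)), q) := col4 0 (mu W2) (mu W3) (mu W4).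
pose C := castmx (mul4nDl p q, erefl (p * q)%N) (col4 A1 A2 A3 A4).
have -> : block4_vec (fun i j => A i *m Lam *m (A j)^T) = C *m Lam *m C^T.
  by rewrite /block4_vec block4_conj castmx_conj.
(* All four limit errors are affine in the same vec Q, so their joint covariance is C Lam C' with
   the stacked matrix [C]. *)
have limE (Q : 'M[R]_(p, q)) : vec (col4 (G *m Q) (cor W2 (G *m Q)) (cor W3 (G *m Q)) (cor W4 (G *m Q))) =
    C *m vec Q + vec m.
  have A1E : vec (G *m Q) = A1 *m vec Q + vec (0 : 'M[R]_(p, q)).
    rewrite -{1}[G *m Q]mulmx1 vec_mulmx trmx1.
    by rewrite (_ : vec 0 = 0) ?addr0//; apply/colP => k; rewrite !mxE.
  by rewrite !vec_col4 !vec_correct A1E col4_affine castmx_affine.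
have mX n : random_mx (X n).
  by apply: randomD; [apply: randomD; [exact: random_cst|exact: random_array]|exact: random_array].
have mXX n : random_mx (fun w => (X n w)^T *m X n w).
  by apply: random_mul => //; exact: random_tr.
have mB1 n : random_mx (B1 n).
  apply: random_mul; last first.
    apply: randomD; last exact: random_array.
    apply: random_mul; last exact: random_cst.
    by apply: randomD; [exact: random_cst|exact: random_array].
  apply: random_mul; last exact: random_tr.
  by apply: random_mul; [exact: random_cst|exact: random_inv].
have mdev n (Q : T -> 'M[R]_(p, q)) : random_mx Q ->
    random_mx (fun w => Num.sqrt n%:R *: (Q w - B n)).
  by move=> mQ; apply: randomZ; apply: randomB => //; exact: random_cst.
have mY n : random_mx (Y n).
  apply: random_col; first exact: mdev.
  apply: random_col.
    apply: mdev; apply: random_restricted => //; apply: random_gain; apply: random_inv.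
    by apply: random_mul => //; exact: random_cst.
  apply: random_col; apply: mdev; apply: random_restricted => //.
  by apply: random_gain; exact: random_inv.
(* It is enough to compare the estimators with the limit map applied to the same [U]: the difference
   must vanish in probability. *)
suff hY : mcvg (whp P) (fun x => Y x.1 x.2 - col4 (G *m U x.1 x.2) (cor W2 (G *m U x.1 x.2))
    (cor W3 (G *m U x.1 x.2)) (cor W4 (G *m U x.1 x.2))) 0.
  apply: (affine_image_normal (u := fun n w => vec (U n w)) (A := C) (m := m)) => //.
  - by move=> n i j; under eq_fun do rewrite mxE; exact: mU.
  - by move=> l; under eq_fun do rewrite mxE; exact: bU.
  - move=> k j; have := hY (mxtens_unindex k).1 (mxtens_unindex k).2; rewrite !mxE.
    rewrite (_ : (fun x : nat * T => _) = fun x => (vec (Y x.1 x.2) - (C *m vec (U x.1 x.2) + vec m)) k j)//.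
    by apply/funext => x; rewrite -limE [LHS]mxE [RHS]mxE; congr (_ + _); rewrite !mxE.
(* The unrestricted block is treated as the correction with zero gain. *)
have step0 : mcvg (whp P) (fun x => cor 0 (invmx (K_X x.1) *m invmx (W x) *m U x.1 x.2) -
    cor 0 (G *m U x.1 x.2)) 0.
  by apply: mcvg_correct => //; exact: mcvg_cst.
have step2 := mcvg_correct R1 R2 theta0 hW2 hG bU.
have step3 := mcvg_correct R1 R2 theta0 hW3 hG bU.
have hW4 : mcvg (whp P) (fun _ : nat * T => W4) W4 by exact: mcvg_cst.
have step4 := mcvg_correct R1 R2 theta0 hW4 hG bU.
have := mcvg_col4 step0 step2 step3 step4.
have -> : col4 0 0 0 0 = 0 :> 'M[R]_(p + (p + (p + p)), q) by rewrite /col4 !col_mx0.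
move=> /(_ _) h; apply: mcvg_near h _.
(* Invertibility holds with probability tending to 1 because the limits in probability are
   invertible and the determinant is continuous. *)
have uW : \forall x \near whp P, W x \in unitmx by exact: mcvg_unit hW Su.
have uWK : \forall x \near whp P, W x *m K_X x.1 \in unitmx by exact: mcvg_unit hWK SKu.
have cst_conj (Q : nat * T -> 'M[R]_p) L : mcvg (whp P) Q L -> L \in unitmx ->
    R1 *m invmx L *m R1^T \in unitmx ->
    \forall x \near whp P, R1 *m invmx (Q x) *m R1^T \in unitmx.
  move=> hQ Lu; apply: mcvg_unit; apply: mcvg_mul; last exact: mcvg_cst.
  by apply: mcvg_mul; [exact: mcvg_cst|exact: mcvg_inv].
have v2 := cst_conj _ _ hWK SKu u2; have v3 := cst_conj _ _ hW Su u3.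
near=> x.
have n0 : (0 < x.1)%N.
  by near: x; exact: (@whp_near _ _ _ P (fun n => (0 < n)%N) (nbhs_infty_gt 0)).
have [SXu KXu] : SX x.1 \in unitmx /\ K_X x.1 \in unitmx.
  by near: x; exact: (whp_near P hunit).
have Wu : W x \in unitmx by near: x.
have nn0 : x.1%:R != 0 :> R by rewrite pnatr_eq0 -lt0n.
have XXu : (X x.1 x.2)^T *m X x.1 x.2 \in unitmx.
  by move: Wu; rewrite /W unitmxZ// unitfE invr_eq0.
have dev1 : Num.sqrt x.1%:R *: (B1 x.1 x.2 - B x.1) =
    invmx (K_X x.1) *m invmx (W x) *m U x.1 x.2.
  exact: Bhat1_dev.
have XXE : (X x.1 x.2)^T *m X x.1 x.2 = x.1%:R *: W x.
  by rewrite /W scalerA divff// scale1r.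
have XXKE : XXK x.1 x.2 = x.1%:R *: (W x *m K_X x.1) by rewrite /XXK XXE scalemxAl.
have gE2 : gain (invmx (XXK x.1 x.2)) R1 = gain (invmx (W x *m K_X x.1)) R1.
  rewrite XXKE invmxZ; last by rewrite unitmxZ ?unitfE//; near: x.
  by rewrite gainZ ?invr_eq0//; near: x.
have gE3 : gain (invmx ((X x.1 x.2)^T *m X x.1 x.2)) R1 = gain (invmx (W x)) R1.
  rewrite XXE invmxZ; last by rewrite unitmxZ ?unitfE.
  by rewrite gainZ ?invr_eq0//; near: x.
(* On this event the scaled errors equal the correction maps with random gains exactly, so no
   remainder is left. *)
rewrite /Y /B2 /B3 /B4 !(restricted_dev _ _ n0 (hlocal _ n0)) dev1 gE2 gE3.
rewrite /cor !correct0 /correct /col4 !opp_col_mx !add_col_mx.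
by [].
Unshelve. all: by end_near. Qed.
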